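(* Let $(M,g,f)$ be an $n$-dimensional complete smooth metric measure space with scalar curvature $R$, and let $V\in L^\infty_{\mathrm{loc}}(M)$ be real-valued and bounded below with $e^{-4\tau V}\in L^1(M,d\mu)$ for some $\tau>0$, where $d\mu=(4\pi\tau)^{-\frac n2}e^{-f}d\upsilon$ is the weighted measure. Then the bottom of the spectrum of $$\mathcal{L}_f=-\Delta_f+V$$ on $L^2(M,d\mu)$ satisfies $$\lambda_0(\mathcal{L}_f)\ \geq\ -\frac{1}{4\tau}\ln\int_M e^{-4\tau V}\,d\mu+\frac{\mu(g,\tau)}{4\tau}+\frac{1}{4\tau}\inf_u\left\{\int_M(n-f-\tau R_f)\,u^2\,d\mu\right\},$$ where $R_f=R+|\nabla f|^2+2\Delta_f f$, $\mu(g,\tau)$ is Perelman's $\mu$-functional, and the infimum is taken over all functions $u\in C_c^\infty(M)$ with $\int_M u^2\,d\mu=1$.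
   Context: A complete smooth metric measure space $(M,g,f)$ is a complete connected $n$-dimensional Riemannian manifold $(M,g)$ equipped with the measure $e^{-f}d\upsilon$, where $f\in C^\infty(M)$ and $d\upsilon$ is the Riemannian volume measure of $g$. The drifted Laplacian is $\Delta_f=\Delta-\langle\nabla f,\nabla\,\cdot\,\rangle$, where $\Delta$ is the Laplace–Beltrami operator. The operator $-\Delta_f+V$ is understood as the self-adjoint operator on $L^2(M,d\mu)$ that is the closure of its restriction to $C_c^\infty(M)$, so that the bottom of its spectrum $\lambda_0(\mathcal{L}_f)$ is the infimum of $\int_M(|\nabla u|^2+Vu^2)\,d\mu$ over $u\in C_c^\infty(M)$ with $\int_M u^2\,d\mu=1$. Perelman's functionals: for $h\in C^\infty(M)$ and $\tau>0$, $$\mathcal{W}(g,h,\tau)=\int_M\left[\tau(R+|\nabla h|^2)+h-n\right](4\pi\tau)^{-\frac n2}e^{-h}\,d\upsilon,$$ and $$\mu(g,\tau)=\inf\left\{\mathcal{W}(g,h,\tau):\ h\in C^\infty(M),\ \int_M(4\pi\tau)^{-\frac n2}e^{-h}\,d\upsilon=1\right\}.$$ Writing $\phi^2=(4\pi\tau)^{-n/2}e^{-h}$, one has $\mathcal{W}(g,h,\tau)=\mathcal{K}(g,\phi,\tau)$ with $$\mathcal{K}(g,\phi,\tau)=\int_M\left(4\tau|\nabla\phi|^2+\tau R\phi^2-\phi^2\ln\phi^2\right)d\upsilon-n\left(1+\tfrac12\ln(4\pi\tau)\right),$$ and equivalently $\mu(g,\tau)=\inf\{\mathcal{K}(g,\phi,\tau):\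 \phi\in C^\infty(M),\ \int_M\phi^2\,d\upsilon=1\}$. The infima are not assumed to be finite (the bound is trivial if the right-hand side is $-\infty$). *)

(* Defs.v *)
From HB Require Import structures.
From mathcomp Require Import all_boot all_order all_algebra.
From mathcomp Require Import all_classical all_reals all_analysis.

Set Implicit Arguments.
Unset Strict Implicit.
Unset Printing Implicit Defensive.

Import Order.TTheory GRing.Theory Num.Theory.
Import numFieldTopology.Exports numFieldNormedType.Exports.

Local Open Scope classical_set_scope.
Local Open Scope ring_scope.

(** * Calculus in coordinates *)

Definition partial (R : realType) (n : nat) (i : 'I_n) (F : 'rV[R]_n -> R) :
    'rV[R]_n -> R :=
  fun x => 'D_(delta_mx 0 i) F x.

(** C^oo on A (used for open A only): the partial derivatives of all orders
    exist and are continuous at every point of A. *)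
Definition smooth_on (R : realType) (n : nat) (A : set 'rV[R]_n)
    (F : 'rV[R]_n -> R) : Prop :=
  forall (s : seq 'I_n) (x : 'rV[R]_n), A x ->
    let G := foldr (@partial R n) F s in
    {for x, continuous G} /\ forall i, derivable G x (delta_mx 0 i).

(** The n-dimensional Lebesgue integral as an iterated one-dimensional integral;
    by Tonelli the two agree on nonnegative Borel functions, and it is only used
    for those. *)
Fixpoint lebesgue_int (R : realType) (n : nat) :
    ('rV[R]_n -> \bar R) -> \bar R :=
  if n is n'.+1 then fun F =>
    (\int[@lebesgue_measure R]_t
       lebesgue_int (fun x : 'rV[R]_n' => F (row_mx (t : R)%:M x)))%E
  else fun F => F 0.

(** Christoffel symbols [christoffel G k i j] = Gamma^k_{ij}, Ricci tensor and
    scalar curvature of the metric with Gram matrix G; the signs are those for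
    which round spheres have positive scalar curvature. *)
Section Coordinates.
Variables (R : realType) (n : nat) (G : 'rV[R]_n -> 'M[R]_n).

Definition christoffel (k i j : 'I_n) (x : 'rV[R]_n) : R :=
  2^-1 * \sum_l invmx (G x) k l *
    (partial i (fun y => G y j l) x + partial j (fun y => G y i l) x
     - partial l (fun y => G y i j) x).

Definition ricci_coord (i j : 'I_n) (x : 'rV[R]_n) : R :=
  \sum_k (partial k (christoffel k i j) x - partial j (christoffel k i k) x)
  + \sum_k \sum_l (christoffel k k l x * christoffel l i j x
                   - christoffel k j l x * christoffel l i k x).

Definition scal_coord (x : 'rV[R]_n) : R :=
  \sum_i \sum_j invmx (G x) i j * ricci_coord i j x.

Definition inner_coord (F H : 'rV[R]_n -> R) (x : 'rV[R]_n) : R :=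
  \sum_i \sum_j invmx (G x) i j * partial i F x * partial j H x.

Definition laplace_coord (F : 'rV[R]_n -> R) (x : 'rV[R]_n) : R :=
  (Num.sqrt (\det (G x)))^-1 *
  \sum_i partial i (fun y =>
    \sum_j Num.sqrt (\det (G y)) * invmx (G y) i j * partial j F y) x.

End Coordinates.

(** * Riemannian manifolds *)

(** A smooth structure is given by an atlas indexed by the points of M, the
    chart [chart p] being defined on an open neighbourhood [chart_dom p] of p.
    M is pointed, hence nonempty; the point plays no other role. *)
Record manifold (R : realType) (n : nat) (M : ptopologicalType) := Manifold {
  manifold_hausdorff : hausdorff_space M ;
  manifold_second_countable : @second_countable M ;
  chart_dom : M -> set M ;
  chart : M -> M -> 'rV[R]_n ;
  chart_inv : M -> 'rV[R]_n -> M ;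
  chart_dom_open : forall p, open (chart_dom p) ;
  chart_dom_mem : forall p, chart_dom p p ;
  chart_img_open : forall p, open (chart p @` chart_dom p) ;
  chartK : forall p q, chart_dom p q -> chart_inv p (chart p q) = q ;
  chart_continuous : forall p q, chart_dom p q -> {for q, continuous (chart p)} ;
  chart_inv_continuous : forall p x, (chart p @` chart_dom p) x ->
    {for x, continuous (chart_inv p)} ;
  chart_transition : forall p q i,
    smooth_on (chart p @` (chart_dom p `&` chart_dom q))
      (fun x => chart q (chart_inv p x) 0 i)
}.

Definition transition_jacobian (R : realType) (n : nat) (M : ptopologicalType)
    (X : manifold R n M) (p q : M) (x : 'rV[R]_n) : 'M[R]_n :=
  \matrix_(i, j) partial i (fun y => chart X q (chart_inv X p y) 0 j) x.

(** A Riemannian metric, through its Gram matrices in the charts. *)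
Record metric (R : realType) (n : nat) (M : ptopologicalType)
    (X : manifold R n M) := Metric {
  gram : M -> 'rV[R]_n -> 'M[R]_n ;
  gram_smooth : forall p i j,
    smooth_on (chart X p @` chart_dom X p) (fun x => gram p x i j) ;
  gram_sym : forall p x, (chart X p @` chart_dom X p) x ->
    (gram p x)^T = gram p x ;
  gram_posdef : forall p x, (chart X p @` chart_dom X p) x ->
    forall v : 'rV[R]_n, v != 0 -> 0 < (v *m gram p x *m v^T) 0 0 ;
  gram_transition : forall p q x,
    (chart X p @` (chart_dom X p `&` chart_dom X q)) x ->
    gram p x = transition_jacobian X p q x *m
                 gram q (chart X q (chart_inv X p x)) *m
                 (transition_jacobian X p q x)^T
}.

Notation borel M := (g_sigma_algebraType (@open M)).

Section Riemannian.
Variables (R : realType) (n : nat) (M : ptopologicalType).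
Variables (X : manifold R n M) (g : metric X).

Definition smooth (u : M -> R) : Prop :=
  forall p, smooth_on (chart X p @` chart_dom X p) (u \o chart_inv X p).

Definition smooth_cpt (u : M -> R) : Prop :=
  smooth u /\ compact (closure [set x | u x != 0]).

Definition grad_inner (u v : M -> R) (p : M) : R :=
  inner_coord (gram g p) (u \o chart_inv X p) (v \o chart_inv X p)
    (chart X p p).

Definition laplacian (u : M -> R) (p : M) : R :=
  laplace_coord (gram g p) (u \o chart_inv X p) (chart X p p).

Definition drift_laplacian (f u : M -> R) (p : M) : R :=
  laplacian u p - grad_inner f u p.

(** [S] is the scalar curvature of [g]: it is given by the coordinate formula in
    every chart. *)
Definition is_scalar_curvature (S : M -> R) : Prop :=
  forall p q, chart_dom X p q -> S q = scal_coord (gram g p) (chart X p q).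

(** These conditions determine the measure: M is covered by countably many
    chart domains. *)
Definition is_riemannian_volume (vol : {measure set (borel M) -> \bar R}) :
    Prop :=
  forall p (A : set (borel M)), measurable A -> A `<=` chart_dom X p ->
    vol A = lebesgue_int (fun x : 'rV[R]_n =>
      (\1_(chart X p @` A) x * Num.sqrt (\det (gram g p x)))%:E).

(** Piecewise C^1 curves from p to q with their lengths, cut into finitely many
    C^1 pieces parametrised by [0, 1], each inside one chart domain (a C^1 map
    on [0, 1] extends to a C^1 map on R, so asking for the latter loses
    nothing). *)
Definition curve_speed (r : M) (c : R -> 'rV[R]_n) (t : R) : R :=
  let v : 'rV[R]_n := \row_i derive1 (fun s => c s 0 i) t in
  Num.sqrt ((v *m gram g r (c t) *m v^T) 0 0).

Inductive curve_length : M -> M -> R -> Prop :=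
| curve_nil p : curve_length p p 0
| curve_cons (r : M) (c : R -> 'rV[R]_n) (q : M) (l : R) :
    (forall i t, derivable (fun s => c s 0 i) t 1) ->
    (forall i, continuous (derive1 (fun s => c s 0 i))) ->
    (forall t, 0 <= t <= 1 -> (chart X r @` chart_dom X r) (c t)) ->
    curve_length (chart_inv X r (c 1)) q l ->
    curve_length (chart_inv X r (c 0)) q
      (\int[@lebesgue_measure R]_(t in `[0, 1]) curve_speed r c t + l).

Definition riemannian_dist (p q : M) : \bar R :=
  ereal_inf [set l%:E | l in curve_length p q].

Definition riemannian_complete : Prop :=
  forall x : nat -> M,
    (forall e : R, 0 < e -> exists N, forall i j, (N <= i)%N -> (N <= j)%N ->
       (riemannian_dist (x i) (x j) < e%:E)%E) ->
    exists l : M, x @ \oo --> l.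

(** Perelman's functionals. The infimum ranges over those h for which the
    integral W(g, h, tau) makes sense in [-oo, +oo]: it is not of the form
    oo - oo. *)
Section Perelman.
Variables (vol : {measure set (borel M) -> \bar R}) (S : M -> R) (tau : R).

Definition gauss_factor : R := (4 * pi * tau) `^ (- (n%:R / 2)).

Definition W_integrand (h : M -> R) (x : borel M) : \bar R :=
  ((tau * (S x + grad_inner h h x) + h x - n%:R)
     * (gauss_factor * expR (- h x)))%:E.

Definition W_functional (h : M -> R) : \bar R :=
  (\int[vol]_x W_integrand h x)%E.

Definition W_meaningful (h : M -> R) : Prop :=
  (\int[vol]_x (W_integrand h)^\+ x < +oo)%E \/
  (\int[vol]_x (W_integrand h)^\- x < +oo)%E.

Definition mu_functional : \bar R :=
  ereal_inf [set W_functional h | h in [set h : M -> R |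
    [/\ smooth h, (\int[vol]_x (gauss_factor * expR (- h x))%:E = 1)%E
      & W_meaningful h]]].

End Perelman.

(** [m] is the weighted measure (4 pi tau)^(-n/2) e^(-f) dvol. *)
Definition is_weighted_measure (vol : {measure set (borel M) -> \bar R})
    (f : M -> R) (tau : R) (m : {measure set (borel M) -> \bar R}) : Prop :=
  forall A : set (borel M), measurable A ->
    m A = (\int[vol]_(x in A) (gauss_factor tau * expR (- f x))%:E)%E.

Definition weighted_scalar_curvature (S f : M -> R) (x : M) : R :=
  S x + grad_inner f f x + 2 * drift_laplacian f f x.

Definition schrodinger (f V u : M -> R) (x : borel M) : R :=
  - drift_laplacian f u x + V x * u x.

Definition smooth_cpt_unit (m : {measure set (borel M) -> \bar R}) :
    set (M -> R) :=
  [set u | smooth_cpt u /\ (\int[m]_x (u x ^+ 2)%:E = 1)%E].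

(** The infimum of the quadratic form of [schrodinger f V] over normalised test
    functions. *)
Definition rayleigh_bottom (m : {measure set (borel M) -> \bar R})
    (V : M -> R) : \bar R :=
  ereal_inf [set (\int[m]_x (grad_inner u u x + V x * u x ^+ 2)%:E)%E
            | u in smooth_cpt_unit m].

(** V is in L^oo_loc. *)
Definition locally_essentially_bounded
    (vol : {measure set (borel M) -> \bar R}) (V : M -> R) : Prop :=
  measurable_fun [set: borel M] (V : borel M -> R) /\
  forall K : set M, compact K ->
    exists C : R, {ae vol, forall x, K x -> `|V x| <= C}.

Definition essentially_bounded_below
    (vol : {measure set (borel M) -> \bar R}) (V : M -> R) : Prop :=
  exists C : R, {ae vol, forall x, C <= V x}.

End Riemannian.

(** * Unbounded operators on L^2 *)

(** An operator on the real Hilbert space L^2(m) is represented by its graph, a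
    relation between square-integrable functions that is invariant under a.e.
    modification. *)
Section Operators.
Context (d : measure_display) (T : measurableType d) (R : realType).
Variable m : {measure set T -> \bar R}.

Definition L2 (u : T -> R) : Prop := u \in Lfun m 2%:E.

Definition L2_norm (u : T -> R) : \bar R := Lnorm m 2%:E (EFin \o u).

Definition operator_closure (D : set (T -> R)) (L : (T -> R) -> T -> R)
    (u v : T -> R) : Prop :=
  [/\ L2 u, L2 v & exists w : nat -> T -> R,
    [/\ forall k, D (w k),
        (fun k => L2_norm (w k \- u)) @ \oo --> 0%:E &
        (fun k => L2_norm (L (w k) \- v)) @ \oo --> 0%:E]].

(** A coincides with its adjoint; for a graph A that is single-valued this
    forces the domain of A to be dense. *)
Definition self_adjoint (A : (T -> R) -> (T -> R) -> Prop) : Prop :=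
  forall u v, L2 u -> L2 v ->
    (A u v <-> forall u' v', A u' v' ->
       (\int[m]_x (u' x * v x)%:E = \int[m]_x (v' x * u x)%:E)%E).

Definition resolvent_set (A : (T -> R) -> (T -> R) -> Prop) : set R :=
  [set l | (forall w, L2 w -> exists u, A u (fun x => w x + l * u x)) /\
           exists C : R, forall u v, A u v ->
             (L2_norm u <= C%:E * L2_norm (fun x => v x - l * u x)%R)%E].

(** Only the real part of the spectrum, which is all of it for a self-adjoint
    operator. *)
Definition real_spectrum (A : (T -> R) -> (T -> R) -> Prop) : set R :=
  ~` resolvent_set A.

Definition spectrum_bottom (A : (T -> R) -> (T -> R) -> Prop) : \bar R :=
  ereal_inf [set l%:E | l in real_spectrum A].

End Operators.

(* Main.v *)
(* For a normalised test function u put phi^2 = (4 pi tau)^(-n/2) e^-f u^2.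
   Integrating the cross term <grad u, grad f> by parts gives
     K(g, phi, tau) = 4 tau int |grad u|^2 dmu - int u^2 ln u^2 dmu
                      - int (n - f - tau R_f) u^2 dmu,
   and Jensen's inequality gives
     int u^2 ln u^2 dmu + 4 tau int V u^2 dmu >= - ln int e^(-4 tau V) dmu.
   Together with mu(g, tau) <= K(g, phi, tau) this bounds the Rayleigh quotient.
   The last inequality needs an argument because phi has compact support while
   the densities (4 pi tau)^(-n/2) e^-h are positive everywhere: (1 - eps) phi^2
   is completed by a locally finite sum of squares of tiny bumps, and the entropy
   of a sum of squares is at most the sum of the entropies, because
   phi^2 |-> |grad phi|^2 is subadditive and t ln t superadditive.

   The Laplacian is seen to be independent of the chart, and the divergence
   theorem is obtained globally, by testing against bumps; in a chart the theorem
   reduces to the translation invariance of Lebesgue measure.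

   If l lies below the infimum of the Rayleigh quotient, the operator minus l is
   bounded below on test functions. A sequence minimising ||(L - l) phi - w||
   then converges, and its residual is orthogonal to the range of L - l, hence,
   by self-adjointness, an eigenvector for l, hence zero: l is in the resolvent
   set. *)

From HB Require Import structures.
Require Import Defs.
From mathcomp Require Import all_boot all_order all_algebra.
From mathcomp Require Import all_classical all_reals all_analysis.
From mathcomp Require Import ring lra measurable_realfun.

Set Implicit Arguments.
Unset Strict Implicit.
Unset Printing Implicit Defensive.

Import Order.TTheory GRing.Theory Num.Theory.
Import numFieldTopology.Exports numFieldNormedType.Exports.
Local Open Scope classical_set_scope.
Local Open Scope ring_scope.

(** * Smooth functions in coordinates *)

(** The volume is prescribed only on subsets of chart domains, by iterated one-dimensional
    integrals. These are represented by a measure on coordinate space, so an integral over M is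
    computed only for integrands supported in one chart domain; global statements come from cutting
    the integrand with a locally finite family. Moreover [grad_inner] and [laplacian] are evaluated
    at each point in that point's own chart, so not even their continuity is visible before they are
    known to be chart independent. For the Laplacian, deducing this from the divergence theorem
    avoids second derivatives of transition maps.

    The completion of phi is affordable because for [0 < c <= 1] the entropy of [c * z] is at most
    [c] times a quantity independent of [c]: the logarithmic term [- c^2 ln c^2] is at most [2 c].
    The scale of each bump can therefore be chosen after its entropy is known, whatever the geometry
    at infinity.

    The functional W of the completed density may be [-oo]; it is only bounded above, through an
    integrable majorant, and this also makes it meaningful. *)

Section DirectionalDerivatives.
Variables (R : realType) (V : normedModType R).
Implicit Types (F G : V -> R) (x v : V).

(** Turns a directional derivative into a derivative in one variable, so that the chain rule and the
    mean value theorem on the real line become available. *)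
Lemma is_derive_lineP x v F l :
  is_derive x v F l <-> is_derive (0 : R) 1 (fun h : R => F (h *: v + x)) l.
Proof.
have D : 'D_v F x = 'D_1 (fun h : R => F (h *: v + x)) 0.
  rewrite /derive; set g1 := fun h => h^-1 *: _; set g2 := fun h => h^-1 *: _.
  suff -> : g1 = g2 by [].
  by rewrite funeqE /g1 /g2 => h /=; rewrite addr0 scale0r add0r [_%:A]mulr1.
split=> -[d e]; split.
- exact: (derivable1P _ _ _).1.
- by rewrite -D.
- exact: (derivable1P _ _ _).2.
- by rewrite D.
Qed.

Lemma is_derive_comp1 x v F l (phi : R -> R) d :
  is_derive x v F l -> is_derive (F x) 1 phi d ->
  is_derive x v (fun y => phi (F y)) (d * l).
Proof.
move=> /is_derive_lineP dF dphi; apply/is_derive_lineP.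
have {}dphi : is_derive (F (0 *: v + x)) 1 phi d by rewrite scale0r add0r.
by have := @is_derive1_comp R phi (fun h : R => F (h *: v + x)) 0 d l dphi dF.
Qed.

Lemma is_derive_mul x v F G l m : is_derive x v F l -> is_derive x v G m ->
  is_derive x v (fun y => F y * G y) (F x * m + G x * l).
Proof. by move=> dF dG; exact: (@is_deriveM _ _ F G x v l m). Qed.

Lemma is_derive_add x v F G l m : is_derive x v F l -> is_derive x v G m ->
  is_derive x v (fun y => F y + G y) (l + m).
Proof. by move=> dF dG; exact: (@is_deriveD _ _ _ F G x v l m). Qed.

Lemma is_derive_bigsum (I : Type) (r : seq I) (F : I -> V -> R) (l : I -> R) x v :
  (forall i, is_derive x v (F i) (l i)) ->
  is_derive x v (fun y => \sum_(i <- r) F i y) (\sum_(i <- r) l i).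
Proof.
move=> dF; elim: r => [|i r IH].
  have -> : (fun y => \sum_(i <- [::]) F i y) = cst 0.
    by apply/funext => y; rewrite big_nil.
  by rewrite big_nil; exact: is_derive_cst.
have -> : (fun y => \sum_(j <- i :: r) F j y) =
    (fun y => F i y + \sum_(j <- r) F j y).
  by apply/funext => y; rewrite big_cons.
by rewrite big_cons; exact: is_derive_add.
Qed.

End DirectionalDerivatives.

(** * The smooth profile from which bumps are built *)

Section BumpProfile.
Variable R : realType.

(** The derivative of [t^-m e^(-1/t)] is a combination of the same functions for
    [m + 1] and [m + 2], so this family is closed under differentiation. *)
Definition bump_profile (m : nat) (t : R) : R :=
  if 0 < t then t^-1 ^+ m * expR (- t^-1) else 0.

Lemma bump_profile_gt0 m t : 0 < t -> 0 < bump_profile m t.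
Proof.
by move=> t0; rewrite /bump_profile t0 mulr_gt0 ?expR_gt0 ?exprn_gt0 ?invr_gt0.
Qed.

Lemma bump_profile_ge0 m t : 0 <= bump_profile m t.
Proof.
rewrite /bump_profile; case: ifPn => // t0.
by rewrite mulr_ge0 ?expR_ge0 ?exprn_ge0 ?invr_ge0 ?ltW.
Qed.

Lemma bump_profile0 m t : t <= 0 -> bump_profile m t = 0.
Proof. by rewrite /bump_profile leNgt => /negbTE ->. Qed.

(** From [s^(m+2) / (m+2)! <= e^s] with [s = 1/t]. The square on the right is what makes the profile
    differentiable at the origin. *)
Lemma bump_profile_le m t : bump_profile m t <= (m.+2)`!%:R * t ^+ 2.
Proof.
have [t0|t0] := leP t 0.
  by rewrite bump_profile0// mulr_ge0// sqr_ge0.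
rewrite /bump_profile t0 expRN.
have ti0 : 0 < t^-1 by rewrite invr_gt0.
rewrite ler_pdivrMr ?expR_gt0//.
have H : t^-1 ^+ m.+2 / m.+2`!%:R <= expR t^-1.
  apply: le_trans (expR_ge1Dxn m.+1 (ltW ti0)).
  by rewrite lerDr.
have f0 : 0 < (m.+2)`!%:R :> R by rewrite ltr0n fact_gt0.
rewrite ler_pdivrMr// in H.
have -> : t^-1 ^+ m = t ^+ 2 * t^-1 ^+ m.+2.
  by rewrite -(addn2 m) exprD mulrCA -exprMn divff ?gt_eqF// expr1n mulr1.
have -> : m.+2`!%:R * t ^+ 2 * expR t^-1 = t ^+ 2 * (expR t^-1 * m.+2`!%:R).
  by ring.
by rewrite ler_wpM2l ?sqr_ge0.
Qed.

(** At the origin the quadratic bound of [bump_profile_le] makes the difference quotient at most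
    [(m+2)!] times [|h|]; to the right it is the product rule, to the left the function is zero. *)
Lemma is_derive_bump_profile (m : nat) (t : R) :
  is_derive t 1 (bump_profile m)
    (bump_profile m.+2 t - m%:R * bump_profile m.+1 t).
Proof.
have [t0|t0|t0] := ltgtP t 0.
- rewrite !bump_profile0 ?ltW// mulr0 subr0.
  apply: (@near_eq_is_derive _ _ _ (cst 0)).
  near=> s; rewrite bump_profile0//; apply/ltW.
  by near: s; exact: lt_nbhsl.
- have dV : is_derive t 1 (fun s : R => s^-1) (- t^-1 ^+ 2).
    split; first by apply: derivableV => //; rewrite gt_eqF.
    rewrite deriveV ?gt_eqF// derive_id.
    by rewrite exprVn -[_ *: _]/(_ * _) mulr1.
  have dX : is_derive t^-1 1 (fun s : R => s ^+ m) (m%:R * t^-1 ^+ m.-1).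
    by split; [exact: exprn_derivable|rewrite exp_derive [LHS]mulr1].
  have dE : is_derive t^-1 1 (fun s : R => expR (- s)) (- expR (- t^-1)).
    have := is_derive_comp1 (is_deriveNid t^-1 1) (is_derive_expR (- t^-1)).
    by rewrite mulrN1.
  have := is_derive_mul (is_derive_comp1 dV dX) (is_derive_comp1 dV dE).
  move=> /near_eq_is_derive H; apply: is_derive_eq; first apply: H.
    near=> s; rewrite /bump_profile ifT//.
    by near: s; exact: lt_nbhsr.
  rewrite /bump_profile t0.
  by case: m {dX H} => [|m]; rewrite ?exprS ?expr0 /= ?expr0; ring.
- rewrite t0 !bump_profile0// mulr0 subr0.
  suff : (fun h : R => h^-1 *: (bump_profile m (h *: 1 + 0) - bump_profile m 0))
      @ 0^' --> (0 : R).
    move=> H; split; first by apply/cvg_ex; exists 0.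
    exact: cvg_lim H.
  apply/cvgr0Pnorm_le => e e0; near=> h.
  rewrite (bump_profile0 m (lexx 0)) subr0 addr0 -[_ *: _]/(_ * _) -[_%:A]/(_ * _) mulr1.
  rewrite normrM normfV (ger0_norm (bump_profile_ge0 _ _)).
  have h0 : 0 < `|h| by rewrite normr_gt0; near: h; exact: nbhs_dnbhs_neq.
  rewrite mulrC ler_pdivrMr//.
  apply: (le_trans (bump_profile_le m h)).
  rewrite -(real_normK (num_real h)) expr2 mulrA ler_wpM2r//.
  rewrite mulrC -ler_pdivlMr ?ltr0n ?fact_gt0//.
  near: h; apply: (@dnbhs0_le R R); by rewrite divr_gt0// ltr0n fact_gt0.
Unshelve. all: by end_near. Qed.

End BumpProfile.

(** * Functions with continuous partial derivatives of all orders *)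

Section SmoothFunctions.
Variables (R : realType) (n : nat).
Implicit Types (A U : set 'rV[R]_n) (F G : 'rV[R]_n -> R).

(** An order-by-order form of [smooth_on] in which the innermost derivative is peeled off first, so
    that closure under sums, products and compositions follows by induction on the order. *)
Fixpoint Ck (k : nat) A F : Prop :=
  (forall x, A x -> {for x, continuous F}) /\
  (if k is k'.+1 then
     forall i, (forall x, A x -> derivable F x (delta_mx 0 i)) /\
               Ck k' A (partial i F)
   else True).

Lemma smooth_onP A F : smooth_on A F <-> forall k, Ck k A F.
Proof.
split.
  move=> sF k; elim: k F sF => [|k IH] F sF /=.
    by split=> // x Ax; have [] := sF [::] x Ax.
  split=> [x Ax|i]; first by have [] := sF [::] x Ax.
  split=> [x Ax|]; first by have [_] := sF [::] x Ax; apply.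
  by apply: IH => s x Ax; have := sF (rcons s i) x Ax; rewrite foldr_rcons.
move=> H s; elim/last_ind: s F H => [|s i IH] F H x Ax.
  have [Hc Hd] := H 1; split=> [|i] /=; first exact: Hc.
  by apply: (Hd i).1.
rewrite foldr_rcons; apply: IH => // k.
by have [_ /(_ i)[]] := H k.+1.
Qed.

Lemma smooth_on_partial A F i : smooth_on A F -> smooth_on A (partial i F).
Proof. by move=> /smooth_onP H; apply/smooth_onP => k; have [_ /(_ i)[]] := H k.+1. Qed.

Lemma smooth_on_continuous A F x : smooth_on A F -> A x -> {for x, continuous F}.
Proof. by move=> H Ax; have [] := H [::] x Ax. Qed.

Lemma smooth_on_is_derive A F x i : smooth_on A F -> A x ->
  is_derive x (delta_mx 0 i) F (partial i F x).
Proof. by move=> H Ax; have [_ d] := H [::] x Ax; apply: derivableP. Qed.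

Lemma smooth_on_sub A U F : U `<=` A -> smooth_on A F -> smooth_on U F.
Proof. by move=> UA H s x /UA; exact: H. Qed.

Lemma Ck_mono k k' A F : (k' <= k)%N -> Ck k A F -> Ck k' A F.
Proof.
elim: k k' F => [|k IH] [|k'] F //=.
- by move=> _ [].
- rewrite ltnS => kk [c d]; split=> // i; have [d1 d2] := d i.
  by split=> //; apply: IH d2.
Qed.

Section OpenDomain.
Variable A : set 'rV[R]_n.
Hypothesis oA : open A.

Lemma near_eq_open F G x : {in A, F =1 G} -> A x -> \forall y \near x, F y = G y.
Proof.
move=> FG Ax; have : \forall y \near x, A y by exact: open_nbhs_nbhs.
by apply: filterS => y Ay; apply: FG; rewrite inE.
Qed.

Lemma eq_partial F G i : {in A, F =1 G} -> {in A, partial i F =1 partial i G}.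
Proof.
move=> FG x; rewrite inE => Ax; apply: near_eq_derive; exact: near_eq_open.
Qed.

Lemma eq_continuous_at F G x : {in A, F =1 G} -> A x ->
  {for x, continuous F} -> {for x, continuous G}.
Proof.
move=> FG Ax cF; rewrite /prop_for /continuous_at -(FG x) ?inE//.
exact: cvg_trans (near_eq_cvg (near_eq_open FG Ax)) cF.
Qed.

Lemma eq_Ck k F G : {in A, F =1 G} -> Ck k A F -> Ck k A G.
Proof.
elim: k F G => [|k IH] F G FG [cF dF].
  by split=> // x Ax; exact: eq_continuous_at FG Ax (cF x Ax).
split=> [x Ax|i]; first exact: eq_continuous_at FG Ax (cF x Ax).
have [d1 d2] := dF i; split=> [x Ax|].
  by apply: (near_eq_derivable (near_eq_open FG Ax)); exact: d1.
by apply: IH d2; exact: eq_partial.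
Qed.

Lemma eq_smooth_on F G : {in A, F =1 G} -> smooth_on A F -> smooth_on A G.
Proof. by move=> FG /smooth_onP H; apply/smooth_onP => k; apply: eq_Ck FG _. Qed.

(** Lets the partial derivatives be supplied by any formula valid on [A]: since [A] is open, higher
    derivatives on [A] do not see the values outside. *)
Lemma CkS k F (DF : 'I_n -> 'rV[R]_n -> R) :
  (forall x, A x -> {for x, continuous F}) ->
  (forall i x, A x -> is_derive x (delta_mx 0 i) F (DF i x)) ->
  (forall i, Ck k A (DF i)) -> Ck k.+1 A F.
Proof.
move=> cF dF CF; split=> // i; split=> [x Ax|]; first by have := dF i x Ax.
apply: eq_Ck (CF i) => x; rewrite inE => Ax.
by have [_ <-] := dF i x Ax.
Qed.

Lemma CkSE k F : Ck k.+1 A F ->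
  [/\ (forall x, A x -> {for x, continuous F}),
      (forall i x, A x -> is_derive x (delta_mx 0 i) F (partial i F x)),
      (forall i, Ck k A (partial i F)) & Ck k A F].
Proof.
move=> H; have [c d] := H; split=> //.
- by move=> i x Ax; apply: derivableP; apply: (d i).1.
- by move=> i; have [] := d i.
- exact: Ck_mono H.
Qed.

Lemma Ck_cst k c : Ck k A (cst c).
Proof.
elim: k c => [|k IH] c; first by split=> // x _; apply: cst_continuous.
apply: (@CkS _ _ (fun _ => cst 0)) => //.
by move=> x _; apply: cst_continuous.
Qed.

Lemma CkD k F G : Ck k A F -> Ck k A G -> Ck k A (fun x => F x + G x).
Proof.
have cD : forall F G, Ck 0 A F -> Ck 0 A G ->
    forall x, A x -> {for x, continuous (fun x => F x + G x)}.
  by move=> F' G' [cF _] [cG _] x Ax; exact: (continuousD (cF x Ax) (cG x Ax)).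
elim: k F G => [|k IH] F G.
  by move=> CF CG; split=> //; exact: cD.
move=> /CkSE[cF dF pF _] /CkSE[cG dG pG _].
apply: (@CkS _ _ (fun i x => partial i F x + partial i G x)).
- exact: cD.
- by move=> i x Ax; apply: is_derive_add; [exact: dF|exact: dG].
- by move=> i; exact: IH.
Qed.

Lemma CkM k F G : Ck k A F -> Ck k A G -> Ck k A (fun x => F x * G x).
Proof.
have cM : forall F G, Ck 0 A F -> Ck 0 A G ->
    forall x, A x -> {for x, continuous (fun x => F x * G x)}.
  by move=> F' G' [cF _] [cG _] x Ax; exact: (continuousM (cF x Ax) (cG x Ax)).
elim: k F G => [|k IH] F G.
  by move=> CF CG; split=> //; exact: cM.
move=> /CkSE[cF dF pF CF] /CkSE[cG dG pG CG].
apply: (@CkS _ _ (fun i x => F x * partial i G x + G x * partial i F x)).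
- exact: cM.
- by move=> i x Ax; apply: is_derive_mul; [exact: dF|exact: dG].
- by move=> i; apply: CkD; exact: IH.
Qed.

Lemma Ck_exp k F : Ck k A F -> Ck k A (fun x => expR (F x)).
Proof.
have cE : forall F, Ck 0 A F -> forall x, A x -> {for x, continuous (fun x => expR (F x))}.
  move=> F' [cF _] x Ax; apply: continuous_comp; first exact: (cF x Ax).
  exact: continuous_expR.
elim: k F => [|k IH] F; first by move=> CF; split=> //; exact: cE.
move=> /CkSE[cF dF pF CF].
apply: (@CkS _ _ (fun i x => expR (F x) * partial i F x)).
- exact: cE.
- by move=> i x Ax; apply: is_derive_comp1; exact: dF.
- by move=> i; apply: CkM => //; exact: IH.
Qed.

Lemma Ck_ln k F : (forall x, A x -> 0 < F x) -> Ck k A F ->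
  Ck k A (fun x => ln (F x)).
Proof.
move=> F0.
have cL : Ck 0 A F -> forall x, A x -> {for x, continuous (fun x => ln (F x))}.
  move=> [cF _] x Ax; apply: continuous_comp; first exact: (cF x Ax).
  by apply: continuous_ln; exact: F0.
elim: k => [|k IH]; first by move=> CF; split=> //; exact: cL.
move=> /CkSE[cF dF pF CF].
(* The reciprocal of [F] is written as an exponential of [ln F], so that the induction hypothesis
   for [ln F] also covers the derivative. *)
apply: (@CkS _ _ (fun i x => expR (- 1 * ln (F x)) * partial i F x)).
- exact: cL.
- move=> i x Ax; rewrite mulN1r expRN lnK ?posrE ?F0//.
  by apply: is_derive_comp1; [exact: dF|apply: is_derive1_ln; exact: F0].
- move=> i; apply: CkM => //; apply: Ck_exp; apply: CkM; first exact: Ck_cst.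
  exact: IH.
Qed.

Lemma Ck_bump k m F : Ck k A F -> Ck k A (fun x => bump_profile m (F x)).
Proof.
have cB : forall m F, Ck 0 A F ->
    forall x, A x -> {for x, continuous (fun x => bump_profile m (F x))}.
  move=> m' F' [cF _] x Ax; apply: continuous_comp; first exact: (cF x Ax).
  apply/differentiable_continuous/derivable1_diffP.
  by have [] := is_derive_bump_profile m' (F' x).
elim: k m F => [|k IH] m F; first by move=> CF; split=> //; exact: cB.
move=> /CkSE[cF dF pF CF].
apply: (@CkS _ _ (fun i x => (bump_profile m.+2 (F x)
    + - m%:R * bump_profile m.+1 (F x)) * partial i F x)).
- exact: cB.
- move=> i x Ax; rewrite mulNr; apply: is_derive_comp1; first exact: dF.
  exact: is_derive_bump_profile.
- move=> i; apply: CkM => //; apply: CkD; first exact: IH.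
  by apply: CkM; [exact: Ck_cst|exact: IH].
Qed.

Lemma smooth_on_cst c : smooth_on A (cst c).
Proof. by apply/smooth_onP => k; exact: Ck_cst. Qed.

Lemma smooth_onD F G : smooth_on A F -> smooth_on A G ->
  smooth_on A (fun x => F x + G x).
Proof. by move=> /smooth_onP a /smooth_onP b; apply/smooth_onP => k; exact: CkD. Qed.

Lemma smooth_onM F G : smooth_on A F -> smooth_on A G ->
  smooth_on A (fun x => F x * G x).
Proof. by move=> /smooth_onP a /smooth_onP b; apply/smooth_onP => k; exact: CkM. Qed.

Lemma smooth_on_exp F : smooth_on A F -> smooth_on A (fun x => expR (F x)).
Proof. by move=> /smooth_onP a; apply/smooth_onP => k; exact: Ck_exp. Qed.

Lemma smooth_on_ln F : (forall x, A x -> 0 < F x) -> smooth_on A F ->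
  smooth_on A (fun x => ln (F x)).
Proof. by move=> F0 /smooth_onP a; apply/smooth_onP => k; exact: Ck_ln. Qed.

Lemma smooth_on_bump m F : smooth_on A F ->
  smooth_on A (fun x => bump_profile m (F x)).
Proof. by move=> /smooth_onP a; apply/smooth_onP => k; exact: Ck_bump. Qed.

Lemma smooth_onN F : smooth_on A F -> smooth_on A (fun x => - F x).
Proof.
move=> sF; apply: (@eq_smooth_on (fun x => cst (- 1) x * F x)).
  by move=> x _; rewrite /cst mulN1r.
exact: (smooth_onM (smooth_on_cst _)).
Qed.

Lemma smooth_onB F G : smooth_on A F -> smooth_on A G ->
  smooth_on A (fun x => F x - G x).
Proof. by move=> sF sG; exact: (smooth_onD sF (smooth_onN sG)). Qed.

Lemma smooth_onV F : (forall x, A x -> 0 < F x) -> smooth_on A F ->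
  smooth_on A (fun x => (F x)^-1).
Proof.
move=> F0 sF; apply: (@eq_smooth_on (fun x => expR (- ln (F x)))).
  by move=> x; rewrite inE => Ax; rewrite expRN lnK// posrE F0.
exact/smooth_on_exp/smooth_onN/smooth_on_ln.
Qed.

Lemma smooth_on_sqrt F : (forall x, A x -> 0 < F x) -> smooth_on A F ->
  smooth_on A (fun x => Num.sqrt (F x)).
Proof.
move=> F0 sF; apply: (@eq_smooth_on (fun x => expR (cst 2^-1 x * ln (F x)))).
  move=> x; rewrite inE => Ax; rewrite -powR12_sqrt ?ltW ?F0//.
  by rewrite /powR gt_eqF ?F0.
apply/smooth_on_exp/smooth_onM; [exact: smooth_on_cst|exact: smooth_on_ln].
Qed.

Lemma smooth_on_sum (I : Type) (r : seq I) (P : pred I) (F : I -> 'rV[R]_n -> R) :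
  (forall i, smooth_on A (F i)) ->
  smooth_on A (fun x => \sum_(i <- r | P i) F i x).
Proof.
move=> sF; elim: r => [|i r IH].
  apply: (@eq_smooth_on (cst 0)); last exact: smooth_on_cst.
  by move=> x _; rewrite big_nil.
case: (boolP (P i)) => Pi.
  apply: (@eq_smooth_on (fun x => F i x + \sum_(j <- r | P j) F j x)).
    by move=> x _; rewrite big_cons Pi.
  exact: (smooth_onD (sF i) IH).
apply: (@eq_smooth_on (fun x => \sum_(j <- r | P j) F j x)) => //.
by move=> x _; rewrite big_cons (negbTE Pi).
Qed.

Lemma smooth_on_prod (I : Type) (r : seq I) (P : pred I) (F : I -> 'rV[R]_n -> R) :
  (forall i, smooth_on A (F i)) ->
  smooth_on A (fun x => \prod_(i <- r | P i) F i x).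
Proof.
move=> sF; elim: r => [|i r IH].
  apply: (@eq_smooth_on (cst 1)); last exact: smooth_on_cst.
  by move=> x _; rewrite big_nil.
case: (boolP (P i)) => Pi.
  apply: (@eq_smooth_on (fun x => F i x * \prod_(j <- r | P j) F j x)).
    by move=> x _; rewrite big_cons Pi.
  exact: (smooth_onM (sF i) IH).
apply: (@eq_smooth_on (fun x => \prod_(j <- r | P j) F j x)) => //.
by move=> x _; rewrite big_cons (negbTE Pi).
Qed.

End OpenDomain.

Lemma smooth_on_local A F :
  (forall x, A x -> exists U G, [/\ open U, U x, smooth_on U G & {in U, F =1 G}]) ->
  smooth_on A F.
Proof.
move=> H s x Ax; have [U [G [oU Ux sG FG]]] := H x Ax.
have GF : {in U, G =1 F} by move=> y Uy; rewrite FG.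
exact: (eq_smooth_on oU GF sG).
Qed.

End SmoothFunctions.

(** * Mean value theorem and chain rule *)

Section ChainRule.
Variable R : realType.

(** The mean value theorem on [0, 1] for [t |-> F ((t h) v + z)]; with this parametrisation the sign
    of [h] plays no part. *)
Lemma mean_value_line (V : normedModType R) (F : V -> R) (z v : V) (h : R) :
  (forall c : R, `|c| <= `|h| -> derivable F (c *: v + z) v) ->
  exists2 c : R, `|c| <= `|h| & F (h *: v + z) - F z = h * 'D_v F (c *: v + z).
Proof.
move=> dF; pose g (t : R) := F ((t * h) *: v + z).
pose dg (t : R) := h * 'D_v F ((t * h) *: v + z).
have le (t : R) : t \in `[0, 1] -> `|t * h| <= `|h|.
  rewrite in_itv/= => /andP[t0 t1]; rewrite normrM ger0_norm//.
  by rewrite ler_piMl.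
have Dg (t : R) : t \in `[0, 1] -> is_derive t 1 g (dg t).
  move=> /le /dF /derivableP dFt; apply/is_derive_lineP.
  rewrite /g /dg -[h in h * _]/(h) mulrC.
  have dl : is_derive (0 : R) 1 (fun s : R => s * h) h.
    have := is_derive_mul (is_derive_id (0 : R) 1) (is_derive_cst h (0 : R) 1).
    by rewrite mul0r add0r mulr1.
  have dF0 : is_derive ((0 : R) * h) 1
      (fun s : R => F (s *: v + ((t * h) *: v + z))) ('D_v F ((t * h) *: v + z)).
    rewrite mul0r.
    exact: (is_derive_lineP ((t * h) *: v + z) v F ('D_v F ((t * h) *: v + z))).1 dFt.
  have := is_derive_comp1 dl dF0; congr is_derive.
  apply/funext => s /=; congr F.
  by rewrite addrA -scalerDl -mulrDl -[_%:A]/(_ * _) mulr1.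
have [c c01 E] : exists2 c : R, c \in `[0, 1]%R & g 1 - g 0 = dg c * (1 - 0).
  have D1 (t : R) : t \in `]0, 1[%R -> is_derive t 1 g (dg t).
    by move=> t01; apply: Dg; apply: subset_itv_oo_cc.
  have D2 : {within `[0, 1], continuous g}.
    by apply: derivable_within_continuous => t /Dg[].
  exact: (MVT_segment ler01 D1 D2).
exists (c * h); first exact: le.
by move: E; rewrite /g /dg mul1r mul0r scale0r add0r subr0 mulr1.
Qed.

Lemma cvgr_sum (T I : Type) (F : set_system T) (FF : Filter F) (r : seq I)
    (f : I -> T -> R) (a : I -> R) :
  (forall i, f i x @[x --> F] --> a i) ->
  (\sum_(i <- r) f i x) @[x --> F] --> \sum_(i <- r) a i.
Proof.
move=> fa; elim: r => [|i r IH].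
  under eq_fun do rewrite big_nil.
  by rewrite big_nil; exact: cvg_cst.
under eq_fun do rewrite big_cons.
by rewrite big_cons; exact: cvgD.
Qed.

Variable n : nat.
Implicit Types (x y : 'rV[R]_n) (F : 'rV[R]_n -> R).

Definition hybrid_point k x y : 'rV[R]_n :=
  \row_j (if (j < k)%N then y 0 j else x 0 j).

Lemma row_norm_le x (e : R) : 0 <= e -> (forall j, `|x 0 j| <= e) -> `|x| <= e.
Proof.
move=> e0 H; rewrite -[`|x|]/(mx_norm x) mx_normrE.
by apply/bigmax_leP; split=> //= -[a b] _ /=; rewrite ord1.
Qed.

Lemma row_coord_le x j : `|x 0 j| <= `|x|.
Proof.
rewrite -[`|x|]/(mx_norm x) mx_normrE.
by apply: (le_trans _ (le_bigmax _ _ (ord0, j))).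
Qed.

(* Walking from x to y one coordinate at a time. *)
Lemma increment_partial (U : set 'rV[R]_n) F x : open U -> smooth_on U F -> U x ->
  exists q : 'I_n -> 'rV[R]_n -> R,
    (forall i, q i y @[y --> x] --> partial i F x) /\
    \forall y \near x, F y - F x = \sum_i (y 0 i - x 0 i) * q i y.
Proof.
move=> oU sF Ux.
have [r /= r0 rU] : nbhs_ball x U by apply/nbhs_ballP; exact: open_nbhs_nbhs.
have hyb (i : 'I_n) y : `|x - y| < r -> exists xi : 'rV[R]_n, `|x - xi| <= `|x - y| /\
    F (hybrid_point i.+1 x y) - F (hybrid_point i x y)
      = (y 0 i - x 0 i) * partial i F xi.
  move=> xyr.
  have E : hybrid_point i.+1 x y =
      (y 0 i - x 0 i) *: delta_mx 0 i + hybrid_point i x y.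
    apply/rowP => j; rewrite !mxE eqxx/= ltnS leq_eqVlt.
    have [->|ji] := eqVneq j i; first by rewrite eqxx/= ltnn mulr1 subrK.
    by rewrite val_eqE (negbTE ji)/= mulr0 add0r.
  have near (c : R) : `|c| <= `|y 0 i - x 0 i| ->
      `|x - (c *: delta_mx 0 i + hybrid_point i x y)| <= `|x - y|.
    move=> ch; apply: row_norm_le => // j; rewrite !mxE eqxx/=.
    have [->|ji] := eqVneq j i.
      rewrite ltnn mulr1 opprD addrCA subrr addr0 normrN (le_trans ch)//.
      by rewrite distrC (le_trans _ (row_coord_le _ i))// !mxE.
    rewrite mulr0 add0r; case: ifP => _.
      by rewrite (le_trans _ (row_coord_le _ j))// !mxE.
    by rewrite subrr normr0.
  have [|c /near cn Ec] := @mean_value_line _ F (hybrid_point i x y)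
      (delta_mx 0 i) (y 0 i - x 0 i).
    move=> c /near cn; have [] := @smooth_on_is_derive _ _ U F
      (c *: delta_mx 0 i + hybrid_point i x y) i sF => //.
    by apply: rU; rewrite -ball_normE/=; apply: le_lt_trans xyr.
  by eexists; split; [exact: cn|rewrite E Ec].
have /choice[xi Hxi] : forall iy : 'I_n * 'rV[R]_n, exists z : 'rV[R]_n, `|x - iy.2| < r ->
    `|x - z| <= `|x - iy.2| /\
    F (hybrid_point iy.1.+1 x iy.2) - F (hybrid_point iy.1 x iy.2)
      = (iy.2 0 iy.1 - x 0 iy.1) * partial iy.1 F z.
  move=> [i y]/=; have [xyr|] := pselect (`|x - y| < r).
    by have [z] := hyb i y xyr; exists z.
  (* A default outside the ball, where nothing is claimed; it makes the choice function total. *)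
  by exists x.
exists (fun i y => partial i F (xi (i, y))); split=> [i|].
  have xic : xi (i, y) @[y --> x] --> x.
    apply/(cvgrPdist_lt (FF := nbhs_filter x)) => e e0.
    have me : 0 < Num.min r e by rewrite lt_min r0.
    apply: (@filterS _ (nbhs x) (nbhs_filter x) _ _ _ (nbhsx_ballx x _ me)) => y.
    rewrite -ball_normE/= lt_min => /andP[yr ye].
    by have [le _] := Hxi (i, y) yr; apply: le_lt_trans le ye.
  apply: cvg_comp xic _.
  exact: smooth_on_continuous (smooth_on_partial i sF) Ux.
apply: (@filterS _ (nbhs x) (nbhs_filter x) _ _ _ (nbhsx_ballx x _ r0)) => y.
rewrite -ball_normE/= => yr.
have -> : \sum_i (y 0 i - x 0 i) * partial i F (xi (i, y)) =
    \sum_(i < n) (F (hybrid_point i.+1 x y) - F (hybrid_point i x y)).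
  by apply: eq_bigr => i _; have [_ ->] := Hxi (i, y) yr.
rewrite -(big_mkord xpredT (fun i => F (hybrid_point i.+1 x y) - F (hybrid_point i x y))).
rewrite telescope_sumr//.
by congr (F _ - F _); apply/rowP => j; rewrite !mxE ?ltn_ord.
Qed.

(** Along the curve [c] the difference quotient of [F] is a sum of coordinate quotients times the
    functions [q] of [increment_partial], which tend to the partial derivatives. No total derivative
    of [F] is involved. *)
Lemma is_derive_chain (V : normedModType R) (T : V -> 'rV[R]_n) (a v : V)
    (l : 'I_n -> R) (U : set 'rV[R]_n) F :
  open U -> smooth_on U F -> U (T a) ->
  (forall j, is_derive a v (fun w => T w 0 j) (l j)) ->
  is_derive a v (fun w => F (T w)) (\sum_j l j * partial j F (T a)).
Proof.
move=> oU sF Ua dT.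
apply: (is_derive_lineP a v (fun w => F (T w)) _).2.
pose c (h : R) := T (h *: v + a).
have c0 : c 0 = T a by rewrite /c scale0r add0r.
rewrite -/(c _) -c0.
have dc j : is_derive (0 : R) 1 (fun h => c h 0 j) (l j).
  exact: (is_derive_lineP a v (fun w => T w 0 j) (l j)).1 (dT j).
have cc : {for 0, continuous c}.
  apply/differentiable_continuous/derivable1_diffP/derivable_mxP => i j.
  by rewrite ord1; have [] := dc j.
rewrite -c0 in Ua.
have [q [qc qE]] := increment_partial oU sF Ua.
suff : (fun h : R => h^-1 *: (F (c (h *: 1 + 0)) - F (c 0))) @ 0^' -->
    (\sum_j l j * partial j F (c 0) : R).
  move=> H; split; first by apply/cvg_ex; eexists; exact: H.
  exact: cvg_lim H.
have Q : (fun h : R => \sum_j (h^-1 * (c h 0 j - c 0 0 j)) * q j (c h)) @ 0^' -->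
    (\sum_j l j * partial j F (c 0) : R).
  apply: cvgr_sum => j; apply: cvgM.
    have [d e] := dc j; move/cvg_ex : (d) => [m Hm].
    have E := cvg_lim (@norm_hausdorff _ _) Hm.
    rewrite -[X in _ --> X]e /derive E.
    apply: cvg_trans Hm; apply: near_eq_cvg; near=> h.
    by rewrite /= -[h%:A]/(_ * _) mulr1 addr0.
  apply: cvg_comp; last exact: qc.
  by apply: cvg_within_filter; exact: cc.
apply: cvg_trans Q; apply: near_eq_cvg.
have : \forall h \near 0^', F (c h) - F (c 0) = \sum_i (c h 0 i - c 0 0 i) * q i (c h).
  by apply: cvg_within_filter cc _ qE.
apply: filterS => h /= E.
rewrite addr0 -[_%:A]/(_ * _) mulr1 E -[_ *: _]/(_ * _) mulr_sumr.
by apply: eq_bigr => j _; rewrite mulrA.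
Unshelve. all: by end_near. Qed.

End ChainRule.

(** * Lebesgue measure and integration *)

Section BorelSets.
Variables (R : realType) (M : ptopologicalType).

Lemma borel_open (A : set M) : open A -> measurable (A : set (borel M)).
Proof. exact: sub_sigma_algebra. Qed.

Lemma borel_closed (A : set M) : closed A -> measurable (A : set (borel M)).
Proof.
by move=> cA; rewrite -(setCK A); apply: measurableC; apply: borel_open; exact: closed_openC.
Qed.

Lemma open_preimage_on (N : topologicalType) (A : set M) (F : M -> N) (O : set N) :
  open A -> (forall x, A x -> {for x, continuous F}) -> open O ->
  open (A `&` F @^-1` O).
Proof.
move=> oA cF oO; rewrite openE => x [Ax Ox]; apply: filterI.
  exact: open_nbhs_nbhs.
by apply: (cF x Ax); exact: open_nbhs_nbhs.
Qed.

Lemma continuous_on_measurable (A : set M) (F : M -> R) :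
  open A -> (forall x, A x -> {for x, continuous F}) ->
  measurable_fun (A : set (borel M)) (F : borel M -> R).
Proof.
move=> oA cF; apply: (measurability _ (RGenOpens.measurableE R)).
move=> _ [_ [a [b ->] <-]]; apply: borel_open.
by apply: open_preimage_on cF _ => //; exact: interval_open.
Qed.

Lemma continuous_measurable (F : M -> R) : continuous F ->
  measurable_fun [set: borel M] (F : borel M -> R).
Proof. by move=> cF; apply: continuous_on_measurable => [|x _]; [exact: openT|exact: cF]. Qed.

Lemma continuous_on_measurable_map (N : ptopologicalType) (A : set M) (F : M -> N) :
  open A -> (forall x, A x -> {for x, continuous F}) ->
  measurable_fun (A : set (borel M)) (F : borel M -> borel N).
Proof.
move=> oA cF; apply: (@measurability _ _ (borel M) (borel N) _ _ (@open N)) => //.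
move=> _ [W oW <-]; apply: borel_open; exact: open_preimage_on.
Qed.

End BorelSets.

(** * Image measures with a density *)

Section IntegralDensity.
Context {d1 d2} {X : measurableType d1} {Y : measurableType d2} {R : realType}.
Variables (m : {measure set X -> \bar R}) (nu : {measure set Y -> \bar R}).
Variables (phi : X -> Y) (rho : X -> R).
Hypothesis mphi : measurable_fun setT phi.
Hypothesis mrho : measurable_fun setT rho.
Hypothesis rho0 : forall x, 0 <= rho x.
Hypothesis nuE : forall A, measurable A ->
  nu A = (\int[m]_x (\1_(phi @^-1` A) x * rho x)%:E)%E.

Import HBNNSimple.
Local Open Scope ereal_scope.

(** Both sides are monotone limits along simple functions approximating [F], and on a level set the
    identity is [nuE]. It serves twice: with [phi] the inverse of a chart, and with [phi] the
    identity for the weighted measure. *)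
Lemma ge0_integral_density (F : Y -> \bar R) :
  measurable_fun setT F -> (forall y, 0 <= F y) ->
  \int[nu]_y F y = \int[m]_x (F (phi x) * (rho x)%:E).
Proof.
move=> mF F0.
pose f_ := nnsfun_approx measurableT mF.
have mprho (h : Y -> R) : measurable_fun setT h ->
    measurable_fun setT (fun x => (h (phi x) * rho x)%:E).
  move=> mh; apply/measurable_EFinP; apply: measurable_funM => //.
  exact: measurableT_comp.
have mpre k n : measurable (phi @^-1` (f_ n @^-1` [set k])).
  by rewrite -[X in measurable X]setTI; apply: mphi.
transitivity (limn (fun n => \int[nu]_y (f_ n y)%:E)).
  rewrite -monotone_convergence//.
  - apply: eq_integral => y _; apply/esym/cvg_lim => //.
    by apply: cvg_nnsfun_approx => // *; exact: F0.
  - by move=> n; exact/measurable_EFinP/measurable_funP.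
  - by move=> n y _; rewrite lee_fin.
  - by move=> y _ a b ab; rewrite lee_fin; exact/lefP/nd_nnsfun_approx.
transitivity (limn (fun n => \int[m]_x (f_ n (phi x) * rho x)%:E)); last first.
  rewrite -monotone_convergence//.
  - apply: eq_integral => x _; apply/cvg_lim => //.
    under eq_fun do rewrite EFinM.
    apply: cvgeZr => //.
    by apply: cvg_nnsfun_approx => // *; exact: F0.
  - by move=> n; apply: mprho; exact: measurable_funP.
  - by move=> n y _; rewrite lee_fin mulr_ge0.
  - move=> y _ a b ab; rewrite lee_fin ler_wpM2r//.
    exact/lefP/nd_nnsfun_approx.
congr (limn _); apply/funext => n.
transitivity (\sum_(k \in range (f_ n))
    \int[m]_x (k%:E * (\1_(phi @^-1` (f_ n @^-1` [set k])) x * rho x)%:E)).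
  rewrite integralT_nnsfun sintegralE; apply: eq_fsbigr => k; rewrite inE => -[y _ fk].
  rewrite ge0_integralZl//; last 3 first.
  - apply/measurable_EFinP; apply: measurable_funM => //.
  - by move=> x _; rewrite lee_fin mulr_ge0.
  - by rewrite lee_fin -fk.
  by rewrite nuE// -[X in measurable X]setTI; exact: measurable_funP.
rewrite -ge0_integral_fsum//.
- apply: eq_integral => x _.
  rewrite (fimfunE (f_ n) (phi x)) EFinM -fsumEFin//.
  rewrite muleC ge0_mule_fsumr; last by move=> k; exact: nnfun_muleindic_ge0.
  apply: eq_fsbigr => k _; rewrite muleC -EFinM -EFinM mulrA.
  congr (_%:E); have -> : \1_(f_ n @^-1` [set k]) (phi x) =
    \1_(phi @^-1` (f_ n @^-1` [set k])) x :> R by [].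
  by ring.
- move=> k; apply/measurable_EFinP; apply: measurable_funM => //.
  by apply: measurable_funM => //.
- move=> k x _; rewrite -EFinM mulrA EFinM mule_ge0 ?lee_fin//.
  by have := nnfun_muleindic_ge0 (f_ n) k (phi x); rewrite -EFinM lee_fin.
Qed.

(** No integrability is assumed: the positive and the negative part are treated separately, and
    multiplication by [rho >= 0] commutes with taking either. *)
Lemma integral_density (F : Y -> R) : measurable_fun setT F ->
  \int[nu]_y (F y)%:E = \int[m]_x (F (phi x) * rho x)%:E.
Proof.
move=> mF; rewrite integralE [RHS]integralE.
congr (_ - _); rewrite ge0_integral_density//.
- apply: eq_integral => x _; rewrite !funeposE -EFin_max -EFinM -EFin_max.
  by rewrite maxr_pMl// mul0r.
- by apply: measurable_funepos; exact/measurable_EFinP.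
- apply: eq_integral => x _; rewrite !funenegE -!EFinN -!EFin_max -EFinM.
  by rewrite maxr_pMl// mul0r mulNr.
- by apply: measurable_funeneg; exact/measurable_EFinP.
Qed.

End IntegralDensity.

(** Product measures are formed from bundled sigma-finite measures, whereas the induction on the
    dimension produces a measure together with a proof of sigma-finiteness. *)
Lemma sigma_finite_measure_pack d (T : measurableType d) (R : realType)
    (m : {measure set T -> \bar R}) : sigma_finite setT m ->
  exists m' : {sigma_finite_measure set T -> \bar R}, m' = m :> (set T -> \bar R).
Proof.
move=> sf; have fm : sfinite_measure m by exact: sfinite_measure_sigma_finite.
pose H1 := isSFinite.Build _ _ _ (Measure.sort m) fm.
pose H2 := isSigmaFinite.Build _ _ _ (Measure.sort m) sf.
pose m' := HB.pack_for (SigmaFiniteMeasure.type T R) (Measure.sort m) H1 H2.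
by exists m'.
Qed.

(** Isolates what the induction on the dimension uses of a product measure: the value on boxes
    yields finiteness on balls, the inequality yields positivity on open sets, and Tonelli's theorem
    yields the iterated integral. *)
Lemma product_pushforward d1 d2 d3 (T1 : measurableType d1) (T2 : measurableType d2)
    (T3 : measurableType d3) (R : realType)
    (m1 : {sigma_finite_measure set T1 -> \bar R})
    (m2 : {sigma_finite_measure set T2 -> \bar R}) (Phi : T1 * T2 -> T3) :
  measurable_fun setT Phi ->
  exists pm : {measure set T3 -> \bar R},
    [/\ forall A B C, measurable A -> measurable B ->
          Phi @^-1` C = A `*` B -> pm C = (m1 A * m2 B)%E,
        forall A B C, measurable A -> measurable B -> measurable C ->
          A `*` B `<=` Phi @^-1` C -> (m1 A * m2 B <= pm C)%E &
        forall F : T3 -> \bar R, measurable_fun setT F -> (forall x, (0 <= F x)%E) ->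
          measurable_fun setT (fun t => \int[m2]_x F (Phi (t, x)))%E /\
          (\int[pm]_x F x = \int[m1]_t \int[m2]_x F (Phi (t, x)))%E].
Proof.
move=> mPhi.
pose pm := (pushforward (m1 \x m2)%E Phi : {measure set T3 -> \bar R}).
exists (pm mPhi); split.
- by move=> A B C mA mB CE; rewrite -product_measure1E// -CE.
- move=> A B C mA mB mC AB; rewrite -product_measure1E//.
  apply: le_measure => //; rewrite inE; first exact: measurableX.
  by rewrite -[X in measurable X]setTI; exact: mPhi.
move=> F mF F0.
have mFPhi : measurable_fun setT (F \o Phi) by exact: measurableT_comp.
split; first exact: (@measurable_fun_fubini_tonelli_F _ _ _ _ _ m2 (F \o Phi) mFPhi (fun x => F0 (Phi x))).
rewrite ge0_integral_pushforward// preimage_setT.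
exact: (@fubini_tonelli1 _ _ _ _ _ m1 m2 (F \o Phi) mFPhi (fun x => F0 (Phi x))).
Qed.

(** * Lebesgue measure on row vectors *)

Section LebesgueMeasureRow.
Variable R : realType.
Local Notation Rm := (measurableTypeR R).

Section Step.
Variable n : nat.
Implicit Types (t : R) (x : 'rV[R]_n).

Definition row_cons t x : 'rV[R]_n.+1 := row_mx (t%:M : 'M[R]_1) x.

Lemma row_consB t x t' x' : row_cons t x - row_cons t' x' = row_cons (t - t') (x - x').
Proof. by rewrite /row_cons raddfB -add_row_mx -opp_row_mx. Qed.

Lemma row_consD t x t' x' : row_cons t x + row_cons t' x' = row_cons (t + t') (x + x').
Proof. by rewrite /row_cons raddfD -add_row_mx. Qed.

Lemma row_consE (y : 'rV[R]_n.+1) : y = row_cons (y 0 0) (rsubmx (y : 'M[R]_(1, 1 + n))).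
Proof.
apply/rowP => j; rewrite /row_cons mxE; case: (split_ordP (j : 'I_(1 + n))) => k ->.
  by rewrite mxE ord1 eqxx mulr1n; congr (y _ _); apply/val_inj.
by rewrite mxE; congr (y _ _); apply/val_inj.
Qed.

Lemma norm_row_cons t x : `|row_cons t x| = Num.max `|t| `|x|.
Proof.
apply/eqP; rewrite eq_le; apply/andP; split.
  apply: row_norm_le => [|j]; first by rewrite le_max normr_ge0.
  rewrite /row_cons mxE; case: (split_ordP (j : 'I_(1 + n))) => k _.
    by rewrite mxE ord1 eqxx mulr1n le_max lexx.
  by rewrite le_max row_coord_le orbT.
rewrite ge_max; apply/andP; split.
  have := @row_coord_le R (1 + n) (row_cons t x) (lshift n ord0).
  by rewrite /row_cons row_mxEl mxE eqxx mulr1n.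
apply: row_norm_le => // j.
have := @row_coord_le R (1 + n) (row_cons t x) (rshift 1 j).
by rewrite /row_cons row_mxEr.
Qed.

(** An open set is a countable union of boxes whose first factor is a rational interval. The second
    factor [W q e] is the largest open set that fits, so that no countable base of the row vectors
    is used. *)
Lemma measurable_row_cons : measurable_fun [set: Rm * borel 'rV[R]_n]
  (fun p => row_cons p.1 p.2 : borel 'rV[R]_n.+1).
Proof.
apply: (@measurability _ _ _ (borel 'rV[R]_n.+1) _ _ (@open 'rV[R]_n.+1)) => //.
move=> _ [U oU <-].
pose W (q e : rat) := [set x : 'rV[R]_n | exists B : set 'rV[R]_n, [/\ open B, B x &
  forall t x', `|ratr q - t| < ratr e -> B x' -> U (row_cons t x')]].
have -> : setT `&` (fun p : Rm * borel 'rV[R]_n => row_cons p.1 p.2) @^-1` U =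
    \bigcup_q \bigcup_e (((ball (ratr q : R) (ratr e)) : set Rm) `*`
      (W q e : set (borel 'rV[R]_n))).
  apply/seteqP; split=> [[t x] [_ /= Utx]|[t x] [q _ [e _ [/= b [B [oB Bx H]]]]]].
    have [r /= r0 rU] : nbhs_ball (row_cons t x) U.
      by apply/nbhs_ballP; exact: open_nbhs_nbhs.
    (* A rational centre within [r / 4] of [t] and a rational radius between [r / 4] and [r / 2]:
       the interval contains [t], and all its points are at distance less than [r] from [t]. *)
    have r4 : 0 < r / 4 by rewrite divr_gt0.
    have [y1 [qt [q _ qy]]] : (ball t (r / 4) `&` (@ratr R @` setT)) !=set0.
      by apply: dense_rat; [exists t; exact: ballxx|exact: ball_open].
    rewrite -{y1}qy in qt.
    have e4 : 0 < r / 8 by rewrite divr_gt0.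
    have [y2 [et [e _ ey]]] : (ball (r * (3 / 8)) (r / 8) `&` (@ratr R @` setT)) !=set0.
      by apply: dense_rat; [eexists; exact: ballxx|exact: ball_open].
    rewrite -{y2}ey in et.
    move: qt et; rewrite -!ball_normE/= => qt et.
    exists q => //; exists e => //; split=> /=.
      rewrite distrC; move: qt et.
      by rewrite !ltr_distl => /andP[? ?] /andP[? ?]; apply/andP; split; lra.
    exists (ball x r); split; [exact: ball_open|exact: ballxx|].
    move=> t' x' qt' xx'; apply: rU; rewrite -ball_normE/= row_consB norm_row_cons.
    move: xx'; rewrite -ball_normE/= => xx'; rewrite gt_max xx' andbT.
    move: qt et qt'; rewrite !ltr_distl => /andP[? ?] /andP[? ?] /andP[? ?].
    by apply/andP; split; lra.
  by split=> //=; apply: H => //; move: b; rewrite -ball_normE.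
apply: bigcupT_measurable_rat => q; apply: bigcupT_measurable_rat => e.
apply: measurableX; first exact: measurable_ball.
apply: borel_open; rewrite openE => x [B [oB Bx H]].
have xB : nbhs (x : 'rV[R]_n) B by exact: open_nbhs_nbhs.
by apply: (@filterS _ _ (nbhs_filter (x : 'rV[R]_n)) _ _ _ xB) => y By; exists B.
Qed.

Lemma measurable_row_cons_r t : measurable_fun [set: borel 'rV[R]_n]
  (row_cons t : borel 'rV[R]_n -> borel 'rV[R]_n.+1).
Proof.
apply: continuous_on_measurable_map; first exact: openT.
move=> x _; apply/(cvgrPdist_lt (FF := nbhs_filter x)) => e e0.
apply: (@filterS _ _ (nbhs_filter x) _ _ _ (nbhsx_ballx x _ e0)) => y.
by rewrite -ball_normE/= row_consB norm_row_cons subrr normr0 gt_max e0.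
Qed.

End Step.

Lemma lebesgue_measure_shift (v : R) (A : set Rm) : measurable A ->
  lebesgue_measure ((fun t : R => t + v) @^-1` A) = lebesgue_measure A.
Proof.
move=> mA.
have ms : measurable_fun [set: Rm] (fun t : Rm => t + v : Rm).
  by apply: measurable_funD => //.
pose pm : {measure set Rm -> \bar R} :=
  pushforward (@lebesgue_measure R) (fun t : Rm => t + v : Rm).
symmetry; apply: (lebesgue_measure_unique (mu := pm ms)) mA => _ [[a b] _ <-] /=.
rewrite /pm /pushforward.
have -> : (fun t : R => t + v) @^-1` `]a, b] = `]a - v, b - v]%classic.
  by apply/seteqP; split=> t /=; rewrite !in_itv/= ltrBlDr lerBrDr.
rewrite !lebesgue_measure_itv/= !lte_fin ltrD2r.
by case: ifP => // _; rewrite -!EFinD; congr (_%:E); ring.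
Qed.

Lemma lebesgue_integral_shift (v : R) (F : Rm -> \bar R) :
  measurable_fun setT F -> (forall t, 0 <= F t)%E ->
  (\int[@lebesgue_measure R]_t F (t + v)%R = \int[@lebesgue_measure R]_t F t)%E.
Proof.
move=> mF F0.
have ms : measurable_fun [set: Rm] (fun t : Rm => t + v : Rm).
  by apply: measurable_funD => //.
pose pm : {measure set Rm -> \bar R} :=
  pushforward (@lebesgue_measure R) (fun t : Rm => t + v : Rm).
rewrite [RHS](eq_measure_integral (pm ms)); last first.
  by move=> A mA _; exact: (esym (lebesgue_measure_shift v mA)).
by rewrite [RHS]ge0_integral_pushforward.
Qed.

(** A bare iterated integral has no convergence theorems; a measure representing it does. The
    measure is a Dirac mass in dimension 0, and then the product with Lebesgue measure on the line,
    carried to row vectors. Finiteness on balls gives the sigma-finiteness on which the next product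
    relies. *)
Lemma lebesgue_int_measure n :
  exists lam : {sigma_finite_measure set (borel 'rV[R]_n) -> \bar R},
  [/\ forall F : 'rV[R]_n -> \bar R,
        measurable_fun [set: borel 'rV[R]_n] (F : borel 'rV[R]_n -> \bar R) ->
        (forall x, 0 <= F x)%E -> lebesgue_int F = (\int[lam]_x F x)%E,
      forall r : R, (lam [set x | (`|x| <= r)%R] < +oo)%E,
      forall v (F : 'rV[R]_n -> \bar R),
        measurable_fun [set: borel 'rV[R]_n] (F : borel 'rV[R]_n -> \bar R) ->
        (forall x, 0 <= F x)%E ->
        (\int[lam]_x F (x + v)%R = \int[lam]_x F x)%E
    & forall U : set 'rV[R]_n, open U -> U !=set0 -> (0 < lam U)%E].
Proof.
elim: n => [|n [lam [lamE lamfin lamsh lampos]]].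
  pose dm : {measure set (borel 'rV[R]_0) -> \bar R} := \d_(0 : borel 'rV[R]_0).
  have [|lam lamE] := @sigma_finite_measure_pack _ _ _ dm.
    exists (fun=> setT); first by rewrite bigcup_const.
    by move=> i; split=> //; rewrite /dm/= diracT ltry.
  have intE (F : 'rV[R]_0 -> \bar R) :
      measurable_fun [set: borel 'rV[R]_0] (F : borel 'rV[R]_0 -> \bar R) ->
      (\int[lam]_x F x)%E = F 0.
    by move=> mF; rewrite lamE /dm/= integral_dirac// diracT mul1e.
  exists lam; split.
  - by move=> F mF F0; rewrite intE.
  - by move=> r; rewrite lamE /dm/= diracE ltry.
  - by move=> v F mF F0; rewrite (thinmx0 v); under eq_integral do rewrite addr0.
  - move=> U oU [x Ux]; rewrite lamE /dm/= diracE (_ : _ \in _) ?lte_fin ?ltr01// inE.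
    by rewrite -(thinmx0 x).
pose Phi (p : Rm * borel 'rV[R]_n) : borel 'rV[R]_n.+1 := row_cons p.1 p.2.
have mPhi : measurable_fun setT Phi := @measurable_row_cons n.
have [pm [pmX pmge pmE]] := product_pushforward (@lebesgue_measure R) lam mPhi.
have pmfin (r : R) : (pm [set x | (`|x| <= r)%R] < +oo)%E.
  have mB k : measurable ([set x : 'rV[R]_k | `|x| <= r] : set (borel 'rV[R]_k)).
    apply: borel_closed.
    rewrite -[X in closed X]/((fun x : 'rV[R]_k => `|x|) @^-1` [set y | y <= r]).
    by apply: closed_comp; [move=> x _; exact: norm_continuous|exact: closed_le].
  have mI : measurable ([set` `[- r, r]] : set Rm) by exact: measurable_itv.
  rewrite (pmX _ _ _ mI (mB n)); last first.
    by apply/seteqP; split=> -[t x] /=; rewrite norm_row_cons ge_max in_itv/= -ler_norml;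
      [move=> /andP[]|move=> [-> ->]].
  rewrite /= lebesgue_measure_itv/=.
  by apply: lte_mul_pinfty => //; case: ifP => //; rewrite -EFinD ?lee_fin//;
     rewrite lte_fin => h; rewrite subr_ge0 ltW.
have [|lam' lam'E] := @sigma_finite_measure_pack _ _ _ pm.
  exists (fun k => [set x : 'rV[R]_n.+1 | `|x| <= k%:R]); last first.
    move=> k; split; last exact: pmfin.
    apply: borel_closed.
    rewrite -[X in closed X]/((fun x : 'rV[R]_n.+1 => `|x|) @^-1` [set y | y <= k%:R]).
    by apply: closed_comp; [move=> x _; exact: norm_continuous|exact: closed_le].
  apply/seteqP; split=> // x _; exists (Num.truncn `|x|).+1 => //=.
  by rewrite ltW// truncnS_gt.
exists lam'; rewrite lam'E; split => //.
- move=> F mF F0; have [_ ->] := pmE F mF F0; apply: eq_integral => t _.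
  apply: lamE => //; apply: (measurableT_comp mF).
  exact: measurable_row_cons_r.
- move=> v F mF F0.
  have mFv : measurable_fun [set: borel 'rV[R]_n.+1]
      ((fun x => F (x + v)) : borel 'rV[R]_n.+1 -> \bar R).
    apply: (measurableT_comp mF); apply: continuous_on_measurable_map; first exact: openT.
    by move=> x _; apply: continuousD; [exact: cvg_id|exact: cst_continuous].
  have [_ ->] := pmE _ mFv (fun x => F0 (x + v)).
  have [mFF ->] := pmE F mF F0.
  rewrite -(lebesgue_integral_shift (v 0 0) mFF); last first.
    by move=> t; apply: integral_ge0.
  apply: eq_integral => t _.
  have mFt : measurable_fun [set: borel 'rV[R]_n]
      ((fun x => F (row_cons (t + v 0 0) x)) : borel 'rV[R]_n -> \bar R).
    by apply: (measurableT_comp mF); exact: measurable_row_cons_r.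
  rewrite -[RHS](lamsh (rsubmx (v : 'M[R]_(1, 1 + n))) _ mFt); last by move=> x; exact: F0.
  by apply: eq_integral => x _; rewrite [in LHS](row_consE v) row_consD.
- move=> U oU [y Uy].
  have [r /= r0 rU] : nbhs_ball y U by apply/nbhs_ballP; exact: open_nbhs_nbhs.
  pose A : set Rm := ball (y 0 0) r.
  pose B : set (borel 'rV[R]_n) := ball (rsubmx (y : 'M[R]_(1, 1 + n))) r.
  have mA : measurable A by exact: measurable_ball.
  have mB : measurable B by apply: borel_open; exact: ball_open.
  have AB : A `*` B `<=` Phi @^-1` U.
    move=> [t x] [/= At Bx]; apply: rU; move: At Bx.
    rewrite /A /B -!ball_normE/= => At Bx.
    by rewrite [y]row_consE row_consB norm_row_cons gt_max At.
  apply: lt_le_trans (pmge _ _ _ mA mB (borel_open oU) AB).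
  rewrite mule_gt0//; first by rewrite /= lebesgue_measure_ball ?ltW// lte_fin mulrn_wgt0.
  by apply: lampos; [exact: ball_open|eexists; exact: ballxx].
Qed.

End LebesgueMeasureRow.

Lemma compact_continuous_bounded (R : realType) (M : topologicalType) (K : set M)
    (F : M -> R) : compact K -> (forall x, K x -> {for x, continuous F}) ->
  exists2 C, 0 <= C & forall x, K x -> `|F x| <= C.
Proof.
move=> cK cF.
have cFK : compact (F @` K).
  by apply: continuous_compact => //; apply: continuous_in_subspaceT => x /set_mem; exact: cF.
have [C [Creal HC]] := compact_bounded cFK.
exists (Num.max 0 (C + 1)); first by rewrite le_max lexx.
move=> x Kx; have := HC (C + 1); rewrite ltrDl ltr01 => /(_ isT (F x)) H.
by rewrite le_max H ?orbT//; exists x.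
Qed.

Lemma continuous_translate (R : realType) (V : normedModType R) (F : V -> R) v :
  continuous F -> continuous (fun x => F (x + v)).
Proof.
move=> cF x; apply: (@continuous_comp _ _ _ (fun x => x + v) F); last exact: cF.
by apply: continuousD; [exact: cvg_id|exact: cst_continuous].
Qed.

Lemma continuous_difference (R : realType) (V : normedModType R) (F : V -> R) c v :
  continuous F -> continuous (fun x => c * (F (x + v) - F x)).
Proof.
move=> cF x; apply: cvgM; first exact: cvg_cst.
by apply: cvgB; [exact: continuous_translate|exact: cF].
Qed.

Section RealIntegrals.
Context {d} {T : measurableType d} {R : realType}.
Variable mu : {measure set T -> \bar R}.
Implicit Types (A : set T) (F G : T -> R).

(** The bound is asked only almost everywhere because the potential [V] is only essentially bounded
    on compact sets. *)
Lemma integrable_bounded_support A F C : measurable A -> (mu A < +oo)%E ->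
  measurable_fun setT F -> {ae mu, forall x, A x -> `|F x| <= C} ->
  (forall x, ~ A x -> F x = 0) -> mu.-integrable setT (EFin \o F).
Proof.
move=> mA Afin mF FC F0; apply/integrableP; split; first exact/measurable_EFinP.
apply: (@le_lt_trans _ _ (\int[mu]_x ((`|C| * \1_A x)%:E))%E).
  apply: ae_ge0_le_integral => //.
  - by apply: measurableT_comp => //; exact/measurable_EFinP.
  - by apply/measurable_EFinP; apply: measurable_funM.
  apply: filterS FC => x HF _ /=; rewrite lee_fin indicE.
  have [xA|xA] := boolP (x \in A).
    by rewrite mulr1 (le_trans (HF _) (ler_norm _))//; exact/set_mem.
  by move: xA; rewrite notin_setE => /F0 ->; rewrite normr0 mulr0.
under eq_integral do rewrite EFinM.
rewrite ge0_integralZl//; last exact/measurable_EFinP.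
by rewrite integral_indic// setIT lte_mul_pinfty.
Qed.

Lemma integrableDr F G : mu.-integrable setT (EFin \o F) ->
  mu.-integrable setT (EFin \o G) -> mu.-integrable setT (EFin \o (fun x => F x + G x)).
Proof. by move=> iF iG; apply: eq_integrable (integrableD _ iF iG). Qed.

Lemma integrableBr F G : mu.-integrable setT (EFin \o F) ->
  mu.-integrable setT (EFin \o G) -> mu.-integrable setT (EFin \o (fun x => F x - G x)).
Proof. by move=> iF iG; apply: eq_integrable (integrableB _ iF iG). Qed.

Lemma integrableZr' k F : mu.-integrable setT (EFin \o F) ->
  mu.-integrable setT (EFin \o (fun x => k * F x)).
Proof. by move=> iF; apply: eq_integrable (integrableZl _ k iF). Qed.

Lemma EFin_Rintegral F : mu.-integrable setT (EFin \o F) ->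
  (\int[mu]_x (F x)%:E = (\int[mu]_x F x)%R%:E)%E.
Proof. by move=> iF; rewrite /Rintegral fineK// integrable_fin_num. Qed.

Lemma Rintegral_sum (I : Type) (r : seq I) (F : I -> T -> R) :
  (forall i, mu.-integrable setT (EFin \o F i)) ->
  \int[mu]_x (\sum_(i <- r) F i x) = \sum_(i <- r) \int[mu]_x F i x /\
  mu.-integrable setT (EFin \o (fun x => \sum_(i <- r) F i x)).
Proof.
move=> iF; elim: r => [|i r [IH1 IH2]].
  under eq_Rintegral do rewrite big_nil.
  rewrite big_nil /Rintegral integral0; split=> //.
  by apply: eq_integrable (integrable0 _ _) => // x _ /=; rewrite big_nil.
under eq_Rintegral do rewrite big_cons.
rewrite big_cons RintegralD// IH1; split=> //.
by apply: eq_integrable (integrableDr (iF i) IH2) => // x _ /=; rewrite big_cons.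
Qed.

End RealIntegrals.

(** * The divergence theorem on coordinate space *)

Section DivergenceRow.
Variables (R : realType) (n : nat) (lam : {measure set (borel 'rV[R]_n) -> \bar R}).
Hypothesis lam_ball : forall r : R, (lam [set x | (`|x| <= r)%R] < +oo)%E.
Hypothesis lam_shift : forall v (F : 'rV[R]_n -> \bar R),
  measurable_fun [set: borel 'rV[R]_n] (F : borel 'rV[R]_n -> \bar R) ->
  (forall x, 0 <= F x)%E -> (\int[lam]_x F (x + v)%R = \int[lam]_x F x)%E.

Lemma closed_norm_ball (r : R) : closed [set x : 'rV[R]_n | `|x| <= r].
Proof.
rewrite -[X in closed X]/((fun x : 'rV[R]_n => `|x|) @^-1` [set y | y <= r]).
by apply: closed_comp; [move=> x _; exact: norm_continuous|exact: closed_le].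
Qed.

Lemma borel_norm_ball (r : R) :
  measurable ([set x : 'rV[R]_n | `|x| <= r] : set (borel 'rV[R]_n)).
Proof. by apply: borel_closed; exact: closed_norm_ball. Qed.

Lemma compact_norm_ball (r : R) : compact [set x : 'rV[R]_n | `|x| <= r].
Proof.
apply: bounded_closed_compact; last exact: closed_norm_ball.
by exists r; split; [exact: num_real|move=> x rx y /= /le_trans; apply; exact: ltW].
Qed.

Lemma integrable_compact_row (F : 'rV[R]_n -> R) r : continuous F ->
  (forall x, r < `|x| -> F x = 0) ->
  lam.-integrable setT (EFin \o F : borel 'rV[R]_n -> \bar R).
Proof.
move=> cF F0.
have [C _ HC] := compact_continuous_bounded (@compact_norm_ball r) (fun x _ => cF x).
apply: (integrable_bounded_support (C := C) (borel_norm_ball r) (lam_ball r)).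
- exact: continuous_measurable.
- exact: aeW.
- by move=> x /negP; rewrite -ltNge; exact: F0.
Qed.

Lemma Rintegral_shift (F : 'rV[R]_n -> R) v : continuous F ->
  \int[lam]_x F (x + v) = \int[lam]_x F x.
Proof.
move=> cF; have mF := continuous_measurable cF.
rewrite /Rintegral; congr fine; rewrite integralE [RHS]integralE; congr (_ - _)%E.
  rewrite -(@lam_shift v (EFin \o F)^\+)%E//.
    by apply: eq_integral => x _; rewrite !funeposE.
  by apply: measurable_funepos; exact/measurable_EFinP.
rewrite -(@lam_shift v (EFin \o F)^\-)%E//.
  by apply: eq_integral => x _; rewrite !funenegE.
by apply: measurable_funeneg; exact/measurable_EFinP.
Qed.

(* The difference quotients have integral zero by translation invariance and are
   dominated, by the mean value theorem. *)
Lemma integral_partial_eq0 (F : 'rV[R]_n -> R) (i : 'I_n) r : continuous F ->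
  (forall x, derivable F x (delta_mx 0 i)) -> continuous (partial i F) ->
  (forall x, r < `|x| -> F x = 0) -> \int[lam]_x partial i F x = 0.
Proof.
move=> cF dF cP F0.
have ne : `|delta_mx 0 i : 'rV[R]_n| <= 1.
  by apply: row_norm_le => // j; rewrite mxE; case: andP => _; rewrite ?normr1 ?normr0.
have P0 x : r < `|x| -> partial i F x = 0.
  move=> rx; rewrite -[RHS](derive_cst (0 : R) x (delta_mx 0 i)).
  apply: near_eq_derive.
  have : nbhs x (~` [set y : 'rV[R]_n | `|y| <= r]).
    apply: open_nbhs_nbhs; split; first by apply: closed_openC; exact: closed_norm_ball.
    by move=> /=; rewrite leNgt rx.
  by apply: (@filterS _ _ (nbhs_filter x)) => y /negP; rewrite -ltNge => /F0.
have [C C0 HC] := compact_continuous_bounded (@compact_norm_ball r) (fun x _ => cP x).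
have {}HC x : `|partial i F x| <= C.
  by have [/HC//|/P0 ->] := leP `|x| r; rewrite normr0.
pose h (k : nat) : R := k.+1%:R^-1.
have h0 k : 0 < h k by rewrite invr_gt0 ltr0n.
have h1 k : h k <= 1 by rewrite invf_le1 ?ltr0n// ler1n.
pose D (k : nat) (x : 'rV[R]_n) : R := (h k)^-1 * (F (x + h k *: delta_mx 0 i) - F x).
have DC k x : `|D k x| <= C.
  have [c _ Ec] := @mean_value_line _ _ F x (delta_mx 0 i) (h k) (fun c _ => dF _).
  by rewrite /D [x + _]addrC Ec mulrA mulVf ?gt_eqF// mul1r; exact: HC.
have cFh k : continuous (fun x : 'rV[R]_n => F (x + h k *: delta_mx 0 i)).
  exact: continuous_translate.
have cD k : continuous (D k) by exact: continuous_difference.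
(* Steps and basis vectors have norm at most 1, so all difference quotients vanish outside one ball,
   of radius [r + 1], on which the dominating constant is integrable. *)
have Fh0 k x : r + 1 < `|x| -> F (x + h k *: delta_mx 0 i) = 0.
  move=> rx; apply: F0; rewrite -(addrK (h k *: delta_mx 0 i) x) in rx.
  have := lt_le_trans rx (ler_normB _ _); rewrite normrZ (gtr0_norm (h0 k)) => H.
  have : h k * `|delta_mx 0 i : 'rV[R]_n| <= 1.
    by rewrite -[leRHS]mulr1 ler_pM// ltW.
  by move: H; lra.
have F1 x : r + 1 < `|x| -> F x = 0.
  by move=> rx; apply: F0; apply: lt_trans rx; rewrite ltrDl.
have D0 k x : r + 1 < `|x| -> D k x = 0.
  by move=> rx; rewrite /D (Fh0 k x rx) (F1 x rx) subrr mulr0.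
have ID k : \int[lam]_x D k x = 0.
  have iF := integrable_compact_row cF F0.
  have iFh := integrable_compact_row (cFh k) (Fh0 k).
  rewrite /D RintegralZl//; last exact: integrableBr.
  by rewrite RintegralB// Rintegral_shift// subrr mulr0.
pose B := [set x : 'rV[R]_n | `|x| <= r + 1].
have hk : h k @[k --> \oo] --> (0 : R)^'.
  move=> P [e /= e0 HP].
  have : \forall k \near \oo, `|0 - h k| < e by apply: cvgr_dist_lt e0; exact: cvg_harmonic.
  by apply: filterS => k hke; apply: (HP _ hke); rewrite gt_eqF.
have := @dominated_convergence _ (borel 'rV[R]_n) R lam setT measurableT
  (fun k x => (D k x)%:E) (fun x => (partial i F x)%:E) (fun x => (C * \1_B x)%:E).
case.
- by move=> k; apply/measurable_EFinP; exact: continuous_measurable.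
- by apply/measurable_EFinP; exact: continuous_measurable.
- apply: aeW => x _; apply: cvg_EFin; first exact: nearW.
  have /cvg_ex[l Hl] := dF x.
  rewrite /partial /derive (cvg_lim _ Hl)//.
  rewrite [X in X @ _](_ : _ =
      (fun h : R => h^-1 *: ((F \o shift x) (h *: delta_mx 0 i) - F x)) \o h).
    exact: cvg_comp Hl.
  by apply/funext => k; rewrite /D /= [x + _]addrC.
- apply: (integrable_bounded_support (C := C) (borel_norm_ball (r + 1)) (lam_ball (r + 1))).
  + apply: measurable_funM => //; exact: measurable_indic (borel_norm_ball (r + 1)).
  + apply: aeW => x Bx; rewrite indicE mem_set//= mulr1 ger0_norm//.
  + by move=> x Bx; rewrite indicE memNset// mulr0.
- apply: aeW => x k _; rewrite lee_fin indicE.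
  have [xB|] := boolP (x \in B); first by rewrite mulr1.
  rewrite notin_setE => /negP; rewrite -ltNge => rx.
  by rewrite (D0 k x rx) normr0 mulr0.
move=> iP _ /= H; apply: EFin_inj; rewrite -EFin_Rintegral//.
have I0 : (fun k => \int[lam]_x (D k x)%:E)%E = cst 0%E.
  apply/funext => k; rewrite EFin_Rintegral ?ID//.
  exact: integrable_compact_row (cD k) (D0 k).
rewrite I0 in H; rewrite -(cvg_lim _ H)//; exact: lim_cst.
Qed.

End DivergenceRow.

(** * Calculus on a manifold *)

Section PositiveDefinite.
Variables (R : rcfType) (n : nat).
Implicit Types A : 'M[R]_n.

Lemma posdef_det_neq0 A :
  (forall v : 'rV[R]_n, v != 0 -> 0 < (v *m A *m v^T) 0 0) -> \det A != 0.
Proof.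
move=> pA; apply/negP => /det0P[v v0 vA].
by have := pA v v0; rewrite vA mul0mx mxE ltxx.
Qed.

Lemma row_sqr_gt0 (v : 'rV[R]_n) : v != 0 -> 0 < (v *m v^T) 0 0.
Proof.
move=> v0; rewrite mxE lt_def; apply/andP; split; last first.
  by apply: sumr_ge0 => i _; rewrite mxE -expr2 sqr_ge0.
apply: contra v0 => /eqP s0; apply/eqP/rowP => i; rewrite [RHS]mxE.
have P j : true -> 0 <= v 0 j * v^T j 0 by move=> _; rewrite mxE -expr2 sqr_ge0.
have := psumr_eq0P P s0 (i := i) isT.
by rewrite mxE => /eqP; rewrite mulf_eq0 orbb => /eqP.
Qed.

(* The determinant does not vanish on the segment from 1 to A. *)
Lemma posdef_det_gt0 A :
  (forall v : 'rV[R]_n, v != 0 -> 0 < (v *m A *m v^T) 0 0) -> 0 < \det A.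
Proof.
move=> pA; rewrite ltNge; apply/negP => A0.
pose P : {poly R} := \det ('X *: map_mx polyC A + (1 - 'X) *: 1%:M).
have PE t : P.[t] = \det (t *: A + (1 - t) *: 1%:M).
  rewrite -[LHS]/(horner_eval t P) /P -det_map_mx; congr (\det _).
  apply/matrixP => i j; rewrite !mxE -[LHS]/(('X * (A i j)%:P + (1 - 'X) * (i == j)%:R).[t]).
  rewrite hornerD !hornerM hornerD hornerN hornerX !hornerC.
  by case: (i == j); rewrite ?hornerC.
have P01 : (- P).[0] <= 0 <= (- P).[1].
  by rewrite !hornerN !PE subrr !scale0r add0r addr0 subr0 !scale1r det1 oppr_le0 ler01 oppr_ge0.
have [t /andP[t0 t1] /rootP] := poly_ivt ler01 P01.
rewrite hornerN PE => /eqP; rewrite oppr_eq0; apply/negP.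
apply: posdef_det_neq0 => v v0.
rewrite mulmxDr -!scalemxAr mulmx1 mulmxDl -!scalemxAl !mxE.
have := pA v v0; have := row_sqr_gt0 v0; rewrite !mxE => q1 q2.
by have [->|t0'] := eqVneq t 0; [lra|have : 0 < t by [rewrite lt_def t0'|]; nra].
Qed.

End PositiveDefinite.

(** The transformation law of the inverse Gram matrix under a change of chart with Jacobian [J].
    Invertibility of the product forces that of [J] and [G]. *)
Lemma invmx_congr (F : fieldType) (n : nat) (J G : 'M[F]_n) :
  J *m G *m J^T \in unitmx -> J^T *m invmx (J *m G *m J^T) *m J = invmx G.
Proof.
move=> uA; move: (uA); rewrite !unitmx_mul unitmx_tr => /andP[/andP[uJ uG] _].
have H : J^T *m invmx (J *m G *m J^T) *m J *m G = 1%:M.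
  apply: (can_inj (mulmxK (_ : J^T \in unitmx))); first by rewrite unitmx_tr.
  by rewrite -!mulmxA mul1mx (mulmxA J) mulVmx// mulmx1.
by rewrite -[LHS]mulmx1 -(mulmxV uG) mulmxA H mul1mx.
Qed.

Section SmoothMatrices.
Variables (R : realType) (n : nat) (A : set 'rV[R]_n).
Hypothesis oA : open A.

Lemma smooth_on_det m (G : 'rV[R]_n -> 'M[R]_m) :
  (forall i j, smooth_on A (fun y => G y i j)) -> smooth_on A (fun y => \det (G y)).
Proof.
move=> sG; rewrite /determinant; apply: smooth_on_sum => // s.
by apply: smooth_onM => //; [exact: smooth_on_cst|apply: smooth_on_prod].
Qed.

(** Cramer's rule: the entries are cofactors divided by the determinant. *)
Lemma smooth_on_invmx m (G : 'rV[R]_n -> 'M[R]_m) :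
  (forall i j, smooth_on A (fun y => G y i j)) ->
  (forall y, A y -> 0 < \det (G y)) ->
  forall i j, smooth_on A (fun y => invmx (G y) i j).
Proof.
move=> sG dG i j.
apply: (eq_smooth_on oA (F := fun y => (\det (G y))^-1 *
    (cst ((-1) ^+ (j + i)) y * \det (row' j (col' i (G y)))))).
  move=> y /set_mem Ay; rewrite /invmx unitmxE unitfE gt_eqF ?dG//.
  by rewrite !mxE.
apply: smooth_onM => //; first by apply: smooth_onV => //; exact: smooth_on_det.
apply: smooth_onM => //; first exact: smooth_on_cst.
apply: smooth_on_det => a b.
by apply: (eq_smooth_on oA (F := fun y => G y (lift j a) (lift i b))) => // y _; rewrite !mxE.
Qed.

End SmoothMatrices.

(** * Smooth functions and their gradients in charts *)

Section Manifold.
Variables (R : realType) (n : nat) (M : ptopologicalType) (X : manifold R n M).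
Local Notation dom := (chart_dom X).
Local Notation img p := (chart X p @` chart_dom X p).
Local Notation inv := (chart_inv X).

Lemma chart_imgP p y : img p y -> dom p (inv p y) /\ chart X p (inv p y) = y.
Proof. by move=> [q Dq <-]; rewrite chartK. Qed.

Lemma chart_img p q : dom p q -> img p (chart X p q).
Proof. by move=> Dq; exists q. Qed.

Lemma open_img p : open (img p). Proof. exact: chart_img_open. Qed.

Lemma open_chart_preimage p (U : set M) : open U -> open (img p `&` inv p @^-1` U).
Proof.
move=> oU; apply: open_preimage_on oU; first exact: open_img.
by move=> y; exact: chart_inv_continuous.
Qed.

Lemma chart_image_setI p (U : set M) :
  chart X p @` (dom p `&` U) = img p `&` inv p @^-1` U.
Proof.
apply/seteqP; split=> [_ [q [Dq Uq] <-]|y [iy Uy]].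
  by split; [exact: chart_img|rewrite /= chartK].
by have [Dy Ey] := chart_imgP iy; exists (inv p y).
Qed.

Lemma near_chart p q (U : set M) : dom p q -> open U -> U q ->
  \forall y \near chart X p q, img p y /\ U (inv p y).
Proof.
move=> Dq oU Uq; apply: open_nbhs_nbhs; split; first exact: open_chart_preimage.
by split; [exact: chart_img|rewrite /= chartK].
Qed.

Lemma smooth_continuous (u : M -> R) : smooth X u -> continuous u.
Proof.
move=> su x.
have Dx := chart_dom_mem X x.
have H : {for x, continuous ((u \o inv x) \o chart X x)}.
  apply: continuous_comp; first exact: chart_continuous.
  exact: smooth_on_continuous (su x) (chart_img Dx).
rewrite /continuous_at -{2}(chartK Dx) -[u (inv x _)]/(((u \o inv x) \o chart X x) x).
apply: cvg_trans H; apply: near_eq_cvg.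
have : nbhs x (dom x) by apply: open_nbhs_nbhs; split; first exact: chart_dom_open.
by apply: filterS => y Dy; rewrite /= chartK.
Qed.

Lemma smooth_near (u : M -> R) :
  (forall x, exists U v, [/\ open U, U x, smooth X v & {in U, u =1 v}]) -> smooth X u.
Proof.
move=> H p; apply: smooth_on_local => y iy.
have [U [v [oU Uy sv uv]]] := H (inv p y).
exists (img p `&` inv p @^-1` U), (v \o inv p); split=> //.
- exact: open_chart_preimage.
- by apply: smooth_on_sub (sv p); exact: subIsetl.
- by move=> z /set_mem[_ Uz] /=; rewrite uv// inE.
Qed.

Lemma smooth_cst c : smooth X (cst c : M -> R).
Proof. by move=> p; apply: smooth_on_cst; exact: open_img. Qed.

Lemma smoothD (u v : M -> R) : smooth X u -> smooth X v -> smooth X (fun x => u x + v x).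
Proof.
move=> su sv p; apply: (smooth_onD (@open_img p) (su p) (sv p)).
Qed.

Lemma smoothM (u v : M -> R) : smooth X u -> smooth X v -> smooth X (fun x => u x * v x).
Proof.
move=> su sv p; apply: (smooth_onM (@open_img p) (su p) (sv p)).
Qed.

Lemma smoothZ c (u : M -> R) : smooth X u -> smooth X (fun x => c * u x).
Proof. by move=> su; exact: (smoothM (smooth_cst c) su). Qed.

Lemma smooth_sum (I : Type) (r : seq I) (u : I -> M -> R) :
  (forall i, smooth X (u i)) -> smooth X (fun x => \sum_(i <- r) u i x).
Proof.
move=> su p; apply: (smooth_on_sum (@open_img p) r (fun=> true) (fun i => su i p)).
Qed.

Lemma smooth_prod (I : Type) (r : seq I) (u : I -> M -> R) :
  (forall i, smooth X (u i)) -> smooth X (fun x => \prod_(i <- r) u i x).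
Proof.
move=> su p; apply: (smooth_on_prod (@open_img p) r (fun=> true) (fun i => su i p)).
Qed.

Lemma smooth_exp (u : M -> R) : smooth X u -> smooth X (fun x => expR (u x)).
Proof. move=> su p; apply: (smooth_on_exp (@open_img p) (su p)). Qed.

Lemma smooth_ln (u : M -> R) : (forall x, 0 < u x) -> smooth X u ->
  smooth X (fun x => ln (u x)).
Proof.
move=> u0 su p; apply: (smooth_on_ln (@open_img p) (fun y _ => u0 (inv p y)) (su p)).
Qed.

Lemma smoothV (u : M -> R) : (forall x, 0 < u x) -> smooth X u ->
  smooth X (fun x => (u x)^-1).
Proof.
move=> u0 su p; apply: (smooth_onV (@open_img p) (fun y _ => u0 (inv p y)) (su p)).
Qed.

Lemma smooth_bump m (u : M -> R) : smooth X u -> smooth X (fun x => bump_profile m (u x)).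
Proof. move=> su p; apply: (smooth_on_bump (@open_img p) m (su p)). Qed.

Lemma partial_chart_change p q (u : M -> R) y i : smooth X u ->
  img p y -> dom q (inv p y) ->
  partial i (u \o inv p) y =
  \sum_j transition_jacobian X p q y i j *
         partial j (u \o inv q) (chart X q (inv p y)).
Proof.
move=> su iy Dq.
pose W := img p `&` inv p @^-1` dom q.
have oW : open W by apply: open_chart_preimage; exact: chart_dom_open.
have Wy : W y by split.
have E : {in W, u \o inv p =1 fun z => (u \o inv q) (chart X q (inv p z))}.
  by move=> z /set_mem[iz Dz] /=; rewrite chartK.
rewrite (eq_partial oW i E (mem_set Wy)).
have dT j : is_derive y (delta_mx 0 i) (fun z => chart X q (inv p z) 0 j)
    (transition_jacobian X p q y i j).
  have sT : smooth_on W (fun z => chart X q (inv p z) 0 j).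
    by rewrite /W -chart_image_setI; exact: chart_transition.
  by have := smooth_on_is_derive i sT Wy; rewrite mxE.
have := is_derive_chain (@open_img q) (su q) (chart_img Dq) dT.
by move=> [_ <-].
Qed.

Variable g : metric X.

Lemma gram_det_gt0 p y : img p y -> 0 < \det (gram g p y).
Proof. by move=> iy; apply: posdef_det_gt0; exact: gram_posdef. Qed.

Lemma gram_unit p y : img p y -> gram g p y \in unitmx.
Proof. by move=> iy; rewrite unitmxE unitfE gt_eqF ?gram_det_gt0. Qed.

Lemma smooth_on_gram_inv p i j : smooth_on (img p) (fun y => invmx (gram g p y) i j).
Proof.
apply: smooth_on_invmx; [exact: open_img|exact: gram_smooth|exact: gram_det_gt0].
Qed.

Lemma smooth_on_gram_sqrt_det p :
  smooth_on (img p) (fun y => Num.sqrt (\det (gram g p y))).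
Proof.
apply: smooth_on_sqrt; [exact: open_img|exact: gram_det_gt0|].
apply: smooth_on_det; [exact: open_img|exact: gram_smooth].
Qed.

Lemma inner_coordE (G : 'rV[R]_n -> 'M[R]_n) (F H : 'rV[R]_n -> R) y :
  inner_coord G F H y = ((\row_i partial i F y) *m invmx (G y) *m
                         (\row_i partial i H y)^T) 0 0.
Proof.
rewrite /inner_coord mxE exchange_big/=; apply: eq_bigr => j _.
by rewrite mxE big_distrl/=; apply: eq_bigr => i _; rewrite !mxE [_ i j * _]mulrC.
Qed.

(** The rows of partial derivatives change by the transposed Jacobian and the Gram matrix by
    congruence; the two changes cancel by [invmx_congr]. *)
Lemma inner_coord_chart_change p q (u v : M -> R) y : smooth X u -> smooth X v ->
  img p y -> dom q (inv p y) ->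
  inner_coord (gram g p) (u \o inv p) (v \o inv p) y =
  inner_coord (gram g q) (u \o inv q) (v \o inv q) (chart X q (inv p y)).
Proof.
move=> su sv iy Dq; rewrite !inner_coordE.
have gradE (w : M -> R) : smooth X w -> \row_i partial i (w \o inv p) y =
    (\row_i partial i (w \o inv q) (chart X q (inv p y))) *m
      (transition_jacobian X p q y)^T.
  move=> sw; apply/rowP => i; rewrite !mxE (partial_chart_change i sw iy Dq).
  by apply: eq_bigr => j _; rewrite !mxE mulrC.
rewrite (gradE u su) (gradE v sv) trmx_mul trmxK.
have Wy : (chart X p @` (dom p `&` dom q)) y by rewrite chart_image_setI; split.
have uG := gram_unit iy; move: uG; rewrite (gram_transition g Wy) => uG.
by rewrite -(invmx_congr uG) !mulmxA.
Qed.

Lemma grad_inner_chart p q (u v : M -> R) : smooth X u -> smooth X v -> dom p q ->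
  grad_inner g u v q =
  inner_coord (gram g p) (u \o inv p) (v \o inv p) (chart X p q).
Proof.
move=> su sv Dq; rewrite /grad_inner.
have Dqq := chart_dom_mem X q.
by rewrite (inner_coord_chart_change (q := p) su sv (chart_img Dqq)) chartK.
Qed.

Lemma smooth_on_inner_coord p (F H : 'rV[R]_n -> R) :
  smooth_on (img p) F -> smooth_on (img p) H ->
  smooth_on (img p) (inner_coord (gram g p) F H).
Proof.
move=> sF sH; have oI := @open_img p; rewrite /inner_coord.
apply: (smooth_on_sum oI) => i; apply: (smooth_on_sum oI) => j.
apply: (smooth_onM oI); last exact: smooth_on_partial.
by apply: (smooth_onM oI); [exact: smooth_on_gram_inv|exact: smooth_on_partial].
Qed.

Lemma smooth_on_laplace_coord p (F : 'rV[R]_n -> R) : smooth_on (img p) F ->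
  smooth_on (img p) (laplace_coord (gram g p) F).
Proof.
move=> sF; have oI := @open_img p; rewrite /laplace_coord.
apply: (smooth_onM oI).
  apply: (smooth_onV oI); last exact: smooth_on_gram_sqrt_det.
  by move=> y iy; rewrite sqrtr_gt0 gram_det_gt0.
apply: (smooth_on_sum oI) => i; apply: smooth_on_partial.
apply: (smooth_on_sum oI) => j; apply: (smooth_onM oI); last exact: smooth_on_partial.
by apply: (smooth_onM oI); [exact: smooth_on_gram_sqrt_det|exact: smooth_on_gram_inv].
Qed.

Lemma smooth_on_scal_coord p : smooth_on (img p) (scal_coord (gram g p)).
Proof.
have oI := @open_img p.
have sC k i j : smooth_on (img p) (christoffel (gram g p) k i j).
  rewrite /christoffel; apply: (smooth_onM oI); first exact: (smooth_on_cst oI).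
  apply: (smooth_on_sum oI) => l; apply: (smooth_onM oI); first exact: smooth_on_gram_inv.
  by apply: (smooth_onB oI); [apply: (smooth_onD oI)|];
    apply: smooth_on_partial; exact: gram_smooth.
rewrite /scal_coord; apply: (smooth_on_sum oI) => i; apply: (smooth_on_sum oI) => j.
apply: (smooth_onM oI); first exact: smooth_on_gram_inv.
rewrite /ricci_coord; apply: (smooth_onD oI).
  by apply: (smooth_on_sum oI) => k; apply: (smooth_onB oI); exact: smooth_on_partial.
apply: (smooth_on_sum oI) => k; apply: (smooth_on_sum oI) => l.
by apply: (smooth_onB oI); exact: (smooth_onM oI).
Qed.

(** A quantity evaluated at each point in that point's own chart jumps, formally, from chart to
    chart. Continuity follows once a single chart is known to give its values on a whole chart
    domain. *)
Lemma continuous_from_chart (F : M -> R) (c : M -> 'rV[R]_n -> R) :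
  (forall p q, dom p q -> F q = c p (chart X p q)) ->
  (forall p, smooth_on (img p) (c p)) -> continuous F.
Proof.
move=> Fc sc x; have Dx := chart_dom_mem X x.
have H : {for x, continuous (c x \o chart X x)}.
  apply: continuous_comp; first exact: chart_continuous.
  exact: smooth_on_continuous (sc x) (chart_img Dx).
rewrite /continuous_at (Fc x x Dx) -[c x _]/((c x \o chart X x) x).
apply: cvg_trans H; apply: near_eq_cvg.
have : nbhs x (dom x) by apply: open_nbhs_nbhs; split; first exact: chart_dom_open.
by apply: filterS => y Dy; rewrite /= (Fc x y Dy).
Qed.

Lemma continuous_grad_inner (u v : M -> R) : smooth X u -> smooth X v ->
  continuous (grad_inner g u v).
Proof.
move=> su sv; apply: (continuous_from_chart
  (c := fun p => inner_coord (gram g p) (u \o inv p) (v \o inv p))).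
  by move=> p q; exact: grad_inner_chart.
by move=> p; exact: smooth_on_inner_coord.
Qed.

Lemma continuous_scalar_curvature S : is_scalar_curvature g S -> continuous S.
Proof.
move=> HS; apply: (continuous_from_chart (c := fun p => scal_coord (gram g p))).
  exact: HS.
exact: smooth_on_scal_coord.
Qed.

End Manifold.

(** * Riemannian volume *)

Lemma measurable_extend d1 d2 (T1 : measurableType d1) (T2 : measurableType d2)
    (A : set T1) (f : T1 -> T2) (c : T2) : measurable A -> measurable_fun A f ->
  measurable_fun setT (fun y => if y \in A then f y else c).
Proof.
move=> mA mf _ B mB; rewrite setTI.
have -> : (fun y => if y \in A then f y else c) @^-1` B =
    (A `&` f @^-1` B) `|` (~` A `&` [set _ | B c]).
  apply/seteqP; split=> y /=.
    case: ifPn => yA By; first by left; split=> //; exact: set_mem.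
    by right; split=> //; move: yA; rewrite notin_setE.
  by case=> -[yA By]; [rewrite mem_set|rewrite memNset].
apply: measurableU; first exact: mf.
apply: measurableI; first exact: measurableC.
have [Bc|Bc] := pselect (B c).
  by rewrite (_ : [set _ | B c] = setT)//; apply/seteqP; split.
by rewrite (_ : [set _ | B c] = set0)//; apply/seteqP; split.
Qed.

Section RiemannianVolume.
Variables (R : realType) (n : nat) (M : ptopologicalType) (X : manifold R n M).
Variables (g : metric X) (vol : {measure set (borel M) -> \bar R}).
Hypothesis vol_def : is_riemannian_volume g vol.
Local Notation dom := (chart_dom X).
Local Notation img p := (chart X p @` chart_dom X p).
Local Notation inv := (chart_inv X).
Local Notation Rn := (borel 'rV[R]_n).

Lemma compact_manifold_closed (K : set M) : compact K -> closed K.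
Proof. by apply: compact_closed; exact: manifold_hausdorff X. Qed.

Definition chart_density p (y : 'rV[R]_n) : R :=
  \1_(img p) y * Num.sqrt (\det (gram g p y)).

Lemma chart_density_ge0 p y : 0 <= chart_density p y.
Proof. by rewrite mulr_ge0// sqrtr_ge0. Qed.

Lemma measurable_img p : measurable (img p : set Rn).
Proof. by apply: borel_open; exact: open_img. Qed.

Lemma measurable_dom p : measurable (dom p : set (borel M)).
Proof. by apply: borel_open; exact: chart_dom_open. Qed.

Lemma measurable_chart_density p :
  measurable_fun [set: Rn] (chart_density p : Rn -> R).
Proof.
have -> : chart_density p =
    ((fun y => Num.sqrt (\det (gram g p y))) \_ (img p) : 'rV[R]_n -> R).
  apply/funext => y; rewrite /chart_density patchE indicE.
  by case: ifP => _; rewrite ?mul1r ?mul0r.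
apply: (measurable_restrictT _ (measurable_img p)).1.
apply: continuous_on_measurable; first exact: open_img.
move=> y iy; exact: (smooth_on_continuous (@smooth_on_gram_sqrt_det _ _ _ _ g p) iy).
Qed.

(** The inverse chart made total and measurable. The default value [p] outside the image is harmless
    because [chart_density] vanishes there. *)
Definition chart_inv_ext p (y : 'rV[R]_n) : M := if y \in img p then inv p y else p.

Lemma measurable_chart_inv_ext p :
  measurable_fun [set: Rn] (chart_inv_ext p : Rn -> borel M).
Proof.
apply: (@measurable_extend _ _ Rn (borel M) _ _ p (measurable_img p)).
apply: continuous_on_measurable_map; first exact: open_img.
by move=> y; exact: chart_inv_continuous.
Qed.

Section LebesgueMeasure.
Variable lam : {measure set Rn -> \bar R}.
Hypothesis lam_int : forall F : 'rV[R]_n -> \bar R,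
  measurable_fun [set: Rn] (F : Rn -> \bar R) ->
  (forall x, 0 <= F x)%E -> lebesgue_int F = (\int[lam]_x F x)%E.

(** Brings the definition of the Riemannian volume into the shape that [integral_density]
    expects. *)
Lemma vol_chart p (A : set M) : measurable (A : set (borel M)) -> A `<=` dom p ->
  vol A = (\int[lam]_y (\1_(chart_inv_ext p @^-1` A) y * chart_density p y)%:E)%E.
Proof.
move=> mA AD.
have E : (fun y => (\1_(chart_inv_ext p @^-1` A) y * chart_density p y)%:E) =
    (fun y => (\1_(chart X p @` A) y * Num.sqrt (\det (gram g p y)))%:E).
  apply/funext => y; rewrite /chart_density mulrA; congr (_ * _)%:E.
  rewrite -[in RHS](setIidr AD) chart_image_setI !indicE.
  have [iy|iy] := pselect (img p y).
    rewrite (mem_set iy) mulr1; congr (_%:R); congr (nat_of_bool _).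
    apply/idP/idP => /set_mem h; apply/mem_set.
      by split=> //; move: h; rewrite /= /chart_inv_ext mem_set.
    by move: h => [_]; rewrite /= /chart_inv_ext mem_set.
  rewrite (memNset iy) mulr0 [X in nat_of_bool X](_ : _ = false)//.
  by apply: memNset => -[].
rewrite (vol_def mA AD) -lam_int//; first by rewrite E.
  apply/measurable_EFinP; apply: measurable_funM; last exact: measurable_chart_density.
  apply: measurable_indic; rewrite -[X in measurable X]setTI.
  exact: measurable_chart_inv_ext.
by move=> x; rewrite lee_fin mulr_ge0 ?chart_density_ge0.
Qed.

(** [integral_density] asks for a formula on all measurable sets, so it is applied to the volume
    restricted to the chart domain; [F] vanishes elsewhere. *)
Lemma integral_vol_chart p (F : M -> R) :
  measurable_fun [set: borel M] (F : borel M -> R) -> (forall x, ~ dom p x -> F x = 0) ->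
  (\int[vol]_x (F x)%:E = \int[lam]_y (F (chart_inv_ext p y) * chart_density p y)%:E)%E.
Proof.
move=> mF F0.
pose nu : {measure set (borel M) -> \bar R} := mrestr vol (measurable_dom p).
have FD : (fun x => (F x)%:E) = ((fun x => (F x)%:E) \_ (dom p)).
  apply/funext => x; rewrite patchE; case: ifPn => //; rewrite notin_setE => /F0 ->.
  by [].
rewrite -(integral_density (nu := nu) (measurable_chart_inv_ext p)
  (measurable_chart_density p) (@chart_density_ge0 p) _ mF).
  rewrite FD -!integral_mkcond.
  apply: eq_measure_integral => A mA AD; rewrite /nu/= /mrestr.
  by rewrite setIidl.
move=> A mA; rewrite /nu/= /mrestr (@vol_chart p) //; last by apply: measurableI => //; exact: measurable_dom.
apply: eq_integral => y _; congr (_%:E).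
rewrite /chart_density !mulrA; congr (_ * _); rewrite !indicE.
have [iy|iy] := pselect (img p y); last by rewrite (memNset iy) !mulr0.
rewrite (mem_set iy) !mulr1; congr (_%:R); congr (nat_of_bool _).
have [Dy _] := chart_imgP iy.
apply/idP/idP => /set_mem; rewrite /= /chart_inv_ext mem_set// => h;
  apply/mem_set; rewrite /= mem_set//.
by case: h.
Qed.

End LebesgueMeasure.

Lemma chart_ball p (U : set M) : open U -> U p ->
  exists2 r, 0 < r & forall y, `|chart X p p - y| <= r -> img p y /\ U (inv p y).
Proof.
move=> oU Up; have Dp := chart_dom_mem X p.
have [r /= r0 H] : nbhs_ball (chart X p p) (img p `&` inv p @^-1` U).
  by apply/nbhs_ballP; exact: near_chart.
exists (r / 2); first by rewrite divr_gt0.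
move=> y yr; apply: H; rewrite -ball_normE/= (le_lt_trans yr)//.
by rewrite ltr_pdivrMr// ltr_pMr// ltr1n.
Qed.

Lemma chart_box_nbhs p r : 0 < r ->
  open (dom p `&` chart X p @^-1` [set y | `|chart X p p - y| < r]).
Proof.
move=> r0; apply: open_preimage_on; first exact: chart_dom_open.
  by move=> q; exact: chart_continuous.
rewrite (_ : [set y | _] = ball (chart X p p) r); first exact: ball_open.
by rewrite -ball_normE.
Qed.

(* Near p the density is bounded, on a relatively compact coordinate box. *)
Lemma vol_locally_finite p : exists U : set M, [/\ open U, U p & (vol U < +oo)%E].
Proof.
have [lam [lam_int lam_ball lam_shift lam_pos]] := lebesgue_int_measure R n.
have [r r0 Hr] := @chart_ball p setT openT I.
have cK : compact [set y : 'rV[R]_n | `|chart X p p - y| <= r].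
  apply: bounded_closed_compact; last first.
    by have := @closed_ball_closed R 'rV[R]_n (chart X p p) r; rewrite closed_ballE.
  exists (`|chart X p p| + r); split; first exact: num_real.
  move=> b rb y /= yr; apply: le_trans (ltW rb).
  by rewrite -lerBlDl (le_trans _ yr)// distrC lerB_dist.
have [C C0 HC] := compact_continuous_bounded cK (fun y yr => smooth_on_continuous
  (@smooth_on_gram_sqrt_det _ _ _ _ g p) (Hr y yr).1).
pose U := dom p `&` chart X p @^-1` [set y | `|chart X p p - y| < r].
have oU : open U := chart_box_nbhs p r0.
exists U; split=> //; first by split; [exact: chart_dom_mem|rewrite /= subrr normr0].
rewrite (vol_chart lam_int (p := p)); [|exact: borel_open|exact: subIsetl].
pose B := [set y : 'rV[R]_n | `|y| <= `|chart X p p| + r].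
apply: (@le_lt_trans _ _ (\int[lam]_y (C * \1_B y)%:E)%E).
  apply: ge0_le_integral => //.
  - by move=> y _; rewrite lee_fin mulr_ge0// chart_density_ge0.
  - apply/measurable_EFinP; apply: measurable_funM; last exact: measurable_chart_density.
    apply: measurable_indic; rewrite -[X in measurable X]setTI.
    by apply: measurable_chart_inv_ext => //; exact: borel_open.
  - apply/measurable_EFinP; apply: measurable_funM => //.
    exact: measurable_indic (borel_norm_ball _).
  move=> y _; rewrite lee_fin /chart_density mulrA !indicE.
  have [iy|iy] := pselect (img p y); last by rewrite (memNset iy) mulr0 mul0r mulr_ge0.
  have [Uy|Uy] := pselect (U (inv p y)); last first.
    rewrite (memNset (_ : ~ (chart_inv_ext p @^-1` U) y)) ?mul0r ?mulr_ge0//.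
    by rewrite /= /chart_inv_ext mem_set.
  have [Dy Ey] := chart_imgP iy; move: Uy => [_ /=]; rewrite Ey => yr.
  rewrite (mem_set iy) [X in _ <= C * X](_ : _ = 1).
    rewrite !mulr1; case: (_ \in _); rewrite ?mul0r// mul1r.
    by rewrite (le_trans (ler_norm _))// HC//= ltW.
  rewrite mem_set// /B/= -lerBlDl; apply: le_trans (ltW yr).
  by rewrite distrC lerB_dist.
under eq_integral do rewrite EFinM.
rewrite ge0_integralZl ?lee_fin//; last first.
  by apply/measurable_EFinP; exact: measurable_indic (borel_norm_ball _).
rewrite integral_indic ?setIT; last exact: borel_norm_ball.
  by apply: lte_mul_pinfty => //; exact: lam_ball.
exact: measurableT.
Qed.

Lemma vol_compact (K : set M) : compact K -> (vol K < +oo)%E.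
Proof.
move=> cK; have mK : measurable (K : set (borel M)).
  by apply: borel_closed; exact: compact_manifold_closed.
have /choice[U HU] := vol_locally_finite.
have oU x : open (U x) by have [] := HU x.
have : finite_subset_cover setT U K.
  rewrite compact_cover in cK; apply: cK => // x _.
  by exists x => //; have [] := HU x.
move=> [D' _ KD]; have /finite_seqP[s sE] := finite_fset D'.
rewrite {D'}sE in KD.
have mU i : measurable (U i : set (borel M)) by exact: borel_open.
have KU : K `<=` \big[setU/set0]_(i <- s) U i.
  by rewrite -bigcup_seq => x /KD.
apply: (@le_lt_trans _ _ (\sum_(i <- s) vol (U i))%E); last first.
  by apply: lte_sum_pinfty => x _; have [] := HU x.
apply: (@le_trans _ _ (vol (\big[setU/set0]_(i <- s) (U i : set (borel M))))).
  by apply: le_measure => //; rewrite inE//; exact: bigsetU_measurable.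
elim: {KD KU} s => [|x s IH]; first by rewrite !big_nil measure0.
rewrite !big_cons; apply: le_trans (measureU2 _ _ _) _ => //.
  exact: bigsetU_measurable.
by rewrite leeD2l.
Qed.

(** The density is positive on the chart image. If the volume were zero, a nonempty open set of
    coordinates would be a null set for Lebesgue measure. *)
Lemma vol_open_gt0 (U : set M) : open U -> U !=set0 -> (0 < vol U)%E.
Proof.
move=> oU [p Up].
have [lam [lam_int lam_ball lam_shift lam_pos]] := lebesgue_int_measure R n.
have Dp := chart_dom_mem X p.
pose V := dom p `&` U.
have oV : open V by apply: openI => //; exact: chart_dom_open.
apply: (@lt_le_trans _ _ (vol V)); last first.
  by apply: le_measure; rewrite ?inE//; try exact: borel_open; exact: subIsetr.
rewrite (vol_chart lam_int (p := p)); [|exact: borel_open|exact: subIsetl].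
pose W := img p `&` inv p @^-1` U.
have oW : open W by exact: open_chart_preimage.
have Wp : W (chart X p p) by split; [exact: chart_img|rewrite /= chartK].
rewrite lt0e; apply/andP; split; last first.
  by apply: integral_ge0 => y _; rewrite lee_fin mulr_ge0// chart_density_ge0.
apply/negP => /eqP I0.
have mF : measurable_fun [set: Rn]
    (fun y : Rn => (\1_(chart_inv_ext p @^-1` V) y * chart_density p y)%:E).
  apply/measurable_EFinP; apply: measurable_funM; last exact: measurable_chart_density.
  apply: measurable_indic; rewrite -[X in measurable X]setTI.
  by apply: measurable_chart_inv_ext => //; exact: borel_open.
have : (\int[lam]_y `|(\1_(chart_inv_ext p @^-1` V) y * chart_density p y)%:E| = 0)%E.
  rewrite -I0; apply: eq_integral => y _.
  by rewrite gee0_abs// lee_fin mulr_ge0// chart_density_ge0.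
move/(ae_eq_integral_abs lam measurableT mF).1 => [N [mN N0 HN]].
have WN : W `<=` N.
  move=> y [iy Uy]; apply: HN => /= /(_ I) /eqP; rewrite eqe.
  have [Dy _] := chart_imgP iy.
  rewrite !indicE (mem_set (_ : (chart_inv_ext p @^-1` V) y)); last first.
    by rewrite /= /chart_inv_ext mem_set.
  by rewrite mul1r /chart_density indicE mem_set// mul1r gt_eqF// sqrtr_gt0 gram_det_gt0.
have := lam_pos W oW (ex_intro _ _ Wp).
rewrite ltNge => /negP; apply; rewrite -N0.
by apply: le_measure; rewrite ?inE//; exact: borel_open.
Qed.

End RiemannianVolume.

(** * The divergence theorem inside one chart *)

Section Divergence.
Variables (R : realType) (n : nat) (M : ptopologicalType) (X : manifold R n M).
Variables (g : metric X) (vol : {measure set (borel M) -> \bar R}).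
Hypothesis vol_def : is_riemannian_volume g vol.
Local Notation dom := (chart_dom X).
Local Notation img p := (chart X p @` chart_dom X p).
Local Notation inv := (chart_inv X).

Lemma compact_borel (K : set M) : compact K -> measurable (K : set (borel M)).
Proof. by move=> cK; apply: borel_closed; exact: (compact_manifold_closed X). Qed.

Lemma integrable_compact_support (K : set M) (F : M -> R) : compact K -> continuous F ->
  (forall x, ~ K x -> F x = 0) ->
  vol.-integrable setT (EFin \o F : borel M -> \bar R).
Proof.
move=> cK cF F0.
have [C _ HC] := compact_continuous_bounded cK (fun x _ => cF x).
apply: (integrable_bounded_support (C := C) (compact_borel cK)
  (vol_compact vol_def cK)) => //.
- exact: continuous_measurable.
- exact: aeW.
Qed.

Lemma partial_chart_eq0 (U : set M) (u : M -> R) p i q : open U ->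
  (forall x, U x -> u x = 0) -> U q -> dom p q ->
  partial i (u \o inv p) (chart X p q) = 0.
Proof.
move=> oU u0 Uq Dq.
rewrite -[RHS](derive_cst (0 : R) (chart X p q) (delta_mx 0 i)).
apply: near_eq_derive.
apply: (@filterS _ _ (nbhs_filter (chart X p q)) _ _ _ (near_chart Dq oU Uq)).
by move=> y [_ Uy] /=; rewrite u0.
Qed.

Lemma grad_inner_eq0 (U : set M) (u v : M -> R) q : open U ->
  (forall x, U x -> u x = 0) -> U q -> grad_inner g u v q = 0.
Proof.
move=> oU u0 Uq; rewrite /grad_inner /inner_coord big1// => i _; rewrite big1// => j _.
by rewrite (partial_chart_eq0 i oU u0 Uq (chart_dom_mem X q)) mulr0 mul0r.
Qed.

Lemma grad_inner_support (K : set M) (u v : M -> R) q : compact K ->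
  (forall x, ~ K x -> u x = 0) -> ~ K q -> grad_inner g u v q = 0.
Proof.
move=> cK u0 Kq; apply: (@grad_inner_eq0 (~` K)) => //.
by apply: closed_openC; exact: (compact_manifold_closed X).
Qed.

(** The Laplacian in the fixed chart at [p], whereas [laplacian] changes the chart with the point.
    The two are kept apart until [laplacian_inE], whose proof uses the divergence theorem for this
    one. *)
Definition laplacian_in p (F : M -> R) (q : M) : R :=
  laplace_coord (gram g p) (F \o inv p) (chart X p q).

Lemma laplacian_in_continuous p (F : M -> R) q : smooth X F -> dom p q ->
  {for q, continuous (laplacian_in p F)}.
Proof.
move=> sF Dq; apply: continuous_comp; first exact: chart_continuous.
exact: (smooth_on_continuous (@smooth_on_laplace_coord _ _ _ _ g p _ (sF p)) (chart_img Dq)).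
Qed.

Lemma measurable_laplacian_in p (w F : M -> R) : smooth X F -> continuous w ->
  (forall x, ~ dom p x -> w x = 0) ->
  measurable_fun [set: borel M] ((fun x => w x * laplacian_in p F x) : borel M -> R).
Proof.
move=> sF cw w0.
have -> : (fun x => w x * laplacian_in p F x) =
    (fun x => w x * laplacian_in p F x) \_ (dom p).
  apply/funext => x; rewrite patchE; case: ifPn => //.
  by rewrite notin_setE => /w0 ->; rewrite mul0r.
apply: (measurable_restrictT _ (measurable_dom X p)).1.
apply: continuous_on_measurable; first exact: chart_dom_open.
move=> x Dx; have cL := laplacian_in_continuous sF Dx.
exact: (continuousM (cw x) cL).
Qed.

(* In coordinates the integrand times the density is the divergence of a
   compactly supported vector field. *)
Lemma chart_divergence p (w F : M -> R) (K : set M) : smooth X w -> smooth X F ->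
  compact K -> K `<=` dom p -> (forall x, ~ K x -> w x = 0) ->
  \int[vol]_x (w x * laplacian_in p F x + grad_inner g w F x) = 0.
Proof.
move=> sw sF cK Kp w0.
have oI := @open_img _ _ _ X p.
have [lam [lam_int lam_ball lam_shift _]] := lebesgue_int_measure R n.
have cw := smooth_continuous sw.
have wD x : ~ dom p x -> w x = 0 by move=> nD; apply: w0 => /Kp.
pose H x := w x * laplacian_in p F x + grad_inner g w F x.
have mH : measurable_fun [set: borel M] (H : borel M -> R).
  apply: measurable_funD; first exact: measurable_laplacian_in.
  by apply: continuous_measurable; exact: continuous_grad_inner.
have H0 x : ~ dom p x -> H x = 0.
  move=> nD; rewrite /H wD// mul0r add0r.
  by apply: (grad_inner_support F cK w0) => /Kp.
pose Y i y := \sum_j Num.sqrt (\det (gram g p y)) * invmx (gram g p y) i j *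
                     partial j (F \o inv p) y.
have sY i : smooth_on (img p) (Y i).
  apply: (smooth_on_sum oI) => j; apply: (smooth_onM oI).
    by apply: (smooth_onM oI); [exact: smooth_on_gram_sqrt_det|exact: smooth_on_gram_inv].
  by apply: smooth_on_partial; exact: sF.
pose Z i := (fun y => (w \o inv p) y * Y i y) \_ (img p).
have cK' : compact (chart X p @` K).
  apply: continuous_compact => //; apply: continuous_in_subspaceT => x /set_mem Kx.
  exact: chart_continuous (Kp _ Kx).
have clK' : closed (chart X p @` K).
  by apply: compact_closed cK'; exact: norm_hausdorff.
have Z0 i y : ~ (chart X p @` K) y -> Z i y = 0.
  move=> nK; rewrite /Z patchE; case: ifPn => // /set_mem iy /=.
  rewrite w0 ?mul0r// => Ky; apply: nK; exists (inv p y) => //.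
  by have [] := chart_imgP iy.
(* Two open sets cover the space: the chart image, where [Z i] is a product of smooth functions, and
   the complement of the compact image of [K], where it is zero. *)
have sZ i : smooth_on setT (Z i).
  apply: smooth_on_local => y _; have [iy|iy] := pselect (img p y).
    exists (img p), (fun y => (w \o inv p) y * Y i y); split=> //.
      exact: (smooth_onM oI (sw p) (sY i)).
    by move=> z iz; rewrite /Z patchE iz.
  exists (~` (chart X p @` K)), (cst 0); split.
  - exact: closed_openC.
  - by move=> [z Kz Ez]; apply: iy; exists z => //; exact: Kp.
  - by apply: smooth_on_cst; exact: closed_openC.
  - by move=> z /set_mem nz; rewrite Z0.
have [r Hr] : exists r, forall y, r < `|y| -> ~ (chart X p @` K) y.
  have [r [_ Hr]] := compact_bounded cK'.
  exists (r + 1) => y ry Ky; have := Hr (r + 1).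
  by rewrite ltrDl ltr01 => /(_ isT y Ky) /=; rewrite leNgt ry.
have cZ i : continuous (Z i).
  by move=> y; exact: (smooth_on_continuous (sZ i) I).
have cP i : continuous (partial i (Z i)).
  by move=> y; exact: (smooth_on_continuous (smooth_on_partial i (sZ i)) I).
have dZ i y : derivable (Z i) y (delta_mx 0 i).
  by have [] := smooth_on_is_derive i (sZ i) (I : setT y).
have P0 i y : r < `|y| -> partial i (Z i) y = 0.
  move=> /Hr nK; rewrite -[RHS](derive_cst (0 : R) y (delta_mx 0 i)).
  apply: near_eq_derive.
  have : nbhs y (~` (chart X p @` K)).
    by apply: open_nbhs_nbhs; split=> //; exact: closed_openC.
  by apply: (@filterS _ _ (nbhs_filter y)) => z; exact: Z0.
have HE y : H (chart_inv_ext X p y) * chart_density g p y = \sum_i partial i (Z i) y.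
  rewrite /chart_density indicE /chart_inv_ext.
  have [iy|iy] := pselect (img p y); last first.
    rewrite (memNset iy) mul0r mulr0 big1// => i _.
    rewrite -[RHS](derive_cst (0 : R) y (delta_mx 0 i)); apply: near_eq_derive.
    have : nbhs y (~` (chart X p @` K)).
      apply: open_nbhs_nbhs; split; first exact: closed_openC.
      by move=> [z Kz Ez]; apply: iy; exists z => //; exact: Kp.
    by apply: (@filterS _ _ (nbhs_filter y)) => z; exact: Z0.
  rewrite (mem_set iy) mul1r /H /laplacian_in.
  have [Dy Ey] := chart_imgP iy.
  rewrite (grad_inner_chart g sw sF Dy) Ey /laplace_coord /inner_coord.
  have sq0 : Num.sqrt (\det (gram g p y)) != 0.
    by rewrite gt_eqF// sqrtr_gt0 gram_det_gt0.
  transitivity ((w \o inv p) y * (\sum_i partial i (Y i) y) + Num.sqrt (\det (gram g p y)) *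
    \sum_i \sum_j invmx (gram g p y) i j * partial i (w \o inv p) y *
                   partial j (F \o inv p) y).
    rewrite /Y /=; move: sq0; set s := Num.sqrt _; set S1 := \sum_i partial i _ _.
    by set S2 := \sum_i _ => s0; field.
  rewrite !mulr_sumr -big_split/=; apply: eq_bigr => i _.
  have ZE : {in img p, Z i =1 fun y => (w \o inv p) y * Y i y}.
    by move=> z iz; rewrite /Z patchE iz.
  rewrite (eq_partial oI i ZE (mem_set iy)).
  have [_ D] := is_derive_mul (smooth_on_is_derive i (sw p) iy)
    (smooth_on_is_derive i (sY i) iy).
  transitivity ((w \o inv p) y * partial i (Y i) y + Y i y * partial i (w \o inv p) y);
    last exact: (esym D).
  congr (_ + _); rewrite /Y mulr_suml mulr_sumr; apply: eq_bigr => j _.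
  by ring.
rewrite -/(H _) /Rintegral (integral_vol_chart vol_def lam_int mH H0).
under eq_integral do rewrite HE.
have iP i := integrable_compact_row lam_ball (cP i) (P0 i).
rewrite -/(Rintegral _ _ _) (Rintegral_sum _ iP).1 big1// => i _.
apply: (integral_partial_eq0 lam_ball lam_shift (r := r)) => // y /Hr; exact: Z0.
Qed.

End Divergence.

(** * Partitions and the divergence theorem *)

Section PartitionOfUnity.
Variables (R : realType) (n : nat) (M : ptopologicalType) (X : manifold R n M).
Local Notation dom := (chart_dom X).
Local Notation img p := (chart X p @` chart_dom X p).
Local Notation inv := (chart_inv X).

(** The norm on row vectors is the maximum norm, so a product of one-variable bumps, one per
    coordinate, is supported in a ball of that norm. Its extension by zero is smooth because the
    closed ball is compact and its image in the Hausdorff space [M] is closed. *)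
Lemma exists_bump p (U : set M) : open U -> U p -> exists (b : M -> R) (K : set M),
  [/\ smooth X b, forall x, 0 <= b x, 0 < b p, compact K &
      K `<=` U `&` dom p /\ forall x, ~ K x -> b x = 0].
Proof.
move=> oU Up; have [r r0 Hr] := chart_ball X oU Up.
pose c := chart X p p; pose B := [set y : 'rV[R]_n | `|c - y| <= r].
have cB : compact B.
  apply: bounded_closed_compact; last exact: closed_closed_ball_.
  exists (`|c| + r); split; first exact: num_real.
  move=> s rs y /= yr; apply: le_trans (ltW rs).
  by rewrite -lerBlDl (le_trans _ yr)// distrC lerB_dist.
pose K := inv p @` B.
have cK : compact K.
  apply: continuous_compact => //; apply: continuous_in_subspaceT => y /set_mem yB.
  by apply: chart_inv_continuous; have [] := Hr y yB.
have clK : closed K by exact: (compact_manifold_closed X).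
have KD : K `<=` U `&` dom p.
  by move=> _ [y yB <-]; have [iy Uy] := Hr y yB; split=> //; have [] := chart_imgP iy.
pose a (t : R) := bump_profile 0 (r ^+ 2 - t ^+ 2).
pose b x := if x \in dom p then \prod_i a (chart X p x 0 i - c 0 i) else 0.
have b0 x : ~ K x -> b x = 0.
  move=> nK; rewrite /b; case: ifPn => // /set_mem Dx.
  have : ~~ (`|c - chart X p x| <= r).
    by apply/negP => h; apply: nK; exists (chart X p x) => //; rewrite chartK.
  rewrite -ltNge => rx.
  have [i Hi] : exists i, r < `|(c - chart X p x) 0 i|.
    apply: contrapT => H; move: rx; rewrite ltNge row_norm_le ?ltW// => j.
    by rewrite leNgt; apply/negP => h; apply: H; exists j.
  rewrite (bigD1 i)//= /a bump_profile0 ?mul0r//.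
  have {}Hi : r <= `|chart X p x 0 i - c 0 i|.
    by move: Hi; rewrite !mxE distrC => /ltW.
  by rewrite subr_le0 -[leRHS]real_normK ?num_real// lerXn2r ?nnegrE// ltW.
exists b, K; split=> //.
- move=> q; apply: smooth_on_local => y iy.
  have [Dy Ey] := chart_imgP iy.
  have [Ky|Ky] := pselect (K (inv q y)); last first.
    exists (img q `&` inv q @^-1` (~` K)), (cst 0); split=> //.
    + by apply: open_chart_preimage; exact: closed_openC.
    + by apply: smooth_on_cst; apply: open_chart_preimage; exact: closed_openC.
    + by move=> z /set_mem[_ nK] /=; rewrite b0.
  have oW : open (img q `&` inv q @^-1` dom p).
    by apply: open_chart_preimage; exact: chart_dom_open.
  exists (img q `&` inv q @^-1` dom p),
    (fun z => \prod_i bump_profile 0 (cst (r ^+ 2) z +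
      - ((chart X p (inv q z) 0 i - cst (c 0 i) z) *
         (chart X p (inv q z) 0 i - cst (c 0 i) z)))); split=> //.
  + by split=> //; have [] := KD _ Ky.
  + apply: (smooth_on_prod oW) => i; apply: (smooth_on_bump oW).
    apply: (smooth_onD oW); first exact: (smooth_on_cst oW).
    apply: (smooth_onN oW).
    have sT : smooth_on (img q `&` inv q @^-1` dom p)
        (fun z => chart X p (inv q z) 0 i - cst (c 0 i) z).
      apply: (smooth_onB oW); last exact: (smooth_on_cst oW).
      by rewrite -chart_image_setI; exact: chart_transition.
    exact: (smooth_onM oW).
  + by move=> z /set_mem[iz Dz] /=; rewrite /b mem_set.
- move=> x; rewrite /b; case: ifP => // _.
  by apply: prodr_ge0 => i _; exact: bump_profile_ge0.
- rewrite /b mem_set; last exact: chart_dom_mem.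
  apply: prodr_gt0 => i _; rewrite /a subrr expr0n subr0.
  by apply: bump_profile_gt0; rewrite exprn_gt0.
Qed.

(* The truncation by [1 / (k + 1)] of the earlier bumps makes the family locally
   finite, with no exhaustion by compact sets. *)
Lemma exists_partition : exists (psi : nat -> M -> R) (c : nat -> M) (K : nat -> set M),
  [/\ forall k, smooth X (psi k), forall k x, 0 <= psi k x,
      forall k, [/\ compact (K k), K k `<=` dom (c k) &
                    forall x, ~ K k x -> psi k x = 0],
      forall x, exists k, 0 < psi k x &
      forall x, exists N (U : set M), [/\ open U, U x &
        forall k y, (N <= k)%N -> U y -> psi k y = 0]].
Proof.
have /choice[b /choice[K0 Hb]] : forall p, exists (b : M -> R) (K : set M),
    [/\ smooth X b, forall x, 0 <= b x, 0 < b p, compact K &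
        K `<=` setT `&` dom p /\ forall x, ~ K x -> b x = 0].
  by move=> p; apply: exists_bump => //; exact: openT.
have [B cB [Bo Bb]] := manifold_second_countable X.
have /countable_injP[j ij] := cB.
(* Each basic open set on which some bump is positive selects one such bump, indexed through the
   injection [j] of the base into the integers; [point] is the default for the other indices. *)
have /choice[c Hc] : forall k, exists p, forall U, B U -> j U = k ->
    (exists p', U `<=` [set x | 0 < b p' x]) -> U `<=` [set x | 0 < b p x].
  move=> k; have [[U [BU jU [p Up]]]|nU] := pselect (exists U, [/\ B U, j U = k &
      exists p', U `<=` [set x | 0 < b p' x]]).
    exists p => U' BU' jU' _.
    by rewrite (_ : U' = U)//; apply: ij; rewrite ?inE// jU jU'.
  by exists point => U BU jU H; exfalso; apply: nU; exists U.
pose eta k := b (c k).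
have eta_cover x : exists k, 0 < eta k x.
  have [_ _ bx _ _] := Hb x.
  have oP : open [set y | 0 < b x y].
    have cb : continuous (b x) by have [sb _ _ _ _] := Hb x; exact: smooth_continuous sb.
    rewrite (_ : [set y | 0 < b x y] = setT `&` (b x) @^-1` [set t | 0 < t]); last first.
      by rewrite setTI.
    by apply: open_preimage_on; [exact: openT|move=> y _; exact: cb|exact: open_gt].
  have [U [BU Ux] UP] := Bb x _ (open_nbhs_nbhs (conj oP bx)).
  by exists (j U); apply: (Hc (j U) U BU erefl); first by exists x.
pose psi k x := bump_profile 0 (eta k x) *
  \prod_(i < k) bump_profile 0 (cst (k.+1%:R^-1) x + cst (-1) x * eta i x).
have seta k : smooth X (eta k) by have [] := Hb (c k).
have eta0 k x : 0 <= eta k x by have [_ H _ _ _] := Hb (c k); exact: H.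
exists psi, c, (fun k => K0 (c k)); split.
- move=> k; apply: (smoothM (smooth_bump 0 (seta k))).
  apply: smooth_prod => i; apply: smooth_bump.
  exact: (smoothD (@smooth_cst _ _ _ X _) (smoothM (@smooth_cst _ _ _ X _) (seta i))).
- move=> k x; rewrite mulr_ge0 ?bump_profile_ge0// prodr_ge0// => i _.
  exact: bump_profile_ge0.
- move=> k; have [_ _ _ cK [KD b0]] := Hb (c k); split=> //.
    by move=> x /KD[].
  by move=> x /b0 bx; rewrite /psi /eta bx bump_profile0// mul0r.
(* At the first index whose bump is positive at [x] all earlier bumps vanish, so no truncating
   factor is zero. *)
- move=> x; have [k etak kmin] := ex_minnP (eta_cover x).
  exists k; rewrite mulr_gt0 ?bump_profile_gt0//.
  apply: prodr_gt0 => i _; apply: bump_profile_gt0.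
  have -> : eta i x = 0.
    apply/eqP; rewrite eq_le eta0 andbT leNgt; apply/negP => /kmin.
    by rewrite leqNgt ltn_ord.
  by rewrite /= mulr0 addr0 invr_gt0 ltr0n.
- move=> x; have [k0 etak] := eta_cover x.
  pose e := eta k0 x / 2.
  have e0 : 0 < e by rewrite divr_gt0.
  (* Beyond this index [k0] is among the earlier bumps and [1 / (k + 1) <= e < eta k0 y], so the
     factor of [eta k0] annihilates [psi k]. *)
  exists (maxn k0.+1 (Num.truncn (e^-1)).+1), [set y | e < eta k0 y]; split.
  + rewrite (_ : [set y | e < eta k0 y] = setT `&` (eta k0) @^-1` [set t | e < t]).
      apply: open_preimage_on; [exact: openT| |exact: open_gt].
      by move=> y _; apply: (smooth_continuous (seta k0)).
    by rewrite setTI.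
  + by rewrite /= /e ltr_pdivrMr// ltr_pMr// ltr1n.
  + move=> k y; rewrite geq_max => /andP[k0k ek] /= ey.
    rewrite /psi (bigD1 (Ordinal k0k))//= [X in _ * (X * _)]bump_profile0 ?mul0r ?mulr0//.
    rewrite /= mulN1r subr_le0 (le_trans _ (ltW ey))//.
    rewrite -[leRHS]invrK lef_pV2 ?posrE ?invr_gt0 ?ltr0n//.
    have /ltW h := truncnS_gt e^-1; apply: (le_trans h).
    by rewrite ler_nat ltnW.
Qed.

(** The sum is cut at a bound depending on the point. Its value does not depend on the cut, so near
    each point it coincides with one fixed finite sum. *)
Lemma locally_finite_sum (f : nat -> M -> R) : (forall k, smooth X (f k)) ->
  (forall x, exists N (U : set M), [/\ open U, U x &
      forall k y, (N <= k)%N -> U y -> f k y = 0]) ->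
  exists2 S, smooth X S &
    forall x m, (forall k, (m <= k)%N -> f k x = 0) -> S x = \sum_(k < m) f k x.
Proof.
move=> sf /choice[N /choice[U HU]].
have SE x m m' : (forall k, (m <= k)%N -> f k x = 0) ->
    (forall k, (m' <= k)%N -> f k x = 0) ->
    \sum_(k < m) f k x = \sum_(k < m') f k x.
  wlog mm' : m m' / (m <= m')%N.
    move=> W Hm Hm'; have [mm'|/ltnW m'm] := leqP m m'; first exact: W.
    by rewrite (W m' m m'm Hm' Hm).
  move=> Hm _; rewrite -!(big_mkord xpredT (fun k => f k x)) (big_cat_nat (leq0n m) mm')//=.
  by rewrite [X in _ = _ + X]big_nat [X in _ = _ + X]big1 ?addr0// => k /andP[mk _]; exact: Hm.
have Ux x : U x x by have [] := HU x.
have Nf x y : U x y -> forall k, (N x <= k)%N -> f k y = 0.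
  by move=> Uy k Nk; have [_ _ H] := HU x; exact: H.
exists (fun x => \sum_(k < N x) f k x); last first.
  by move=> x m Hm; apply: SE => //; exact: Nf.
apply: smooth_near => x; exists (U x), (fun y => \sum_(k < N x) f k y); split=> //.
- by have [] := HU x.
- exact: smooth_sum.
- by move=> y /set_mem Uy; apply: SE; [exact: Nf|exact: Nf Uy].
Qed.

End PartitionOfUnity.

(** * Differentials and the cometric *)

Section Gradient.
Variables (R : realType) (n : nat) (M : ptopologicalType) (X : manifold R n M).
Variable g : metric X.
Local Notation img p := (chart X p @` chart_dom X p).
Local Notation inv := (chart_inv X).

(** The components of the differential in the chart of [q], with the index not raised; this is why
    they are paired by the inverse Gram matrix. *)
Definition grad_row (u : M -> R) (q : M) : 'rV[R]_n :=
  \row_i partial i (u \o inv q) (chart X q q).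

Definition cometric (q : M) (a b : 'rV[R]_n) : R :=
  (a *m invmx (gram g q (chart X q q)) *m b^T) 0 0.

Lemma grad_innerE u v q : grad_inner g u v q = cometric q (grad_row u q) (grad_row v q).
Proof. by rewrite /grad_inner inner_coordE. Qed.

Lemma img_self q : img q (chart X q q).
Proof. exact: chart_img (chart_dom_mem X q). Qed.

Lemma cometricDl q a b c : cometric q (a + b) c = cometric q a c + cometric q b c.
Proof. by rewrite /cometric !mulmxDl mxE. Qed.

Lemma cometricZl q k a c : cometric q (k *: a) c = k * cometric q a c.
Proof. by rewrite /cometric -!scalemxAl mxE. Qed.

Lemma cometricC q a b : cometric q a b = cometric q b a.
Proof.
have iq := img_self q; rewrite /cometric.
transitivity ((a *m invmx (gram g q (chart X q q)) *m b^T)^T 0 0); first by rewrite [RHS]mxE.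
by rewrite !trmx_mul trmxK trmx_inv gram_sym// mulmxA.
Qed.

Lemma cometricDr q a b c : cometric q a (b + c) = cometric q a b + cometric q a c.
Proof. by rewrite cometricC cometricDl !(cometricC q a). Qed.

Lemma cometricZr q k a c : cometric q a (k *: c) = k * cometric q a c.
Proof. by rewrite cometricC cometricZl cometricC. Qed.

Lemma cometric_ge0 q a : 0 <= cometric q a a.
Proof.
have iq := img_self q; have uG := gram_unit g iq; have sG := gram_sym g iq.
rewrite /cometric; set G := gram g q (chart X q q) in uG sG *.
have E : a *m invmx G *m a^T = (a *m invmx G) *m G *m (a *m invmx G)^T.
  by rewrite trmx_mul trmx_inv sG mulmxA mulmxKV.
rewrite E; have [->|v0] := eqVneq (a *m invmx G) 0; first by rewrite !mul0mx mxE.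
by rewrite ltW// gram_posdef.
Qed.

Lemma cometric_suml q (I : Type) (r : seq I) (a : I -> 'rV[R]_n) c :
  cometric q (\sum_(i <- r) a i) c = \sum_(i <- r) cometric q (a i) c.
Proof.
elim: r => [|i r IH]; first by rewrite !big_nil /cometric !mul0mx mxE.
by rewrite !big_cons cometricDl IH.
Qed.

Lemma smooth_partial_derive (u : M -> R) q i : smooth X u ->
  is_derive (chart X q q) (delta_mx 0 i) (u \o inv q) (grad_row u q 0 i).
Proof.
by move=> su; rewrite mxE; exact: smooth_on_is_derive (su q) (img_self q).
Qed.

Lemma grad_rowM (u v : M -> R) q : smooth X u -> smooth X v ->
  grad_row (fun x => u x * v x) q = u q *: grad_row v q + v q *: grad_row u q.
Proof.
move=> su sv; apply/rowP => i; rewrite [LHS]mxE.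
have [_ D] := is_derive_mul (smooth_partial_derive q i su) (smooth_partial_derive q i sv).
rewrite 3!mxE; apply: etrans D _ => /=.
by rewrite chartK; [rewrite !mxE|exact: chart_dom_mem].
Qed.

Lemma grad_rowD (u v : M -> R) q : smooth X u -> smooth X v ->
  grad_row (fun x => u x + v x) q = grad_row u q + grad_row v q.
Proof.
move=> su sv; apply/rowP => i; rewrite [LHS]mxE.
have [_ D] := is_derive_add (smooth_partial_derive q i su) (smooth_partial_derive q i sv).
by apply: etrans D _; rewrite [RHS]mxE.
Qed.

Lemma grad_row_comp (u : M -> R) (phi : R -> R) d q : smooth X u ->
  is_derive (u q) 1 phi d -> grad_row (fun x => phi (u x)) q = d *: grad_row u q.
Proof.
move=> su dphi; apply/rowP => i; rewrite [LHS]mxE.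
have dphi' : is_derive ((u \o inv q) (chart X q q)) 1 phi d.
  by rewrite /= chartK//; exact: chart_dom_mem.
have [_ D] := is_derive_comp1 (smooth_partial_derive q i su) dphi'.
by apply: etrans D _; rewrite [RHS]mxE.
Qed.

Lemma grad_row_sum (I : Type) (r : seq I) (u : I -> M -> R) q :
  (forall i, smooth X (u i)) ->
  grad_row (fun x => \sum_(i <- r) u i x) q = \sum_(i <- r) grad_row (u i) q.
Proof.
move=> su; apply/rowP => k; rewrite [LHS]mxE summxE.
have [_ D] := is_derive_bigsum r (fun i => smooth_partial_derive q k (su i)).
by apply: etrans D _.
Qed.

Lemma grad_rowZ k (u : M -> R) q : smooth X u ->
  grad_row (fun x => k * u x) q = k *: grad_row u q.
Proof.
move=> su; have := @grad_rowM (cst k) u q (@smooth_cst _ _ _ X k) su.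
rewrite (_ : grad_row (cst k) q = 0) ?scaler0 ?addr0//.
by apply/rowP => i; rewrite !mxE; exact: derive_cst.
Qed.

Lemma grad_row_near (U : set M) (u v : M -> R) q : open U -> U q ->
  (forall x, U x -> u x = v x) -> grad_row u q = grad_row v q.
Proof.
move=> oU Uq uv; apply/rowP => i; rewrite !mxE; apply: near_eq_derive.
apply: (@filterS _ _ (nbhs_filter (chart X q q)) _ _ _
  (near_chart (chart_dom_mem X q) oU Uq)).
by move=> y [_ Uy] /=; exact: uv.
Qed.

End Gradient.

Lemma laplacian_in_self (R : realType) n (M : ptopologicalType) (X : manifold R n M)
  (g : metric X) (F : M -> R) q : laplacian_in g q F q = laplacian g F q.
Proof. by []. Qed.

Lemma laplacian_in_coord (R : realType) n (M : ptopologicalType) (X : manifold R n M)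
  (g : metric X) p (F : M -> R) q :
  laplacian_in g p F q = laplace_coord (gram g p) (F \o chart_inv X p) (chart X p q).
Proof. by []. Qed.

Opaque laplace_coord inner_coord laplacian laplacian_in grad_inner.

(** * Chart independence of the Laplacian *)

Section GlobalDivergence.
Variables (R : realType) (n : nat) (M : ptopologicalType) (X : manifold R n M).
Variables (g : metric X) (vol : {measure set (borel M) -> \bar R}).
Hypothesis vol_def : is_riemannian_volume g vol.
Local Notation dom := (chart_dom X).
Local Notation img p := (chart X p @` chart_dom X p).
Local Notation inv := (chart_inv X).

(** A zero integral would make [F] vanish almost everywhere, but the open set where [F] is positive
    has positive volume. *)
Lemma integral_vol_gt0 (F : M -> R) (K : set M) q : compact K -> continuous F ->
  (forall x, 0 <= F x) -> (forall x, ~ K x -> F x = 0) -> 0 < F q ->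
  0 < \int[vol]_x F x.
Proof.
move=> cK cF F0 FK Fq.
have iF := integrable_compact_support vol_def cK cF FK.
rewrite lt_def Rintegral_ge0// andbT; apply/negP => /eqP I0.
have mF : measurable_fun [set: borel M] (fun x : borel M => (F x)%:E).
  by apply/measurable_EFinP; exact: continuous_measurable.
have : (\int[vol]_x `|(F x)%:E| = 0)%E.
  rewrite -[RHS](_ : (\int[vol]_x F x)%R%:E = 0%E); last by rewrite I0.
  rewrite -EFin_Rintegral//; apply: eq_integral => x _.
  by rewrite gee0_abs// lee_fin.
move/(ae_eq_integral_abs vol measurableT mF).1 => [N [mN N0 HN]].
have oP : open [set x | 0 < F x].
  rewrite (_ : [set x | 0 < F x] = setT `&` F @^-1` [set t | 0 < t]); last first.
    by rewrite setTI.
  by apply: open_preimage_on; [exact: openT|move=> y _; exact: cF|exact: open_gt].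
have PN : [set x | 0 < F x] `<=` N.
  move=> x /= Fx; apply: HN => /= /(_ I) /eqP; rewrite eqe => /eqP F0x.
  by move: Fx; rewrite F0x ltxx.
have := vol_open_gt0 vol_def oP (ex_intro _ q Fq).
rewrite ltNge => /negP; apply; rewrite -N0.
by apply: le_measure; rewrite ?inE//; exact: borel_open.
Qed.

Lemma continuous_mul_support (w h : M -> R) (U K : set M) : open U -> compact K ->
  K `<=` U -> continuous w -> (forall x, ~ K x -> w x = 0) ->
  (forall x, U x -> {for x, continuous h}) -> continuous (fun x => w x * h x).
Proof.
move=> oU cK KU cw w0 ch x; have [Kx|Kx] := pselect (K x).
  exact: (continuousM (cw x) (ch x (KU x Kx))).
have oK : open (~` K) by apply: closed_openC; exact: (compact_manifold_closed X).
have E : {near x, (cst 0 : M -> R) =1 (fun x => w x * h x)}.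
  have : nbhs x (~` K) by exact: open_nbhs_nbhs.
  by apply: filterS => y /w0 ->; rewrite mul0r.
rewrite /continuous_at w0// mul0r.
exact: (cvg_trans (near_eq_cvg E) (@cvg_cst _ _ _ _ _)).
Qed.

(* Both coordinate expressions are adjoint to the gradient for the same measure,
   so they agree when tested against bumps. *)
Lemma laplacian_inE p (F : M -> R) q : smooth X F -> dom p q ->
  laplacian_in g p F q = laplacian g F q.
Proof.
move=> sF Dq; rewrite -(laplacian_in_self g F q).
apply/eqP; rewrite -subr_eq0; apply/negP => /negP D0.
pose D x := laplacian_in g p F x - laplacian_in g q F x.
pose U0 := dom p `&` dom q.
have oU0 : open U0 by apply: openI; exact: chart_dom_open.
have cD x : U0 x -> {for x, continuous (fun x => D x * D q)}.
  move=> [px qx].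
  have c1 := laplacian_in_continuous (g := g) sF px.
  have c2 := laplacian_in_continuous (g := g) sF qx.
  have cc : {for x, continuous (cst (D q) : M -> R)} by exact: cst_continuous.
  exact: (continuousM (continuousB c1 c2) cc).
(* Multiplication by the constant [D q] makes the discrepancy positive near [q] whatever its
   sign. *)
pose U := U0 `&` (fun x => D x * D q) @^-1` [set t | 0 < t].
have oU : open U by apply: open_preimage_on => //; exact: open_gt.
have DD : 0 < D q * D q by rewrite -expr2 lt_def sqrf_eq0 D0 sqr_ge0.
have Uq : U q by split=> //; split=> //; exact: chart_dom_mem.
have [b [K [sb b0 bq cK [KU bK]]]] := exists_bump X oU Uq.
have cb := smooth_continuous sb.
have KU0 : K `<=` U0 by move=> x /KU[[]].
have cbL p' : (U0 `<=` dom p') -> continuous (fun x => b x * laplacian_in g p' F x).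
  move=> Up'; apply: (continuous_mul_support oU0 cK KU0 cb bK) => x /Up'.
  exact: laplacian_in_continuous.
have U0p : U0 `<=` dom p by exact: subIsetl.
have U0q : U0 `<=` dom q by exact: subIsetr.
have iL p' (Up' : U0 `<=` dom p') := integrable_compact_support vol_def cK (cbL p' Up')
  (fun x nK => etrans (congr1 (fun t => t * _) (bK x nK)) (mul0r _)).
have iG : vol.-integrable setT (EFin \o (grad_inner g b F : borel M -> R)).
  apply: (integrable_compact_support vol_def cK).
    exact: continuous_grad_inner.
  by move=> x; exact: (grad_inner_support g F cK bK).
have E p' : (U0 `<=` dom p') -> \int[vol]_x (b x * laplacian_in g p' F x) =
    - \int[vol]_x grad_inner g b F x.
  move=> Up'; apply/eqP; rewrite -addr_eq0 -RintegralD//; last exact: iL.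
  apply/eqP; apply: (chart_divergence vol_def sb sF cK _ bK).
  by move=> x /KU0 /Up'.
have : 0 < \int[vol]_x (b x * (D x * D q)).
  apply: (@integral_vol_gt0 _ K q) => //.
  - exact: (continuous_mul_support oU0 cK KU0 cb bK).
  - move=> x; have [Kx|Kx] := pselect (K x); last by rewrite bK// mul0r.
    by have [[_ h] _] := KU x Kx; apply: mulr_ge0; [exact: b0|exact: (ltW h)].
  - by move=> x /bK ->; rewrite mul0r.
  - by rewrite mulr_gt0.
rewrite (_ : (fun x => b x * (D x * D q)) = (fun x => D q * (b x * laplacian_in g p F x
    - b x * laplacian_in g q F x))); last first.
  by apply/funext => x; rewrite -mulrBr -/(D x) mulrA mulrC.
have iLp := iL p U0p; have iLq := iL q U0q.
rewrite (RintegralZl _ measurableT (integrableBr iLp iLq)).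
have IB := RintegralB measurableT iLp iLq.
have I0 := etrans IB (etrans (congr2 (fun s t => s - t) (E p U0p) (E q U0q)) (subrr _)).
by rewrite I0 mulr0 ltxx.
Qed.

Lemma continuous_laplacian (F : M -> R) : smooth X F -> continuous (laplacian g F).
Proof.
move=> sF; apply: (continuous_from_chart (X := X)
  (c := fun p => laplace_coord (gram g p) (F \o inv p))).
  by move=> p q Dq; rewrite -(laplacian_inE sF Dq) laplacian_in_coord.
by move=> p; exact: smooth_on_laplace_coord.
Qed.

Lemma compact_locally_finite (f : nat -> M -> R) (K : set M) : compact K ->
  (forall x, exists N (U : set M), [/\ open U, U x &
      forall k y, (N <= k)%N -> U y -> f k y = 0]) ->
  exists N, forall k x, (N <= k)%N -> K x -> f k x = 0.
Proof.
move=> cK /choice[N /choice[U HU]].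
have : finite_subset_cover setT U K.
  rewrite compact_cover in cK; apply: cK => [x _|x _]; first by have [] := HU x.
  by exists x => //; have [] := HU x.
move=> [D' _ KD]; have /finite_seqP[s sE] := finite_fset D'.
rewrite {D'}sE in KD.
exists (\max_(x <- s) N x)%N => k x Nk /KD[y ys Uy].
have [_ _ H] := HU y; apply: H => //; apply: leq_trans Nk.
exact: (leq_bigmax_seq (F := N)).
Qed.

End GlobalDivergence.

Section ProductSums.
Variable R : realType.

Lemma mul0_eq (a b c : R) : a = 0 -> a * b = a * c.
Proof. by move=> ->; rewrite !mul0r. Qed.

Lemma mul_add0 (a b c : R) : a = 0 -> b = 0 -> a * c + b = 0.
Proof. by move=> -> ->; rewrite mul0r addr0. Qed.

Lemma eq_mul_add (a a' b b' c c' : R) : a * b = a' * b' -> c = c' ->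
  a * b + c = a' * b' + c'.
Proof. by move=> -> ->. Qed.

Lemma continuous_mul_add (T : topologicalType) (a b c : T -> R) :
  continuous a -> continuous b -> continuous c -> continuous (fun x => a x * b x + c x).
Proof.
by move=> ca cb cc x; apply: cvgD; [apply: cvgM; [exact: ca|exact: cb]|exact: cc].
Qed.

Lemma sum_mul_add (I : Type) (r : seq I) (a c : I -> R) (b : R) :
  \sum_(i <- r) (a i * b + c i) = (\sum_(i <- r) a i) * b + \sum_(i <- r) c i.
Proof. by rewrite big_split/= mulr_suml. Qed.

End ProductSums.

(** * The divergence theorem on the manifold *)

Section Divergence.
Variables (R : realType) (n : nat) (M : ptopologicalType) (X : manifold R n M).
Variables (g : metric X) (vol : {measure set (borel M) -> \bar R}).
Hypothesis vol_def : is_riemannian_volume g vol.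
Local Notation dom := (chart_dom X).
Local Notation img p := (chart X p @` chart_dom X p).
Local Notation inv := (chart_inv X).

(** Only finitely many members of the family are nonzero on the compact set [K], so [w] is a finite
    sum of pieces [w psi_k / Psi], each supported in one chart domain, where [chart_divergence]
    applies. The family does not sum to one; the division by its sum [Psi] normalises it here. *)
Lemma divergence (w F : M -> R) (K : set M) : smooth X w -> smooth X F ->
  compact K -> (forall x, ~ K x -> w x = 0) ->
  \int[vol]_x (w x * laplacian g F x + grad_inner g w F x) = 0.
Proof.
move=> sw sF cK w0.
have [psi [c [Kp [spsi psi0 Kpsi psi_pos psi_fin]]]] := exists_partition X.
have [Psi sPsi PsiE] := locally_finite_sum spsi psi_fin.
have [N HN] := compact_locally_finite cK psi_fin.
have Psi0 x : 0 < Psi x.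
  have [N0 [U [_ Ux HU]]] := psi_fin x.
  have [k pk] := psi_pos x.
  have kN : (k < N0)%N by rewrite ltnNge; apply/negP => /HU/(_ Ux) E; rewrite E ltxx in pk.
  rewrite (PsiE x N0) => [|k' Nk']; last exact: HU.
  rewrite (bigD1 (Ordinal kN))//=; apply: ltr_wpDr => //.
  by apply: sumr_ge0 => i _.
pose w' k x := (w x * (Psi x)^-1) * psi k x.
have sw' k : smooth X (w' k).
  exact: (smoothM (smoothM sw (smoothV Psi0 sPsi)) (spsi k)).
have wE : w = fun x => \sum_(k < N) w' k x.
  apply/funext => x; have [Kx|Kx] := pselect (K x); last first.
    by rewrite w0// big1// => k _; rewrite /w' w0// !mul0r.
  rewrite -mulr_sumr -(PsiE x N) => [|k Nk]; last exact: HN.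
  by rewrite mulfVK// gt_eqF.
have divk k : \int[vol]_x (w' k x * laplacian g F x + grad_inner g (w' k) F x) = 0.
  have [cKk KD pk] := Kpsi k.
  have w'0 x : ~ Kp k x -> w' k x = 0 by move=> /pk E; rewrite /w' E mulr0.
  rewrite -[RHS](chart_divergence vol_def (sw' k) sF cKk KD w'0).
  have Ek x : w' k x * laplacian g F x = w' k x * laplacian_in g (c k) F x.
    have [Kx|nK] := pselect (Kp k x); last exact: (mul0_eq _ _ (w'0 x nK)).
    by rewrite (laplacian_inE vol_def sF (KD x Kx)).
  by apply: eq_Rintegral => x _; exact: eq_mul_add (Ek x) erefl.
have ik k : vol.-integrable setT (EFin \o
    ((fun x => w' k x * laplacian g F x + grad_inner g (w' k) F x) : borel M -> R)).
  have w'0 x : ~ K x -> w' k x = 0 by move=> /w0 E; rewrite /w' E !mul0r.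
  apply: (integrable_compact_support vol_def cK).
    have cg : continuous (grad_inner g (w' k) F) := continuous_grad_inner (g := g) (sw' k) sF.
    exact: (continuous_mul_add (smooth_continuous (sw' k)) (continuous_laplacian vol_def sF) cg).
  move=> x nK; exact: (mul_add0 _ (w'0 x nK) (grad_inner_support g F cK w'0 nK)).
have [IS _] := Rintegral_sum (index_enum 'I_N) (fun k : 'I_N => ik k).
rewrite (eq_bigr (fun=> 0)) in IS; last by move=> k _; exact: divk.
rewrite big1// in IS; rewrite -[RHS]IS; apply: eq_Rintegral => x _.
apply: esym; apply: etrans (sum_mul_add _ _ _ _) _.
apply: eq_mul_add; first by rewrite [in RHS]wE.
rewrite grad_innerE [in RHS]wE grad_row_sum; last by move=> k; exact: sw'.
rewrite cometric_suml; apply: eq_bigr => k _; exact: grad_innerE.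
Qed.

End Divergence.

(** * The weighted measure and the drifted Laplacian *)

Section WeightedMeasure.
Variables (R : realType) (n : nat) (M : ptopologicalType) (X : manifold R n M).
Variables (g : metric X) (vol mu : {measure set (borel M) -> \bar R}).
Variables (f : M -> R) (tau : R).
Hypothesis vol_def : is_riemannian_volume g vol.
Hypothesis f_smooth : smooth X f.
Hypothesis tau_gt0 : 0 < tau.
Hypothesis mu_def : is_weighted_measure n vol f tau mu.

Definition weight (x : M) : R := gauss_factor n tau * expR (- f x).

Lemma gauss_factor_gt0 : 0 < gauss_factor n tau.
Proof. by rewrite powR_gt0// !mulr_gt0// pi_gt0. Qed.

Lemma weight_gt0 x : 0 < weight x.
Proof. by rewrite mulr_gt0 ?gauss_factor_gt0 ?expR_gt0. Qed.

(** Arbitrary coefficients, because both the weight and its square root have this form. *)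
Lemma smooth_exp_affine (a b : R) : smooth X (fun x => expR (a + b * f x)).
Proof.
exact: (smooth_exp (smoothD (@smooth_cst _ _ _ X a) (smoothZ b f_smooth))).
Qed.

Lemma weightE : weight = fun x => expR (ln (gauss_factor n tau) + (- 1) * f x).
Proof.
apply/funext => x; rewrite /weight expRD lnK ?posrE ?gauss_factor_gt0//.
by rewrite mulN1r.
Qed.

Lemma smooth_weight : smooth X weight.
Proof. by rewrite weightE; exact: smooth_exp_affine. Qed.

Lemma grad_row_exp_affine (a b : R) q :
  grad_row X (fun x => expR (a + b * f x)) q
  = (expR (a + b * f q) * b) *: grad_row X f q.
Proof.
have sa : smooth X (fun _ : M => a) := @smooth_cst _ _ _ X a.
have D := grad_rowD q sa (smoothZ b f_smooth).
have C := grad_row_comp (q := q) (smoothD sa (smoothZ b f_smooth)) (is_derive_expR _).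
apply: etrans C _; rewrite D (grad_rowZ b q f_smooth).
rewrite (_ : grad_row _ (fun=> a) q = 0) ?add0r ?scalerA//.
by apply/rowP => i; rewrite !mxE; exact: derive_cst.
Qed.

Lemma continuous_weight : continuous weight.
Proof. exact: smooth_continuous smooth_weight. Qed.

Lemma measurable_weight : measurable_fun [set: borel M] (weight : borel M -> R).
Proof. by apply: continuous_measurable; exact: continuous_weight. Qed.

Lemma mu_indicE (A : set (borel M)) : measurable A ->
  mu A = (\int[vol]_x (\1_(idfun @^-1` A) x * weight x)%:E)%E.
Proof.
move=> mA; rewrite (mu_def mA) integral_mkcond; apply: eq_integral => x _.
by rewrite patchE indicE /weight; case: (x \in A); rewrite ?mul1r ?mul0r.
Qed.

Lemma integral_mu (F : borel M -> R) : measurable_fun setT F ->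
  (\int[mu]_x (F x)%:E = \int[vol]_x (F x * weight x)%:E)%E.
Proof.
move=> mF; exact: (integral_density (phi := idfun) (@measurable_id _ _ _) measurable_weight
  (fun x => ltW (weight_gt0 x)) mu_indicE mF).
Qed.

Lemma Rintegral_mu (F : borel M -> R) : measurable_fun setT F ->
  \int[mu]_x F x = \int[vol]_x (F x * weight x).
Proof. by move=> mF; rewrite /Rintegral integral_mu. Qed.

Lemma mu_compact (K : set M) : compact K -> (mu K < +oo)%E.
Proof.
move=> cK; have mK := compact_borel X cK.
have [C C0 HC] := compact_continuous_bounded cK
  (fun x _ => @continuous_weight x).
rewrite (mu_def mK); apply: (@le_lt_trans _ _ (\int[vol]_(x in K) (cst C%:E x))%E).
  apply: ge0_le_integral => //.
  - by move=> x _; rewrite lee_fin ltW// weight_gt0.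
  - by apply/measurable_EFinP; apply: measurable_funS measurable_weight.
  - by move=> x Kx; rewrite lee_fin (le_trans (ler_norm _))// HC.
by rewrite integral_cst// lte_mul_pinfty// (vol_compact vol_def).
Qed.

Lemma ae_mu (P : M -> Prop) : {ae vol, forall x, P x} -> {ae mu, forall x, P x}.
Proof.
move=> [N [mN N0 HN]]; exists N; split=> //.
by rewrite (mu_def mN) null_set_integral//; apply/measurable_EFinP;
  apply: measurable_funS measurable_weight.
Qed.

Lemma integrable_mu_bounded (K : set M) (F : M -> R) C : compact K ->
  measurable_fun [set: borel M] (F : borel M -> R) ->
  {ae vol, forall x, K x -> `|F x| <= C} -> (forall x, ~ K x -> F x = 0) ->
  mu.-integrable setT (EFin \o F : borel M -> \bar R).
Proof.
move=> cK mF FC F0.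
apply: (integrable_bounded_support (C := C) (compact_borel X cK) (mu_compact cK)) => //.
exact: ae_mu.
Qed.

Lemma integrable_mu_continuous (K : set M) (F : M -> R) : compact K -> continuous F ->
  (forall x, ~ K x -> F x = 0) -> mu.-integrable setT (EFin \o F : borel M -> \bar R).
Proof.
move=> cK cF F0; have [C _ HC] := compact_continuous_bounded cK (fun x _ => cF x).
apply: (integrable_mu_bounded (C := C) cK) => //; first exact: continuous_measurable.
exact: aeW.
Qed.

Lemma continuous_drift_laplacian (v : M -> R) : smooth X v ->
  continuous (drift_laplacian g f v).
Proof.
move=> sv x; have cl := continuous_laplacian vol_def sv.
have cg : continuous (grad_inner g f v) := continuous_grad_inner (g := g) f_smooth sv.
exact: (continuousB (cl x) (cg x)).
Qed.

(** The divergence theorem for [w * weight]: the gradient of the weight contributes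
    [- w <grad f, grad v>], exactly the drift term. *)
Lemma weighted_divergence (w v : M -> R) (K : set M) : smooth X w -> smooth X v ->
  compact K -> (forall x, ~ K x -> w x = 0) ->
  \int[mu]_x (w x * drift_laplacian g f v x + grad_inner g w v x) = 0.
Proof.
move=> sw sv cK w0.
have mH : measurable_fun [set: borel M] ((fun x => w x * drift_laplacian g f v x
    + grad_inner g w v x) : borel M -> R).
  have cg : continuous (grad_inner g w v) := continuous_grad_inner (g := g) sw sv.
  apply: continuous_measurable.
  exact: (continuous_mul_add (smooth_continuous sw) (continuous_drift_laplacian sv) cg).
rewrite (Rintegral_mu mH).
have swd := smoothM sw smooth_weight.
have wd0 x : ~ K x -> w x * weight x = 0 by move=> /w0 ->; rewrite mul0r.
rewrite -[RHS](divergence vol_def swd sv cK wd0).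
apply: eq_Rintegral => x _; rewrite /drift_laplacian !grad_innerE.
rewrite (grad_rowM x sw smooth_weight) weightE grad_row_exp_affine.
rewrite cometricDl !cometricZl.
by move: (laplacian g v x) (cometric g x _ _) (cometric g x _ _) => a b c; ring.
Qed.

Lemma smooth_cpt_support (u : M -> R) : smooth_cpt X u ->
  exists2 K : set M, compact K & forall x, ~ K x -> u x = 0.
Proof.
move=> [_ cK]; exists (closure [set x | u x != 0]) => // x nK.
by apply/eqP/negPn/negP => ux; apply: nK; exact: subset_closure.
Qed.

End WeightedMeasure.

(** * Perelman's entropy *)

Lemma ln_le_sub1 (R : realType) (y : R) : 0 < y -> ln y <= y - 1.
Proof.
move=> y0; have := expR_ge1Dx (ln y); rewrite lnK ?posrE// => h.
by rewrite lerBrDl.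
Qed.

Lemma mul_lnV_le (R : realType) (y : R) : 0 <= y -> - (y * ln y) <= 1 - y.
Proof.
rewrite le_eqVlt => /predU1P[<-|y0]; first by rewrite mul0r oppr0 addr0 ler01.
have := ln_le_sub1 (y := y^-1); rewrite invr_gt0 => /(_ y0); rewrite lnV ?posrE// => h.
have := ler_wpM2l (ltW y0) h; rewrite mulrBr mulfV ?gt_eqF// mulr1.
by rewrite mulrN.
Qed.

Lemma norm_mul_ln_le (R : realType) (y : R) : 0 <= y -> `|y * ln y| <= 1 + y ^+ 2.
Proof.
move=> y0; rewrite ler_norml; apply/andP; split.
  by have := mul_lnV_le y0; nra.
move: y0; rewrite le_eqVlt => /predU1P[<-|y0]; first by rewrite mul0r; nra.
by have := ln_le_sub1 y0; nra.
Qed.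

Lemma continuous_add (R : realType) (T : topologicalType) (a b : T -> R) :
  continuous a -> continuous b -> continuous (fun x => a x + b x).
Proof. by move=> ca cb x; apply: cvgD; [exact: ca|exact: cb]. Qed.

Lemma continuous_mul (R : realType) (T : topologicalType) (a b : T -> R) :
  continuous a -> continuous b -> continuous (fun x => a x * b x).
Proof. by move=> ca cb x; apply: cvgM; [exact: ca|exact: cb]. Qed.

Lemma continuous_comp_sqr (R : realType) (T : topologicalType) (z : T -> R) :
  continuous z -> continuous (fun x => z x ^+ 2).
Proof. by move=> cz x; apply: (@cvgM _ _ _ (nbhs_filter x) z z); exact: cz. Qed.

Section Entropy.
Variables (R : realType) (n : nat) (M : ptopologicalType) (X : manifold R n M).
Variables (g : metric X) (vol : {measure set (borel M) -> \bar R}).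
Variables (S : M -> R) (tau : R).
Hypothesis vol_def : is_riemannian_volume g vol.
Hypothesis S_def : is_scalar_curvature g S.
Hypothesis tau_gt0 : 0 < tau.
Local Notation G := (gauss_factor n tau).

(* The integrand of Perelman's functional K: the constant
   - n (1 + ln (4 pi tau) / 2) equals [ln G - n]. *)
Definition entropy_density (z : M -> R) (x : M) : R :=
  tau * (S x * z x ^+ 2 + 4 * grad_inner g z z x) + (ln G - n%:R) * z x ^+ 2
  - z x ^+ 2 * ln (z x ^+ 2).

Lemma entropy_densityZ (c : R) (z : M -> R) x : 0 < c -> smooth X z ->
  entropy_density (fun y => c * z y) x
  = c ^+ 2 * entropy_density z x - c ^+ 2 * ln (c ^+ 2) * z x ^+ 2.
Proof.
move=> c0 sz; rewrite /entropy_density !grad_innerE (grad_rowZ c x sz).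
rewrite cometricZl cometricZr exprMn.
move: (cometric g x _ _) (S x) => a s.
have [->|z0] := eqVneq (z x) 0; first by rewrite expr0n/=; ring.
have z2 : 0 < z x ^+ 2 by rewrite exprn_even_gt0.
rewrite lnM ?posrE// ?exprn_gt0//.
by move: (ln (c ^+ 2)) (ln (z x ^+ 2)) => u v; ring.
Qed.

(** The logarithmic term is [- c^2 ln c^2 = 2 c (- c ln c) <= 2 c (1 - c)]. The bound is linear in
    [c], and its other factor does not depend on [c]. *)
Lemma entropy_densityZ_le (c : R) (z : M -> R) x : 0 < c -> c <= 1 -> smooth X z ->
  entropy_density (fun y => c * z y) x
  <= c * (`|entropy_density z x| + 2 * z x ^+ 2).
Proof.
move=> c0 c1 sz; rewrite (entropy_densityZ x c0 sz).
have e1 : c ^+ 2 * entropy_density z x <= c * `|entropy_density z x|.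
  apply: (@le_trans _ _ (c ^+ 2 * `|entropy_density z x|)).
    by rewrite ler_wpM2l ?sqr_ge0// ler_norm.
  by rewrite ler_wpM2r// expr2 ler_piMr// ltW.
have := mul_lnV_le (ltW c0); rewrite lnXn// => h.
have z2 := sqr_ge0 (z x).
move: e1; move: (entropy_density z x) => e e1.
rewrite [X in _ <= X]mulrDr; apply: lerD => //.
have := ler_wpM2r z2 (ler_wpM2l (ltW c0) h).
have := mulr_ge0 (mulr_ge0 (ltW c0) (ltW c0)) z2.
by move: (ln c) (z x ^+ 2) => l y; rewrite mulr2n; lra.
Qed.

Lemma continuous_entropy_quadratic (z : M -> R) : smooth X z -> continuous (fun x =>
  tau * (S x * z x ^+ 2 + 4 * grad_inner g z z x) + (ln G - n%:R) * z x ^+ 2).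
Proof.
move=> sz; have cz2 : continuous (fun x => z x ^+ 2).
  exact: (continuous_comp_sqr (smooth_continuous sz)).
have cg : continuous (grad_inner g z z) := continuous_grad_inner (g := g) sz sz.
have cS : continuous S := continuous_scalar_curvature S_def.
have cc (k : R) : continuous (fun _ : M => k) by move=> x; exact: cvg_cst.
apply: (continuous_add _ (continuous_mul (cc _) cz2)).
exact: (continuous_mul (cc _) (continuous_add (continuous_mul cS cz2) (continuous_mul (cc _) cg))).
Qed.

Lemma measurable_mul_ln_sqr (z : borel M -> R) : measurable_fun setT z ->
  measurable_fun setT (fun x => z x ^+ 2 * ln (z x ^+ 2)).
Proof.
move=> mz; have mz2 : measurable_fun setT (fun x => z x ^+ 2) by exact: measurable_funX.
by apply: measurable_funM => //; exact: (measurableT_comp (@measurable_ln R) mz2).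
Qed.

Lemma measurable_entropy_density (z : M -> R) : smooth X z ->
  measurable_fun [set: borel M] (entropy_density z : borel M -> R).
Proof.
move=> sz; apply: measurable_funB.
  exact: (continuous_measurable (continuous_entropy_quadratic sz)).
apply: measurable_mul_ln_sqr.
exact: (continuous_measurable (smooth_continuous sz)).
Qed.

Lemma entropy_density_eq0 (z : M -> R) (K : set M) x : compact K ->
  (forall x, ~ K x -> z x = 0) -> ~ K x -> entropy_density z x = 0.
Proof.
move=> cK z0 nK; rewrite /entropy_density (z0 x nK) (grad_inner_support g z cK z0 nK).
by rewrite expr0n/=; ring.
Qed.

Lemma integrable_entropy_density (z : M -> R) (K : set M) : smooth X z -> compact K ->
  (forall x, ~ K x -> z x = 0) ->
  vol.-integrable setT (EFin \o entropy_density z : borel M -> \bar R).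
Proof.
move=> sz cK z0.
have cq := continuous_entropy_quadratic sz; have cz := smooth_continuous sz.
have [C C0 HC] := compact_continuous_bounded cK (fun x _ => cq x).
have [D D0 HD] := compact_continuous_bounded cK (fun x _ => cz x).
apply: (integrable_bounded_support (C := C + (1 + (D ^+ 2) ^+ 2)) (compact_borel X cK)
  (vol_compact vol_def cK)).
- exact: measurable_entropy_density.
- apply: aeW => x Kx; apply: (le_trans (ler_normB _ _)); apply: lerD; first exact: HC.
  apply: (le_trans (norm_mul_ln_le (sqr_ge0 _))); rewrite lerD2l ler_pXn2r ?nnegrE ?sqr_ge0//.
  by rewrite -real_normK ?num_real// ler_pXn2r ?nnegrE// HD.
- by move=> x; exact: (entropy_density_eq0 cK z0).
Qed.

(* With [G e^-h = sum z_k^2], completing squares gives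
   [4 sum |grad z_k|^2 - G e^-h |grad h|^2 = sum |2 grad z_k + z_k grad h|^2]. *)
Lemma W_integrand_le (I : Type) (r : seq I) (z : I -> M -> R) (h : M -> R) (U : set M) x :
  open U -> U x -> smooth X h -> (forall i, smooth X (z i)) ->
  (forall y, U y -> G * expR (- h y) = \sum_(i <- r) z i y ^+ 2) ->
  (W_integrand g S tau h x <= (\sum_(i <- r) entropy_density (z i) x)%:E)%E.
Proof.
move=> oU Ux sh sz E; rewrite /W_integrand lee_fin.
have G0 := @gauss_factor_gt0 R n tau tau_gt0.
set H := grad_row X h x; pose Z i := grad_row X (z i) x.
set P := G * expR (- h x).
have P0 : 0 < P by rewrite mulr_gt0 ?expR_gt0.
have PE : P = \sum_(i <- r) z i x ^+ 2 by exact: E.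
have hE : h x = ln G - ln P by rewrite lnM ?posrE ?expR_gt0// expRK; ring.
(* The identity for the density is differentiated; this is why it is assumed on a neighbourhood of
   [x]. *)
have dP : \sum_(i <- r) (2 * z i x) *: Z i = - P *: H.
  have dl : grad_row X (fun y => G * expR (- h y)) x = - P *: H.
    have sN : smooth X (fun y => - 1 * h y) by exact: smoothZ.
    have e1 : (fun y => G * expR (- h y)) = (fun y => G * expR (- 1 * h y)).
      by apply/funext => y; rewrite mulN1r.
    rewrite e1 (grad_rowZ G x (smooth_exp sN)).
    have C := grad_row_comp (q := x) sN (is_derive_expR _).
    rewrite C (grad_rowZ (- 1) x sh) !scalerA; congr (_ *: _).
    by rewrite /P mulN1r; ring.
  have sz2 i : smooth X (fun y => z i y ^+ 2) := smoothM (sz i) (sz i).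
  rewrite -dl (grad_row_near X oU Ux E) (grad_row_sum r x sz2).
  apply: eq_bigr => i _; rewrite (grad_rowM x (sz i) (sz i)) -scalerDl.
  by congr (_ *: _); ring.
have C : \sum_(i <- r) 4 * cometric g x (Z i) (Z i) - P * cometric g x H H
    = \sum_(i <- r) cometric g x (2 *: Z i + z i x *: H) (2 *: Z i + z i x *: H).
  have e i : cometric g x (2 *: Z i + z i x *: H) (2 *: Z i + z i x *: H)
     = 4 * cometric g x (Z i) (Z i) + 2 * cometric g x ((2 * z i x) *: Z i) H
       + z i x ^+ 2 * cometric g x H H.
    rewrite !(cometricDl, cometricDr, cometricZl, cometricZr) (cometricC g x H (Z i)).
    by move: (cometric g x (Z i) H) => a; ring.
  under [RHS]eq_bigr do rewrite e.
  have T : \sum_(i <- r) cometric g x ((2 * z i x) *: Z i) H = - P * cometric g x H H.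
    by rewrite -cometric_suml dP cometricZl.
  rewrite big_split big_split/= -mulr_suml -PE -[X in _ = _ + X + _]mulr_sumr T.
  by move: (cometric g x H H) (\sum_(i <- r) _) => a b; ring.
have C0 : 0 <= \sum_(i <- r) 4 * cometric g x (Z i) (Z i) - P * cometric g x H H.
  by rewrite C; apply: sumr_ge0 => i _; exact: cometric_ge0.
(* Each square is at most their sum [P] and the logarithm is increasing; a vanishing square is set
   apart, its term being zero. *)
have L : \sum_(i <- r) z i x ^+ 2 * ln (z i x ^+ 2) <= P * ln P.
  rewrite [X in X * ln P]PE mulr_suml.
  have le1 : forall s : seq I, 0 <= \sum_(i <- s) z i x ^+ 2.
    by move=> s; apply: sumr_ge0 => i _; exact: sqr_ge0.
  have : forall i, List.In i r -> z i x ^+ 2 <= P.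
    rewrite PE; elim: (r) => [//|j s IH] i /=; rewrite big_cons => -[->|/IH].
      by rewrite lerDl.
    by move/le_trans; apply; rewrite lerDr sqr_ge0.
  elim: (r) => [|j s IH] Hs; first by rewrite !big_nil.
  rewrite !big_cons lerD//; last by apply: IH => i si; apply: Hs; right.
  have [->|z0] := eqVneq (z j x) 0; first by rewrite expr0n/= !mul0r.
  apply: ler_wpM2l; first exact: sqr_ge0.
  have zj : 0 < z j x ^+ 2 by rewrite exprn_even_gt0.
  by rewrite ler_ln ?posrE//; apply: Hs; left.
rewrite /entropy_density.
under [X in _ <= X]eq_bigr do rewrite grad_innerE.
rewrite sumrB big_split/= -mulr_sumr big_split/= -!mulr_sumr -PE.
rewrite grad_innerE -/H hE.
have C0' := ler_wpM2l (ltW tau_gt0) C0; rewrite mulr0 -mulr_sumr in C0'.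
move: L C0' {C C0 dP}; rewrite -/Z.
move: (\sum_(i <- r) _ * ln _) (\sum_(i <- r) cometric _ _ _ _) (cometric g x H H) => a b c.
by move: (ln P) (ln G) (S x) => u v s; nra.
Qed.

End Entropy.

Lemma nneseries_finite_support (R : realType) (u : nat -> R) m :
  (forall k, 0 <= u k) -> (forall k, (m <= k)%N -> u k = 0) ->
  (\sum_(0 <= k <oo) (u k)%:E = (\sum_(k < m) u k)%:E)%E.
Proof.
move=> u0 um; rewrite (nneseries_split 0 m); last by move=> k _; rewrite lee_fin.
rewrite add0n eseries0 ?adde0; last by move=> k mk _; rewrite um.
by rewrite big_mkord -sumEFin.
Qed.

(** * Integrals with an integrable majorant *)

Section MeasureLemmas.
Context (d : measure_display) (T : measurableType d) (R : realType).
Variable m : {measure set T -> \bar R}.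

(** [F] need not be integrable and its integral may be [-oo]. The finiteness of the positive part is
    what [W_meaningful] asks for. *)
Lemma le_integral_upper (F H : T -> \bar R) : measurable_fun setT F ->
  m.-integrable setT H -> (forall x, (F x <= H x)%E) ->
  (\int[m]_x F x <= \int[m]_x H x)%E /\ (\int[m]_x F^\+ x < +oo)%E.
Proof.
move=> mF iH FH; have mH := measurable_int _ iH.
have p : (\int[m]_x F^\+ x <= \int[m]_x H^\+ x)%E.
  apply: ge0_le_integral => //.
  - exact: measurable_funepos.
  - exact: measurable_funepos.
  - by move=> x _; rewrite !funeposE ge_max !le_max FH lexx !orbT.
have q : (\int[m]_x H^\- x <= \int[m]_x F^\- x)%E.
  apply: ge0_le_integral => //.
  - exact: measurable_funeneg.
  - exact: measurable_funeneg.
  - by move=> x _; rewrite !funenegE ge_max !le_max leeN2 FH lexx !orbT.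
split; last by apply: le_lt_trans p _; have := integrable_pos_fin_num measurableT iH;
  rewrite ge0_fin_numE ?integral_ge0.
by rewrite [X in (X <= _)%E]integralE [X in (_ <= X)%E]integralE; apply: leeB.
Qed.

Lemma integral_add_nneseries (a : T -> R) (u : nat -> T -> R) :
  m.-integrable setT (EFin \o a) ->
  (forall k, m.-integrable setT (EFin \o u k)) -> (forall k x, 0 <= u k x) ->
  (\sum_(0 <= k <oo) (\int[m]_x u k x)%:E < +oo)%E ->
  let H x := ((a x)%:E + \sum_(0 <= k <oo) (u k x)%:E)%E in
  m.-integrable setT H /\
  (\int[m]_x H x = (\int[m]_x a x)%:E + \sum_(0 <= k <oo) (\int[m]_x u k x)%:E)%E.
Proof.
move=> ia iu u0 fin.
have mu k : measurable_fun setT (fun x => (u k x)%:E) by exact: measurable_int (iu k).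
pose s x := (\sum_(0 <= k <oo) (u k x)%:E)%E.
have s0 x : (0 <= s x)%E by apply: nneseries_ge0 => k _ _; rewrite lee_fin.
have Is : (\int[m]_x s x = \sum_(0 <= k <oo) (\int[m]_x u k x)%:E)%E.
  rewrite integral_nneseries//; last by move=> k x _; rewrite lee_fin.
  by apply: eq_eseriesr => k _; rewrite EFin_Rintegral.
have iS : m.-integrable setT s.
  apply/integrableP; split.
    by apply: (ge0_emeasurable_sum (P := xpredT)) => // k x _ _; rewrite lee_fin.
  by under eq_integral do rewrite gee0_abs//; rewrite Is.
split; first exact: (integrableD measurableT ia iS).
by rewrite (integralD measurableT ia iS) Is EFin_Rintegral.
Qed.

End MeasureLemmas.

(** * Gluing a locally finite family into an admissible density *)

Section MuUpperBound.
Variables (R : realType) (n : nat) (M : ptopologicalType) (X : manifold R n M).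
Variables (g : metric X) (vol : {measure set (borel M) -> \bar R}).
Variables (S : M -> R) (tau : R).
Hypothesis vol_def : is_riemannian_volume g vol.
Hypothesis S_def : is_scalar_curvature g S.
Hypothesis tau_gt0 : 0 < tau.
Local Notation G := (gauss_factor n tau).
Local Notation E := (entropy_density g S tau).

Lemma integrable_sqr (z : M -> R) (K : set M) : smooth X z -> compact K ->
  (forall x, ~ K x -> z x = 0) ->
  vol.-integrable setT (EFin \o (fun x => z x ^+ 2) : borel M -> \bar R).
Proof.
move=> sz cK z0; have cz := continuous_comp_sqr (smooth_continuous sz).
apply: (integrable_compact_support vol_def cK cz) => x nK.
by rewrite (z0 x nK) expr0n.
Qed.

Lemma measurable_W_integrand (h : M -> R) : smooth X h ->
  measurable_fun [set: borel M] (W_integrand g S tau h : borel M -> \bar R).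
Proof.
move=> sh; apply/measurable_EFinP; apply: continuous_measurable.
have cg : continuous (grad_inner g h h) := continuous_grad_inner (g := g) sh sh.
have cS : continuous S := continuous_scalar_curvature S_def.
have ch := smooth_continuous sh.
have cc (k : R) : continuous (fun _ : M => k) by move=> x; exact: cvg_cst.
have sN : smooth X (fun x => - 1 * h x) by exact: smoothZ.
have ce : continuous (fun x => expR (- h x)).
  rewrite (_ : (fun x => _) = (fun x => expR (- 1 * h x))).
    exact: (smooth_continuous (smooth_exp sN)).
  by apply/funext => x; rewrite mulN1r.
apply: continuous_mul; last exact: (continuous_mul (cc _) ce).
apply: continuous_add; last exact: (cc _).
apply: continuous_add; last exact: ch.
exact: (continuous_mul (cc _) (continuous_add cS cg)).
Qed.

(* Gluing the family z, zeta_0, zeta_1, ... into the density [z^2 + sum zeta_k^2]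
   gives an admissible function in the definition of [mu_functional]. *)
Lemma mu_functional_le_series (z : M -> R) (K : set M) (zeta : nat -> M -> R)
    (A : nat -> M -> R) :
  smooth X z -> compact K -> (forall x, ~ K x -> z x = 0) ->
  (forall k, smooth X (zeta k)) ->
  (forall k, vol.-integrable setT (EFin \o (fun x => zeta k x ^+ 2) : borel M -> \bar R)) ->
  (forall x, exists N (U : set M), [/\ open U, U x &
     forall k y, (N <= k)%N -> U y -> zeta k y = 0]) ->
  (forall x, exists k, 0 < zeta k x) ->
  ((\int[vol]_x (z x ^+ 2))%:E
     + \sum_(0 <= k <oo) (\int[vol]_x (zeta k x ^+ 2))%:E = 1)%E ->
  (forall k, vol.-integrable setT (EFin \o A k : borel M -> \bar R)) ->
  (forall k x, 0 <= A k x) -> (forall k x, E (zeta k) x <= A k x) ->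
  (forall k (U : set M) x, open U -> U x -> (forall y, U y -> zeta k y = 0) -> A k x = 0) ->
  (\sum_(0 <= k <oo) (\int[vol]_x A k x)%:E < +oo)%E ->
  (mu_functional g vol S tau <=
     (\int[vol]_x E z x)%:E + \sum_(0 <= k <oo) (\int[vol]_x A k x)%:E)%E.
Proof.
move=> sz cK z0 szeta izeta lf pos sum1 iA A0 EA Az finA.
(* The index is shifted by one to make room for [z], so [N] of the functions [zeta] correspond to
   [N.+1] terms below. *)
pose zz k := if k is k'.+1 then zeta k' else z.
have szz k : smooth X (zz k) by case: k.
have szz2 k : smooth X (fun x => zz k x ^+ 2) := smoothM (szz k) (szz k).
have lfz x : exists N (U : set M), [/\ open U, U x &
    forall k y, (N <= k)%N -> U y -> zz k y ^+ 2 = 0].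
  have [N [U [oU Ux HU]]] := lf x; exists N.+1, U; split=> // -[//|k] y Nk Uy.
  by rewrite /zz (HU k y Nk Uy) expr0n.
have [Phi sPhi PhiE] := locally_finite_sum szz2 lfz.
have Phi_gt0 x : 0 < Phi x.
  have [k zk] := pos x; have [N [U [oU Ux HU]]] := lfz x.
  have kN : (k.+1 < maxn N k.+2)%N by rewrite leq_max leqnn orbT.
  rewrite (PhiE x (maxn N k.+2)); last by move=> j; rewrite geq_max => /andP[Nj _]; exact: HU.
  rewrite (bigD1 (Ordinal kN))//= ltr_wpDr ?exprn_gt0// sumr_ge0// => i _.
  exact: sqr_ge0.
pose h x := ln G + (- 1) * ln (Phi x).
have sh : smooth X h.
  have sG : smooth X (fun _ : M => ln G) := @smooth_cst _ _ _ X (ln G).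
  have sl := smooth_ln Phi_gt0 sPhi.
  exact: (smoothD sG (smoothZ (- 1) sl)).
have G0 := @gauss_factor_gt0 R n tau tau_gt0.
have hPhi x : G * expR (- h x) = Phi x.
  rewrite /h mulN1r opprD opprK expRD lnK ?posrE// -[X in expR X]lnV ?posrE//.
  by rewrite lnK ?posrE ?invr_gt0// mulrA mulfV ?mul1r// gt_eqF.
have tail x : exists N (U : set M), [/\ open U, U x,
    (forall k y, (N <= k)%N -> U y -> zeta k y = 0) &
    forall y, U y -> G * expR (- h y) = \sum_(i < N.+1) zz i y ^+ 2].
  have [N [U [oU Ux HU]]] := lf x; exists N, U; split=> // y Uy.
  rewrite hPhi; apply: PhiE => -[//|k] Nk.
  by rewrite /zz (HU k y Nk Uy) expr0n.
have PhiS x : (G * expR (- h x))%:E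
    = ((z x ^+ 2)%:E + \sum_(0 <= k <oo) (zeta k x ^+ 2)%:E)%E.
  have [N [U [oU Ux HU e]]] := tail x; rewrite (e x Ux) big_ord_recl EFinD; congr (_ + _)%E.
  rewrite (@nneseries_finite_support R (fun k => zeta k x ^+ 2) N)//.
  - by move=> k; exact: sqr_ge0.
  - by move=> k Nk; rewrite (HU k x Nk Ux) expr0n.
have finz : (\sum_(0 <= k <oo) (\int[vol]_x (zeta k x ^+ 2))%:E < +oo)%E.
  by rewrite ltNge leye_eq; apply/negP => /eqP Eoo; move: sum1; rewrite Eoo.
have [_ IPhi] := integral_add_nneseries (integrable_sqr sz cK z0) izeta
  (fun k x => sqr_ge0 _) finz.
have iEz := integrable_entropy_density tau vol_def S_def sz cK z0.
have [iH IH] := integral_add_nneseries iEz iA A0 finA.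
have WH x : (W_integrand g S tau h x <= (E z x)%:E + \sum_(0 <= k <oo) (A k x)%:E)%E.
  have [N [U [oU Ux HU e]]] := tail x.
  have := W_integrand_le g S tau_gt0 oU Ux sh (fun i : 'I_N.+1 => szz i) e.
  move=> /le_trans; apply; rewrite big_ord_recl EFinD leeD2l//.
  rewrite (@nneseries_finite_support R (fun k => A k x) N)//.
    by rewrite lee_fin; apply: ler_sum => i _; exact: EA.
  by move=> k Nk; apply: (Az k U x oU Ux) => y Uy; exact: HU.
have [le1 le2] := le_integral_upper (measurable_W_integrand sh) iH WH.
rewrite -IH; apply: le_trans le1; apply: ereal_inf_lbound; exists h => //; split => //.
  by rewrite -[RHS]sum1 -IPhi; apply: eq_integral => x _.
by left.
Qed.

End MuUpperBound.

(** * Perelman's functional tested on compactly supported functions *)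

Section MuBound.
Variables (R : realType) (n : nat) (M : ptopologicalType) (X : manifold R n M).
Variables (g : metric X) (vol : {measure set (borel M) -> \bar R}).
Variables (S : M -> R) (tau : R).
Hypothesis vol_def : is_riemannian_volume g vol.
Hypothesis S_def : is_scalar_curvature g S.
Hypothesis tau_gt0 : 0 < tau.
Local Notation E := (entropy_density g S tau).

Lemma entropy_density_local_eq0 (z : M -> R) (U : set M) x : open U -> U x ->
  (forall y, U y -> z y = 0) -> E z x = 0.
Proof.
move=> oU Ux z0; rewrite /entropy_density (grad_inner_eq0 g z oU z0 Ux) (z0 x Ux).
by rewrite expr0n/=; ring.
Qed.

(** The majorant [A k] is [|E (psi k)| + 2 psi_k^2]. It is independent of the scale [c], so scales
    can be chosen afterwards in terms of the integrals of the [A k], and it vanishes wherever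
    [psi k] vanishes locally, which keeps the family locally finite. *)
Lemma exists_vanishing_partition : exists (psi : nat -> M -> R) (A : nat -> M -> R),
  [/\ [/\ forall k, smooth X (psi k),
      forall k, vol.-integrable setT (EFin \o (fun x => psi k x ^+ 2) : borel M -> \bar R),
      forall x, exists k, 0 < psi k x &
      forall x, exists N (U : set M), [/\ open U, U x &
        forall k y, (N <= k)%N -> U y -> psi k y = 0]],
   forall k, vol.-integrable setT (EFin \o A k : borel M -> \bar R),
   forall k x, psi k x ^+ 2 <= A k x,
   forall c k x, 0 < c -> c <= 1 -> E (fun y => c * psi k y) x <= c * A k x &
   forall k (U : set M) x, open U -> U x -> (forall y, U y -> psi k y = 0) -> A k x = 0].
Proof.
have [psi [c [K [spsi psi0 Kpsi pos fin]]]] := exists_partition X.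
have ipsi k : vol.-integrable setT (EFin \o (fun x => psi k x ^+ 2) : borel M -> \bar R).
  by have [cK _ K0] := Kpsi k; exact: (integrable_sqr vol_def (spsi k) cK K0).
exists psi, (fun k x => `|E (psi k) x| + 2 * psi k x ^+ 2); split=> //.
- move=> k; have [cK _ K0] := Kpsi k.
  have iE := integrable_entropy_density tau vol_def S_def (spsi k) cK K0.
  have i2 := integrableZl measurableT 2 (ipsi k).
  exact: (integrableD measurableT (integrable_abse iE) i2).
- move=> k x; have := normr_ge0 (E (psi k) x); have := sqr_ge0 (psi k x).
  by move: `|_| (psi k x ^+ 2) => a b; lra.
- by move=> c' k x c0 c1; exact: (entropy_densityZ_le g S tau x c0 c1 (spsi k)).
- move=> k U x oU Ux z0; rewrite (entropy_density_local_eq0 oU Ux z0) (z0 x Ux).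
  by rewrite normr0 expr0n/= mulr0 addr0.
Qed.

(** The bumps [psi k] are scaled by [del * d k]: the factors [d k] make masses and entropies
    summable, and [del] makes their sums small. The mass given to the bumps is taken from [phi], and
    the total cost is at most any prescribed [e]. *)
Lemma mu_functional_le (phi : M -> R) (K : set M) : smooth X phi -> compact K ->
  (forall x, ~ K x -> phi x = 0) -> \int[vol]_x (phi x ^+ 2) = 1 ->
  (mu_functional g vol S tau <= (\int[vol]_x E phi x)%:E)%E.
Proof.
move=> sphi cK phi0 phi1.
have [psi [A [[spsi ipsi pos fin] iA psiA EA Az]]] := exists_vanishing_partition.
have iphi := integrable_sqr vol_def sphi cK phi0.
have iE := integrable_entropy_density tau vol_def S_def sphi cK phi0.
have A0 k x : 0 <= A k x by exact: le_trans (sqr_ge0 _) (psiA k x).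
pose a k := \int[vol]_x A k x; pose s k := \int[vol]_x (psi k x ^+ 2).
have a0 k : 0 <= a k by exact: Rintegral_ge0.
have s0 k : 0 <= s k by apply: Rintegral_ge0 => x _; exact: sqr_ge0.
have sa k : s k <= a k by apply: le_Rintegral => // x _; exact: psiA.
(* Makes [d k * a k] at most [2^-(k+1)], with sum at most 1 over [k]; the summand 1 in [1 + a k]
   guards against [a k = 0] and keeps [d k <= 1]. *)
pose d k := (1 + a k)^-1 / (2 ^ k.+1)%:R.
have a1 k : 0 < 1 + a k by rewrite ltr_wpDr.
have p0 k : 0 < ((2 ^ k.+1)%:R : R) by rewrite ltr0n expn_gt0.
have p1 k : 1 <= ((2 ^ k.+1)%:R : R) by rewrite ler1n expn_gt0.
have d0 k : 0 < d k by rewrite divr_gt0 ?invr_gt0.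
have d1 k : d k <= 1.
  rewrite ler_pdivrMr// mul1r (le_trans _ (p1 k))// invf_le1// lerDl.
  exact: a0.
have da k : d k * a k <= 1 / (2 ^ k.+1)%:R.
  rewrite /d mulrAC ler_wpM2r ?invr_ge0 ?(ltW (p0 k))//.
  by rewrite mulrC ler_pdivrMr// mul1r lerDr.
have ds k : d k ^+ 2 * s k <= 1 / (2 ^ k.+1)%:R.
  apply: le_trans (da k); apply: ler_pM => //; first exact: sqr_ge0.
  by rewrite expr2 ler_piMr// ltW.
have trick (u : nat -> R) : (forall k, 0 <= u k) -> (forall k, u k <= 1 / (2 ^ k.+1)%:R) ->
    (\sum_(0 <= k <oo) (u k)%:E <= 1)%E.
  move=> u0 u1; apply: le_trans (epsilon_trick0 xpredT ler01).
  by apply: lee_nneseries => k *; rewrite lee_fin.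
have m1 := trick (fun k => d k ^+ 2 * s k) (fun k => mulr_ge0 (sqr_ge0 _) (s0 k)) ds.
have m0 : (0 <= \sum_(0 <= k <oo) (d k ^+ 2 * s k)%:E)%E.
  by apply: nneseries_ge0 => k _ _; rewrite lee_fin mulr_ge0 ?sqr_ge0.
have [m mE] : exists m : R, (\sum_(0 <= k <oo) (d k ^+ 2 * s k)%:E = m%:E)%E.
  by move: m1 m0; case: (\big[_/_]_(0 <= k <oo) _)%E => [r| |]//; exists r.
rewrite mE !lee_fin in m0 m1.
have mA := trick (fun k => d k * a k) (fun k => mulr_ge0 (ltW (d0 k)) (a0 k)) da.
pose Q := \int[vol]_x E phi x; rewrite -/Q.
apply/lee_addgt0Pr => e e0; rewrite -EFinD.
(* The error is at most [del * (|Q| + 2)]: [del * |Q|] from shrinking [phi], [del] from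
   [- c2 ln c2 <= 1 - c2], and [del] from the bumps. The bound [1/2] keeps [c2] positive. *)
pose del := Num.min (2^-1) (e / (`|Q| + 2)).
have Q2 : 0 < `|Q| + 2 by rewrite ltr_wpDl.
have del0 : 0 < del by rewrite lt_min invr_gt0 ltr0n divr_gt0.
have delh : del <= 2^-1 by rewrite ge_min lexx.
have dele : del * (`|Q| + 2) <= e by rewrite -ler_pdivlMr// ge_min lexx orbT.
have del1 : del <= 1 by apply: le_trans delh _; rewrite invf_le1// ler1n.
(* The bumps have total mass [del ^+ 2 * m]; this is the mass left to [phi]. *)
pose c2 := 1 - del ^+ 2 * m.
have dm0 : 0 <= del ^+ 2 * m by rewrite mulr_ge0// sqr_ge0.
have dm1 : del ^+ 2 * m <= del by rewrite expr2 -mulrA ler_piMr ?(ltW del0)// mulr_ile1// ltW.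
have c2_gt0 : 0 < c2 by rewrite /c2; lra.
have c2_le1 : c2 <= 1 by rewrite /c2; lra.
pose c := Num.sqrt c2.
have c0 : 0 < c by rewrite sqrtr_gt0.
have cE : c ^+ 2 = c2 by rewrite sqr_sqrtr// ltW.
pose z x := c * phi x.
have sz : smooth X z := smoothZ c sphi.
have z0 x : ~ K x -> z x = 0 by move=> nK; rewrite /z (phi0 x nK) mulr0.
pose zeta k x := del * d k * psi k x.
have dd0 k : 0 < del * d k by rewrite mulr_gt0.
have dd1 k : del * d k <= 1 by exact: le_trans (ler_piMr (ltW del0) (d1 k)) del1.
pose B k x := del * d k * A k x.
have szeta k : smooth X (zeta k) := smoothZ (del * d k) (spsi k).
have zetaE k x : zeta k x ^+ 2 = (del * d k) ^+ 2 * psi k x ^+ 2 by rewrite exprMn.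
have izeta k : vol.-integrable setT (EFin \o (fun x => zeta k x ^+ 2) : borel M -> \bar R).
  apply: eq_integrable (integrableZl measurableT ((del * d k) ^+ 2) (ipsi k)) => //.
  by move=> x _; rewrite /= zetaE.
have Izeta k : \int[vol]_x (zeta k x ^+ 2) = del ^+ 2 * (d k ^+ 2 * s k).
  under eq_Rintegral do rewrite zetaE.
  by apply: etrans (RintegralZl _ measurableT (ipsi k)) _; rewrite exprMn -mulrA.
have iB k : vol.-integrable setT (EFin \o B k : borel M -> \bar R).
  by apply: eq_integrable (integrableZl measurableT (del * d k) (iA k)).
have IB k : \int[vol]_x B k x = del * (d k * a k) by apply: etrans (RintegralZl _ measurableT (iA k)) _; rewrite -mulrA.
have sum1 : ((\int[vol]_x (z x ^+ 2))%:E
    + \sum_(0 <= k <oo) (\int[vol]_x (zeta k x ^+ 2))%:E = 1)%E.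
  under eq_eseriesr do rewrite Izeta EFinM.
  rewrite nneseriesZl; last by move=> k _; rewrite lee_fin mulr_ge0 ?sqr_ge0.
  under eq_Rintegral do rewrite exprMn.
  by rewrite mE RintegralZl// phi1 mulr1 cE -EFinM -EFinD /c2 subrK.
have sumB : (\sum_(0 <= k <oo) (\int[vol]_x B k x)%:E <= del%:E)%E.
  under eq_eseriesr do rewrite IB EFinM.
  rewrite nneseriesZl; last by move=> k _; rewrite lee_fin mulr_ge0// ltW.
  by rewrite -[leRHS]mule1 lee_wpmul2l// lee_fin ltW.
have lfz x : exists N (U : set M), [/\ open U, U x &
     forall k y, (N <= k)%N -> U y -> zeta k y = 0].
  have [N [U [oU Ux H]]] := fin x; exists N, U; split=> // k y Nk Uy.
  by rewrite /zeta (H k y Nk Uy) mulr0.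
have posz x : exists k, 0 < zeta k x.
  by have [k pk] := pos x; exists k; rewrite mulr_gt0.
have B0 k x : 0 <= B k x by rewrite mulr_ge0// ltW.
have EB k x : E (zeta k) x <= B k x by exact: EA.
have Bz k (U : set M) x : open U -> U x -> (forall y, U y -> zeta k y = 0) -> B k x = 0.
  move=> oU Ux HU; rewrite /B (Az k U x oU Ux) ?mulr0// => y /HU /eqP.
  by rewrite mulf_eq0 gt_eqF//= => /eqP.
have finB := le_lt_trans sumB (ltry del).
have := mu_functional_le_series vol_def S_def tau_gt0 sz cK z0 szeta izeta lfz posz sum1
  iB B0 EB Bz finB.
move=> /le_trans; apply; apply: le_trans (leeD2l _ sumB) _; rewrite -EFinD lee_fin.
have -> : \int[vol]_x E z x = c2 * Q - c2 * ln c2.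
  under eq_Rintegral do rewrite (entropy_densityZ g S tau _ c0 sphi) cE.
  rewrite RintegralB//; last 2 first.
  - exact: (integrableZl measurableT c2 iE).
  - exact: (integrableZl measurableT (c2 * ln c2) iphi).
  by rewrite !RintegralZl// phi1 mulr1.
have h1 := mul_lnV_le (ltW c2_gt0).
have h2 : - Q <= `|Q| by rewrite -normrN ler_norm.
have h3 := ler_wpM2l dm0 h2.
have h4 := ler_wpM2r (normr_ge0 Q) dm1.
by move: h1 h3 h4 dele dm1; rewrite /c2; lra.
Qed.

End MuBound.

(** * The Rayleigh quotient *)

Section EntropyTransform.
Variables (R : realType) (n : nat) (M : ptopologicalType) (X : manifold R n M).
Variables (g : metric X) (vol mu : {measure set (borel M) -> \bar R}).
Variables (f S : M -> R) (tau : R).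
Hypothesis vol_def : is_riemannian_volume g vol.
Hypothesis S_def : is_scalar_curvature g S.
Hypothesis f_smooth : smooth X f.
Hypothesis tau_gt0 : 0 < tau.
Hypothesis mu_def : is_weighted_measure n vol f tau mu.
Local Notation G := (gauss_factor n tau).

Definition potential_density (u : M -> R) (x : M) : R :=
  (n%:R - f x - tau * weighted_scalar_curvature g S f x) * u x ^+ 2.

(** The integrand of the weighted divergence theorem for [u ^+ 2] and [f]. Its integral is zero, and
    carrying it along makes the integration by parts a pointwise identity. *)
Definition divergence_density (u : M -> R) (x : M) : R :=
  u x ^+ 2 * drift_laplacian g f f x + grad_inner g (fun y => u y ^+ 2) f x.

Definition half_weight (x : M) : R := expR (2^-1 * ln G + - 2^-1 * f x).

Lemma half_weight_sqr x : half_weight x ^+ 2 = weight n f tau x.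
Proof.
rewrite (weightE n f tau_gt0) /half_weight expr2 -expRD; congr expR.
by move: (ln G) (f x) => a b; lra.
Qed.

(** The square root of the weight has gradient [- 1/2] times itself times [grad f], so
    [4 tau |grad phi|^2] contains the cross term [- 4 tau u <grad u, grad f>]. This is [- 2 tau]
    times the divergence density up to [2 tau u^2] times the drifted Laplacian of [f], which is the
    origin of the last summand of [R_f]. *)
Lemma entropy_density_half_weight (u : M -> R) x : smooth X u ->
  entropy_density g S tau (fun y => u y * half_weight y) x
  = (4 * tau * grad_inner g u u x - u x ^+ 2 * ln (u x ^+ 2)
     - potential_density u x - 2 * tau * divergence_density u x)
    * weight n f tau x.
Proof.
move=> su.
have sw : smooth X half_weight := smooth_exp_affine f_smooth (2^-1 * ln G) (- 2^-1).
rewrite /divergence_density /potential_density /weighted_scalar_curvature /entropy_density.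
rewrite !grad_innerE (grad_rowM x su sw) (grad_rowM x su su).
rewrite (grad_row_exp_affine f_smooth (2^-1 * ln G) (- 2^-1) x) -/(half_weight x).
rewrite !(cometricDl, cometricDr, cometricZl, cometricZr).
rewrite (cometricC g x (grad_row X f x) (grad_row X u x)).
(* The logarithm of the product does not split at a zero of [u], but there the factor in front
   vanishes. *)
have lnw : u x ^+ 2 * half_weight x ^+ 2 * ln (u x ^+ 2 * half_weight x ^+ 2)
    = u x ^+ 2 * half_weight x ^+ 2 * (ln (u x ^+ 2) + (ln G - f x)).
  have [->|u0] := eqVneq (u x) 0; first by rewrite expr0n/= !mul0r.
  have u2 : 0 < u x ^+ 2 by rewrite exprn_even_gt0.
  rewrite half_weight_sqr lnM ?posrE//; last exact: (@weight_gt0 R n M f tau tau_gt0 x).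
  by rewrite [in ln (weight _ _ _ _)](weightE n f tau_gt0) expRK mulN1r.
rewrite exprMn lnw -half_weight_sqr.
move: (half_weight x) (u x) (f x) (S x) (ln G) (ln _) => w v b s l m.
move: (drift_laplacian g f f x) => D.
move: (cometric g x (grad_row X u x) (grad_row X f x)) (cometric g x (grad_row X u x) (grad_row X u x))
  (cometric g x (grad_row X f x) (grad_row X f x)) => p q r.
by field.
Qed.

Section TestFunction.
Variables (u : M -> R) (K : set M).
Hypotheses (su : smooth X u) (cK : compact K) (u0 : forall x, ~ K x -> u x = 0).

Lemma sqr_support x : ~ K x -> u x ^+ 2 = 0.
Proof. by move=> nK; rewrite (u0 nK) expr0n. Qed.

Lemma smooth_sqr : smooth X (fun x => u x ^+ 2).
Proof. exact: (smoothM su su). Qed.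

Lemma integrable_grad_sqr :
  mu.-integrable setT (EFin \o (grad_inner g u u : borel M -> R)).
Proof.
have cg : continuous (grad_inner g u u) := continuous_grad_inner (g := g) su su.
apply: (integrable_mu_continuous vol_def f_smooth tau_gt0 mu_def cK cg) => x.
exact: (grad_inner_support g u cK u0).
Qed.

Lemma integrable_mu_sqr :
  mu.-integrable setT (EFin \o ((fun x => u x ^+ 2) : borel M -> R)).
Proof.
apply: (integrable_mu_continuous vol_def f_smooth tau_gt0 mu_def cK _ sqr_support).
exact: (smooth_continuous smooth_sqr).
Qed.

Lemma integrable_mu_locally_bounded (V : M -> R) : locally_essentially_bounded vol V ->
  mu.-integrable setT (EFin \o ((fun x => V x * u x ^+ 2) : borel M -> R)).
Proof.
move=> [mV VK]; have [C HC] := VK K cK; have cu := smooth_continuous su.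
have [D D0 HD] := compact_continuous_bounded cK (fun x _ => cu x).
apply: (integrable_mu_bounded vol_def f_smooth tau_gt0 mu_def (C := C * D ^+ 2) cK).
- apply: measurable_funM => //.
  exact: (continuous_measurable (smooth_continuous smooth_sqr)).
- have [N [mN N0 HN]] := HC; exists N; split=> // x /= nP; apply: HN => /= HCx.
  apply: nP => Kx; rewrite normrM ler_pM//; first exact: HCx.
  by rewrite normrX ler_pXn2r ?nnegrE// HD.
- by move=> x nK; rewrite (sqr_support nK) mulr0.
Qed.

Lemma integrable_sqr_ln :
  mu.-integrable setT (EFin \o ((fun x => u x ^+ 2 * ln (u x ^+ 2)) : borel M -> R)).
Proof.
have cu := smooth_continuous su.
have [D D0 HD] := compact_continuous_bounded cK (fun x _ => cu x).
apply: (integrable_mu_bounded vol_def f_smooth tau_gt0 mu_def (C := 1 + (D ^+ 2) ^+ 2) cK).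
- by apply: measurable_mul_ln_sqr; exact: continuous_measurable.
- apply: aeW => x Kx; apply: (le_trans (norm_mul_ln_le (sqr_ge0 _))).
  rewrite lerD2l ler_pXn2r ?nnegrE ?sqr_ge0//.
  by rewrite -real_normK ?num_real// ler_pXn2r ?nnegrE// HD.
- by move=> x nK; rewrite (sqr_support nK) mul0r.
Qed.

Lemma integrable_potential_density :
  mu.-integrable setT (EFin \o (potential_density u : borel M -> R)).
Proof.
apply: (integrable_mu_continuous vol_def f_smooth tau_gt0 mu_def cK); last first.
  by move=> x nK; rewrite /potential_density (sqr_support nK) mulr0.
have cf := smooth_continuous f_smooth.
have cc (k : R) : continuous (fun _ : M => k) by move=> x; exact: cvg_cst.
have cS : continuous S := continuous_scalar_curvature S_def.
have cg : continuous (grad_inner g f f) := continuous_grad_inner (g := g) f_smooth f_smooth.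
have cD := continuous_drift_laplacian vol_def f_smooth f_smooth.
apply: continuous_mul; last exact: (smooth_continuous smooth_sqr).
have cR : continuous (weighted_scalar_curvature g S f).
  exact: (continuous_add (continuous_add cS cg) (continuous_mul (cc 2) cD)).
move=> x; apply: cvgB; first by apply: cvgB; [exact: cvg_cst|exact: cf].
exact: (continuous_mul (cc tau) cR).
Qed.

Lemma integrable_divergence_density :
  mu.-integrable setT (EFin \o (divergence_density u : borel M -> R)).
Proof.
apply: (integrable_mu_continuous vol_def f_smooth tau_gt0 mu_def cK).
  have cg : continuous (grad_inner g (fun y => u y ^+ 2) f) :=
    continuous_grad_inner (g := g) smooth_sqr f_smooth.
  exact: (continuous_mul_add (smooth_continuous smooth_sqr)
    (continuous_drift_laplacian vol_def f_smooth f_smooth) cg).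
move=> x nK; exact: (mul_add0 _ (sqr_support nK) (grad_inner_support g f cK sqr_support nK)).
Qed.

Lemma mu_functional_le_mu : \int[mu]_x (u x ^+ 2) = 1 ->
  (mu_functional g vol S tau <= (4 * tau * \int[mu]_x grad_inner g u u x
     - \int[mu]_x (u x ^+ 2 * ln (u x ^+ 2)) - \int[mu]_x potential_density u x)%:E)%E.
Proof.
move=> u1.
have sw : smooth X half_weight := smooth_exp_affine f_smooth (2^-1 * ln G) (- 2^-1).
have sphi := smoothM su sw.
have phi0 x : ~ K x -> u x * half_weight x = 0 by move=> nK; rewrite (u0 nK) mul0r.
have mu2 : measurable_fun [set: borel M] ((fun x => u x ^+ 2) : borel M -> R).
  exact: (continuous_measurable (smooth_continuous smooth_sqr)).
have phi1 : \int[vol]_x ((u x * half_weight x) ^+ 2) = 1.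
  rewrite -u1 (Rintegral_mu f_smooth tau_gt0 mu_def mu2).
  by apply: eq_Rintegral => x _; rewrite exprMn half_weight_sqr.
have := mu_functional_le vol_def S_def tau_gt0 sphi cK phi0 phi1.
move=> /le_trans; apply; rewrite lee_fin.
have i1 := integrableZr' (4 * tau) integrable_grad_sqr.
have i2 := integrableBr i1 integrable_sqr_ln.
have i3 := integrableBr i2 integrable_potential_density.
have i4 := integrableZr' (2 * tau) integrable_divergence_density.
have i5 := integrableBr i3 i4.
under eq_Rintegral do rewrite (entropy_density_half_weight _ su).
rewrite -(Rintegral_mu f_smooth tau_gt0 mu_def); last first.
  by apply/measurable_EFinP; exact: measurable_int i5.
rewrite (RintegralB measurableT i3 i4) (RintegralB measurableT i2 integrable_potential_density).
rewrite (RintegralB measurableT i1 integrable_sqr_ln).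
rewrite (RintegralZl _ measurableT integrable_grad_sqr).
rewrite (RintegralZl _ measurableT integrable_divergence_density).
rewrite [X in _ - 2 * tau * X](weighted_divergence vol_def f_smooth tau_gt0 mu_def
  smooth_sqr f_smooth cK sqr_support).
by rewrite mulr0 subr0.
Qed.

End TestFunction.
End EntropyTransform.

(** Jensen's inequality in pointwise form: [ln y <= y - 1] at [y = e^-v / (c u^2)], multiplied by
    [u^2]. When [c] is the integral of [e^-v] and [u^2] has integral 1, the last two terms on the
    left cancel after integration. *)
Lemma entropy_sqr_ge (R : realType) (c v u : R) : 0 < c ->
  - ln c * u ^+ 2 + u ^+ 2 - c^-1 * expR (- v) <= u ^+ 2 * ln (u ^+ 2) + v * u ^+ 2.
Proof.
move=> c0; have e0 := expR_gt0 (- v).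
have [->|u0] := eqVneq u 0.
  rewrite expr0n/= mulr0 !addr0 add0r mul0r mulr0 addr0 oppr_le0.
  by rewrite mulr_ge0 ?invr_ge0 ?(ltW c0) ?(ltW e0).
have u2 : 0 < u ^+ 2 by rewrite exprn_even_gt0.
have y0 : 0 < expR (- v) / (u ^+ 2 * c) by rewrite divr_gt0// mulr_gt0.
have uc : 0 < u ^+ 2 * c by exact: mulr_gt0.
have := ln_le_sub1 y0; rewrite ln_div ?posrE// expRK lnM ?posrE// => h.
have := ler_wpM2l (ltW u2) h.
have -> : c^-1 * expR (- v) = u ^+ 2 * (expR (- v) / (u ^+ 2 * c)).
  by field; rewrite gt_eqF// u0.
set q := expR (- v) / _; lra.
Qed.

(** * The lower bound for the quadratic form *)

Section RayleighBound.
Variables (R : realType) (n : nat) (M : ptopologicalType) (X : manifold R n M).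
Variables (g : metric X) (vol mu : {measure set (borel M) -> \bar R}).
Variables (f V S : M -> R) (tau : R).
Hypothesis vol_def : is_riemannian_volume g vol.
Hypothesis S_def : is_scalar_curvature g S.
Hypothesis f_smooth : smooth X f.
Hypothesis tau_gt0 : 0 < tau.
Hypothesis mu_def : is_weighted_measure n vol f tau mu.
Hypothesis V_loc : locally_essentially_bounded vol V.
Hypothesis expV_L1 : mu.-integrable [set: borel M]
       (fun x => (expR (- (4 * tau * V x)))%:E).
Local Notation c := (\int[mu]_x expR (- (4 * tau * V x))).

Lemma smooth_cpt_unitP (u : M -> R) : smooth_cpt_unit X mu u ->
  exists K : set M, [/\ smooth X u, compact K, forall x, ~ K x -> u x = 0 &
    \int[mu]_x (u x ^+ 2) = 1].
Proof.
move=> [cu u1]; have [K cK u0] := smooth_cpt_support cu.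
exists K; split; [by case: cu|exact: cK|exact: u0|by rewrite /Rintegral u1].
Qed.

(** The integrand is positive everywhere, so a zero integral would make the whole space a null set,
    which the unit mass of [u] excludes. *)
Lemma expV_gt0 (u : M -> R) : smooth_cpt_unit X mu u -> 0 < c.
Proof.
move=> uu; have [K [su cK u0 _]] := smooth_cpt_unitP uu.
have iu := integrable_mu_sqr vol_def f_smooth tau_gt0 mu_def su cK u0.
case: uu => _ u1; rewrite lt_def Rintegral_ge0 ?andbT; last by move=> x _; exact: expR_ge0.
apply/negP => /eqP c0.
have : (\int[mu]_x `|(expR (- (4 * tau * V x)))%:E| = 0)%E.
  rewrite -[RHS](_ : c%:E = 0%E); last by rewrite c0.
  rewrite -EFin_Rintegral//; apply: eq_integral => x _.
  by rewrite gee0_abs// lee_fin expR_ge0.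
move/(ae_eq_integral_abs mu measurableT (measurable_int _ expV_L1)).1 => [N [mN N0 HN]].
have NT : N = setT.
  apply/seteqP; split=> // x _; apply: HN => /= /(_ I) /eqP; rewrite eqe.
  by rewrite gt_eqF// expR_gt0.
have : (\int[mu]_x (u x ^+ 2)%:E = 0)%E.
  by rewrite -NT; apply: null_set_integral => //; rewrite NT; exact: measurable_int iu.
by rewrite u1 => /eqP; rewrite eqe oner_eq0.
Qed.

Lemma rayleigh_real_bound (u : M -> R) : smooth_cpt_unit X mu u ->
  - ln c <= \int[mu]_x (u x ^+ 2 * ln (u x ^+ 2)) + 4 * tau * \int[mu]_x (V x * u x ^+ 2).
Proof.
move=> uu; have c0 := expV_gt0 uu.
have [K [su cK u0 u1]] := smooth_cpt_unitP uu.
have iu := integrable_mu_sqr vol_def f_smooth tau_gt0 mu_def su cK u0.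
have iL := integrable_sqr_ln vol_def f_smooth tau_gt0 mu_def su cK u0.
have iV := integrable_mu_locally_bounded vol_def f_smooth tau_gt0 mu_def su cK u0 V_loc.
have i1 := integrableZr' (- ln c) iu.
have i2 := integrableDr i1 iu.
have i3 := integrableZr' c^-1 expV_L1.
have i4 := integrableBr i2 i3.
have i5 := integrableZr' (4 * tau) iV.
have i6 := integrableDr iL i5.
have : \int[mu]_x (- ln c * u x ^+ 2 + u x ^+ 2 - c^-1 * expR (- (4 * tau * V x)))
    <= \int[mu]_x (u x ^+ 2 * ln (u x ^+ 2) + 4 * tau * (V x * u x ^+ 2)).
  apply: (le_Rintegral measurableT i4 i6) => x _; rewrite mulrA.
  exact: entropy_sqr_ge.
rewrite (RintegralB measurableT i2 i3) (RintegralD measurableT i1 iu).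
rewrite (RintegralD measurableT iL i5) (RintegralZl _ measurableT iu).
rewrite (RintegralZl _ measurableT expV_L1) (RintegralZl _ measurableT iV) u1.
by rewrite mulVf ?gt_eqF// mulr1 addrK.
Qed.

Definition spectral_bound : \bar R :=
  ((- ((4 * tau)^-1 * ln c)%R)%:E
     + ((4 * tau)^-1)%:E * mu_functional g vol S tau
     + ((4 * tau)^-1)%:E *
       ereal_inf [set \int[mu]_x ((n%:R - f x
                        - tau * weighted_scalar_curvature g S f x)
                        * u x ^+ 2)%R%:E
                 | u in smooth_cpt_unit X mu])%E.

Lemma spectral_bound_le_rayleigh : (spectral_bound <= rayleigh_bottom g mu V)%E.
Proof.
apply/le_ereal_inf_tmp => _ [u uu <-].
have [K [su cK u0 u1]] := smooth_cpt_unitP uu.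
have jen := rayleigh_real_bound uu.
have k0 : 0 < (4 * tau)^-1 by rewrite invr_gt0 mulr_gt0.
have hmu := mu_functional_le_mu vol_def S_def f_smooth tau_gt0 mu_def su cK u0 u1.
have iC := integrable_potential_density vol_def S_def f_smooth tau_gt0 mu_def su cK u0.
have iA := integrable_grad_sqr vol_def f_smooth tau_gt0 mu_def su cK u0.
have iV := integrable_mu_locally_bounded vol_def f_smooth tau_gt0 mu_def su cK u0 V_loc.
have hinf : (ereal_inf [set \int[mu]_x ((n%:R - f x
                        - tau * weighted_scalar_curvature g S f x)
                        * u x ^+ 2)%R%:E
                 | u in smooth_cpt_unit X mu]
    <= (\int[mu]_x potential_density g f S tau u x)%:E)%E.
  by rewrite -EFin_Rintegral//; apply: ereal_inf_lbound; exists u.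
have k1 : (0 <= ((4 * tau)^-1)%:E)%E by rewrite lee_fin ltW.
(* The functional and the infimum may be [-oo]; monotonicity in the extended reals replaces them by
   real upper bounds, and what remains is real arithmetic. *)
have := leeD (leeD (lexx (- ((4 * tau)^-1 * ln c)%R)%:E) (lee_wpmul2l k1 hmu))
  (lee_wpmul2l k1 hinf).
move=> /le_trans; apply.
have i5 := integrableDr iA iV.
rewrite (EFin_Rintegral i5) (RintegralD measurableT iA iV) -!EFinM -!EFinD lee_fin.
move: jen; move: (\int[mu]_x potential_density g f S tau u x) (\int[mu]_x grad_inner g u u x)
  (\int[mu]_x (V x * u x ^+ 2)) (\int[mu]_x (u x ^+ 2 * ln (u x ^+ 2))) (ln _) => C A B L l jen.
have t0 : tau != 0 by rewrite gt_eqF.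
rewrite -(ler_pM2l (x := 4 * tau)) ?mulr_gt0//.
rewrite (_ : 4 * tau * (_ + _ + _) = - l + (4 * tau * A - L)); last by field.
by lra.
Qed.

End RayleighBound.

(** * Square-integrable functions and coercive operators *)

(** Gives both the Cauchy-Schwarz inequality and the near-orthogonality of the residuals of a
    minimising sequence; the degenerate case [c = 0] is included because norms may vanish. *)
Lemma discriminant_le (R : realType) (a b c : R) : 0 <= c ->
  (forall t, 0 <= a + 2 * t * b + t ^+ 2 * c) -> b ^+ 2 <= a * c.
Proof.
rewrite le_eqVlt => /predU1P[<-|c0] H.
  have [->|b0] := eqVneq b 0; first by rewrite expr0n/= mulr0.
  (* With [c = 0] the expression is affine in [t]; at this point it equals -1. *)
  have := H (- (a + 1) / (2 * b)).
  have -> : 2 * (- (a + 1) / (2 * b)) * b = - (a + 1) by field.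
  by rewrite mulr0; lra.
have := H (- b / c).
have -> : a + 2 * (- b / c) * b + (- b / c) ^+ 2 * c = a - b ^+ 2 / c.
  by field; rewrite gt_eqF.
by rewrite subr_ge0 ler_pdivrMr.
Qed.

Section SquareIntegrable.
Context (d : measure_display) (T : measurableType d) (R : realType).
Variable m : {measure set T -> \bar R}.
Implicit Types u v w : T -> R.

Lemma Lnorm2E u : L2_norm m u = ((\int[m]_x (u x ^+ 2)%:E) `^ 2^-1)%E.
Proof.
rewrite /L2_norm unlock; congr (_ `^ _)%E; apply: eq_integral => x _ /=.
by rewrite powR_mulrn// real_normK ?num_real.
Qed.

Lemma L2P u : L2 m u <->
  measurable_fun setT u /\ m.-integrable setT (EFin \o (fun x => u x ^+ 2)).
Proof.
rewrite /L2; split=> [l2|[mu iu]].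
  split; last exact: Lfun2_integrable_sqr.
  by move: l2; rewrite inE => /andP[+ _]; rewrite inE.
rewrite inE; apply/andP; split; rewrite inE//= /finite_norm.
rewrite -/(L2_norm m u) Lnorm2E poweR_lty//.
have /integrableP[_] := iu; apply: le_lt_trans; apply: ge0_le_integral => //=.
- by move=> x _; rewrite lee_fin sqr_ge0.
- by apply/measurable_EFinP; exact: measurable_funX.
- by apply/measurable_EFinP; apply: measurableT_comp => //; exact: measurable_funX.
- by move=> x _; exact: ler_norm.
Qed.

Lemma L2_measurable u : L2 m u -> measurable_fun setT u.
Proof. by move/L2P => []. Qed.

Definition L2_inner u v : R := \int[m]_x (u x * v x).

Definition L2_length u : R := Num.sqrt (L2_inner u u).

Lemma L2_integrable_mul u v : L2 m u -> L2 m v ->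
  m.-integrable setT (EFin \o (fun x => u x * v x)).
Proof. by move=> lu lv; apply/Lfun1_integrable; exact: Lfun2_mul_Lfun1. Qed.

Lemma L2_innerE u v : L2 m u -> L2 m v ->
  (\int[m]_x (u x * v x)%:E = (L2_inner u v)%:E)%E.
Proof. by move=> lu lv; rewrite EFin_Rintegral//; exact: L2_integrable_mul. Qed.

Lemma L2_inner_ge0 u : 0 <= L2_inner u u.
Proof. by apply: Rintegral_ge0 => x _; rewrite -expr2 sqr_ge0. Qed.

Lemma L2_length_ge0 u : 0 <= L2_length u.
Proof. exact: sqrtr_ge0. Qed.

Lemma L2_length_sqr u : L2_length u ^+ 2 = L2_inner u u.
Proof. by rewrite sqr_sqrtr// L2_inner_ge0. Qed.

Lemma L2_normE u : L2 m u -> L2_norm m u = (L2_length u)%:E.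
Proof.
move=> lu; rewrite Lnorm2E (L2_innerE lu lu) poweR_EFin.
by rewrite powR12_sqrt ?L2_inner_ge0.
Qed.

Lemma L2_innerC u v : L2_inner u v = L2_inner v u.
Proof. by apply: eq_Rintegral => x _; rewrite mulrC. Qed.

Lemma L2_lin a b u v : L2 m u -> L2 m v -> L2 m (fun x => a * u x + b * v x).
Proof.
move=> /L2P[mu iu] /L2P[mv iv]; apply/L2P; split.
  by apply: measurable_funD; apply: measurable_funM.
have i1 := integrableZr' (2 * a ^+ 2) iu; have i2 := integrableZr' (2 * b ^+ 2) iv.
have i3 := integrableDr i1 i2.
apply: (le_integrable measurableT _ _ i3).
  apply/measurable_EFinP; apply: measurable_funX.
  by apply: measurable_funD; apply: measurable_funM.
move=> x _ /=; rewrite lee_fin !ger0_norm ?sqr_ge0//; last first.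
  by rewrite addr_ge0// mulr_ge0 ?sqr_ge0// mulr_ge0 ?sqr_ge0.
by have := sqr_ge0 (a * u x - b * v x); rewrite sqrrB sqrrD !exprMn; lra.
Qed.

Lemma L2_inner_linl a b u v w : L2 m u -> L2 m v -> L2 m w ->
  L2_inner (fun x => a * u x + b * v x) w = a * L2_inner u w + b * L2_inner v w.
Proof.
move=> lu lv lw; have i1 := L2_integrable_mul lu lw; have i2 := L2_integrable_mul lv lw.
have -> : L2_inner (fun x => a * u x + b * v x) w
    = \int[m]_x (a * (u x * w x) + b * (v x * w x)).
  by apply: eq_Rintegral => x _; rewrite mulrDl !mulrA.
rewrite (RintegralD measurableT (integrableZr' a i1) (integrableZr' b i2)).
by rewrite (RintegralZl _ measurableT i1) (RintegralZl _ measurableT i2).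
Qed.

Lemma L2_inner_linr a b u v w : L2 m u -> L2 m v -> L2 m w ->
  L2_inner w (fun x => a * u x + b * v x) = a * L2_inner w u + b * L2_inner w v.
Proof.
by move=> lu lv lw; rewrite L2_innerC L2_inner_linl// !(L2_innerC w).
Qed.

Lemma L2_inner_lin_sqr a b u v : L2 m u -> L2 m v ->
  L2_inner (fun x => a * u x + b * v x) (fun x => a * u x + b * v x)
  = a ^+ 2 * L2_inner u u + 2 * a * b * L2_inner u v + b ^+ 2 * L2_inner v v.
Proof.
move=> lu lv; rewrite (L2_inner_linl a b lu lv (L2_lin a b lu lv)).
by rewrite !L2_inner_linr// (L2_innerC v u); ring.
Qed.

Lemma L2_cauchy_schwarz u v : L2 m u -> L2 m v ->
  `|L2_inner u v| <= L2_length u * L2_length v.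
Proof.
move=> lu lv; rewrite -(@ler_pXn2r _ 2)// ?nnegrE ?mulr_ge0 ?L2_length_ge0//.
rewrite real_normK ?num_real// exprMn !L2_length_sqr.
apply: discriminant_le; first exact: L2_inner_ge0.
move=> t; have := L2_inner_ge0 (fun x => 1 * u x + t * v x).
by rewrite L2_inner_lin_sqr// expr1n !mul1r mulr1.
Qed.

Lemma L2_length_lin a b u v : L2 m u -> L2 m v ->
  L2_length (fun x => a * u x + b * v x) <= `|a| * L2_length u + `|b| * L2_length v.
Proof.
move=> lu lv.
have p0 : 0 <= `|a| * L2_length u + `|b| * L2_length v.
  by rewrite addr_ge0// mulr_ge0// L2_length_ge0.
rewrite -(@ler_pXn2r _ 2)// ?nnegrE ?L2_length_ge0//.
rewrite L2_length_sqr L2_inner_lin_sqr// sqrrD !exprMn !real_normK ?num_real//.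
rewrite !L2_length_sqr lerD2r lerD2l.
apply: (le_trans (ler_norm _)); rewrite !normrM ger0_norm//.
have := ler_wpM2l (mulr_ge0 (normr_ge0 a) (normr_ge0 b)) (L2_cauchy_schwarz lu lv).
by rewrite mulr2n; lra.
Qed.

Lemma cvg_L2_norm (w : nat -> T -> R) : (forall k, L2 m (w k)) ->
  (fun k => L2_norm m (w k)) @ \oo --> 0%:E <-> (fun k => L2_length (w k)) @ \oo --> 0.
Proof.
move=> lw; have -> : (fun k => L2_norm m (w k)) = EFin \o (fun k => L2_length (w k)).
  by apply/funext => k /=; exact: L2_normE.
split; first by move/fine_cvgP => [].
by move=> h; apply/fine_cvgP; split=> //; exact: nearW.
Qed.

End SquareIntegrable.

Lemma limn_einf_le (R : realType) (u : (\bar R)^nat) c N :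
  (forall k, (N <= k)%N -> (u k <= c)%E) -> (limn_einf u <= c)%E.
Proof.
move=> uc; rewrite limn_einf_lim; apply: lime_le; first exact: is_cvg_einfs.
apply: nearW => k; apply: le_trans (uc (maxn N k) (leq_maxl _ _)).
by apply: ereal_inf_lbound; exists (maxn N k) => //=; exact: leq_maxr.
Qed.

(** * Completeness of the space of square-integrable functions *)

Section Completeness.
Context (d : measure_display) (T : measurableType d) (R : realType).
Variable m : {measure set T -> \bar R}.

Lemma L2_subE (u v : T -> R) : (fun x => u x - v x) = (fun x => 1 * u x + (- 1) * v x).
Proof. by apply/funext => x; rewrite mul1r mulN1r. Qed.

Lemma L2_sub (u v : T -> R) : L2 m u -> L2 m v -> L2 m (fun x => u x - v x).
Proof. by rewrite L2_subE; exact: L2_lin. Qed.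

(** The measure may be infinite, so the differences need not be integrable. The weighted squares
    [2^k (a_(k+1) - a_k)^2] have summable integrals, hence a finite sum almost everywhere, and
    [t <= 2^-(k+1) + 2^k t^2] turns this into absolute convergence of the telescoping series. *)
Lemma fast_cauchy_cvg (a : nat -> T -> R) : (forall k, L2 m (a k)) ->
  (forall k, L2_length m (fun x => a k.+1 x - a k x) <= ((2 ^ k.+1)%:R)^-1) ->
  {ae m, forall x, cvgn (fun k => a k x)}.
Proof.
move=> la da; pose u k x := (2 ^ k)%:R * (a k.+1 x - a k x) ^+ 2.
have ld k := L2_sub (la k.+1) (la k).
have iu k : m.-integrable setT (EFin \o u k).
  exact: integrableZr' (Lfun2_integrable_sqr (ld k)).
have u0 k x : 0 <= u k x by rewrite mulr_ge0// sqr_ge0.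
have p0 k : 0 < ((2 ^ k)%:R : R) by rewrite ltr0n expn_gt0.
have Iu k : \int[m]_x u k x <= 1 / (2 ^ k.+1)%:R.
  rewrite (RintegralZl _ measurableT (Lfun2_integrable_sqr (ld k))).
  rewrite -/(L2_inner m (fun x => a k.+1 x - a k x) (fun x => a k.+1 x - a k x)).
  rewrite -L2_length_sqr; have h := da k.
  have h2 : L2_length m (fun x => a k.+1 x - a k x) ^+ 2 <= ((2 ^ k.+1)%:R)^-1 ^+ 2.
    by rewrite ler_pXn2r ?nnegrE ?L2_length_ge0// invr_ge0 ltW.
  apply: (le_trans (ler_wpM2l (ltW (p0 k)) h2)).
  rewrite expr2 mulrA ler_wpM2r ?invr_ge0 ?(ltW (p0 _))//.
  by rewrite ler_pdivrMr// mul1r ler_nat leq_exp2l.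
have sumu : (\sum_(0 <= k <oo) (\int[m]_x u k x)%:E <= 1)%E.
  apply: le_trans (epsilon_trick0 xpredT ler01).
  apply: lee_nneseries => k *; rewrite lee_fin//; exact: Rintegral_ge0.
have i0 : m.-integrable setT (EFin \o (fun _ : T => 0 : R)) by exact: integrable0.
have [iH _] := integral_add_nneseries i0 iu u0 (le_lt_trans sumu (ltry 1)).
have [N [mN N0 HN]] := integrable_ae measurableT iH.
exists N; split=> // x /= nc; apply: HN => /= /(_ I) fin; apply: nc.
have sfin : (\sum_(0 <= k <oo) (`|a k.+1 x - a k x|)%:E < +oo)%E.
  have le1 : (\sum_(0 <= k <oo) (`|a k.+1 x - a k x|)%:E
      <= \sum_(0 <= k <oo) ((1 / (2 ^ k.+1)%:R)%:E + (u k x)%:E))%E.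
    apply: lee_nneseries => k *; rewrite lee_fin// /u.
    rewrite -[(_ - _) ^+ 2]real_normK ?num_real//; move: `|_| => t.
    have := sqr_ge0 (1 - (2 ^ k)%:R * t); have := p0 k.
    rewrite expnS natrM; move: (2 ^ k)%:R => p pp.
    rewrite -(ler_pM2l pp) => h.
    have -> : p * (1 / (2%:R * p) + p * t ^+ 2) = 2^-1 + (p * t) ^+ 2.
      by field; rewrite gt_eqF.
    by move: (p * t) h => s; nra.
  apply: le_lt_trans le1 _.
  rewrite nneseriesD; [|by move=> k _; rewrite lee_fin divr_ge0 ?(ltW (p0 _))|
    by move=> k _; rewrite lee_fin].
  apply: lte_add_pinfty; last by move: fin; rewrite add0e ge0_fin_numE// nneseries_ge0// => k _ _; rewrite lee_fin.
  exact: le_lt_trans (epsilon_trick0 xpredT ler01) (ltry 1).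
have cs := nnseries_is_cvg (fun k => normr_ge0 (a k.+1 x - a k x)) sfin.
have cs' : cvgn (series (fun k => a k.+1 x - a k x)) by exact: normed_cvg.
have -> : (fun k => a k x) = (fun k => a 0%N x + series (fun k => a k.+1 x - a k x) k).
  by apply/funext => k; exact: (eq_sum_telescope (fun k => a k x)).
have /cvg_ex[/= l sl] := cs'; apply/cvg_ex; exists (a 0%N x + l).
by apply: cvgD => //; exact: cvg_cst.
Qed.

Lemma L2_complete (w : nat -> T -> R) : (forall k, L2 m (w k)) ->
  (forall e : R, 0 < e -> exists N, forall i j, (N <= i)%N -> (N <= j)%N ->
     L2_length m (fun x => w i x - w j x) < e) ->
  exists2 u, L2 m u & (fun k => L2_length m (fun x => w k x - u x)) @ \oo --> 0.
Proof.
move=> lw cauchy.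
have /choice[N HN] : forall k : nat, exists N, forall i j, (N <= i)%N -> (N <= j)%N ->
     L2_length m (fun x => w i x - w j x) < ((2 ^ k.+1)%:R)^-1.
  by move=> k; apply: cauchy; rewrite invr_gt0 ltr0n expn_gt0.
(* Indices of a subsequence: increasing, with [p k] at least both [N k] and, thanks to the
   successors, [k]. *)
pose p k := (\sum_(i < k.+1) (N i).+1)%N.
have pS k : p k.+1 = (p k + (N k.+1).+1)%N by rewrite /p big_ord_recr.
have Np k : (N k <= p k)%N.
  by rewrite /p big_ord_recr/=; apply: leq_trans (leqnSn _) (leq_addl _ _).
have kp k : (k <= p k)%N.
  by elim: k => // k IH; rewrite pS addnS ltnS (leq_trans IH)// leq_addr.
have ae_cvg : {ae m, forall x, cvgn (fun k => w (p k) x)}.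
  apply: (@fast_cauchy_cvg (fun k => w (p k))) => // k; apply/ltW/HN; last exact: Np.
  by rewrite pS; apply: leq_trans (Np k) (leq_addr _ _).
(* An upper limit is measurable without any convergence; its value on the null set where the
   subsequence diverges does not matter. *)
pose u x := fine (limn_esup (fun k => (w (p k) x)%:E)).
have mw k : measurable_fun setT (w k) := L2_measurable (lw k).
have mu : measurable_fun setT u.
  apply: measurableT_comp => //.
  by apply: measurable_fun_limn_esup => k; apply/measurable_EFinP.
have uE x : cvgn (fun k => w (p k) x) -> (fun k => w (p k) x) @ \oo --> u x.
  move=> /cvg_ex[/= l wl]; suff -> : u x = l by [].
  have wl' : (fun k => (w (p k) x)%:E) @ \oo --> l%:E.
    by apply/fine_cvgP; split; [exact: nearW|exact: wl].
  by rewrite /u (cvg_limn_einf_sup wl').2.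
pose h k x := ((w k x - u x) ^+ 2)%:E.
have mh k : measurable_fun setT (h k).
  by apply/measurable_EFinP; apply: measurable_funX; exact: measurable_funB.
(* Fatou's lemma along the subsequence, with the member [w k] held fixed. *)
have bound (e : R) : 0 < e -> exists N, forall k, (N <= k)%N ->
    (\int[m]_x h k x <= (e ^+ 2)%:E)%E.
  move=> e0; have [K HK] := cauchy _ e0; exists K => k Kk.
  pose q j x := ((w k x - w (p j) x) ^+ 2)%:E.
  have mq j : measurable_fun setT (q j).
    by apply/measurable_EFinP; apply: measurable_funX; exact: measurable_funB.
  have q0 j x : setT x -> (0 <= q j x)%E by rewrite lee_fin sqr_ge0.
  apply: (@le_trans _ _ (\int[m]_x limn_einf (q^~ x))%E).
    apply: ae_ge0_le_integral => //.
    - by move=> x _; rewrite lee_fin sqr_ge0.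
    - by move=> x _; rewrite limn_einf_lim; apply: lime_ge; [exact: is_cvg_einfs|
        apply: nearW => j; apply: le_ereal_inf_tmp => _ [i _ <-]; exact: q0].
    - by rewrite (_ : (fun x => _) = (fun x => - limn_esup (fun j => - q j x)))%E//;
        apply: measurableT_comp => //; apply: measurable_fun_limn_esup => j;
        exact: measurableT_comp.
    have [A [mA A0 HA]] := ae_cvg; exists A; split=> // x /= nle; apply: HA => /= /uE wu.
    apply: nle => _.
    have qc : (fun j => q j x) @ \oo --> h k x.
      apply/fine_cvgP; split; first exact: nearW.
      have c1 : (fun j => w k x - w (p j) x) @ \oo --> w k x - u x.
        by apply: cvgB => //; exact: cvg_cst.
      exact: (cvgM c1 c1).
    by rewrite (cvg_limn_einf_sup qc).1.
  have F := fatou m measurableT mq q0.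
  apply: (le_trans F); apply: (@limn_einf_le _ _ _ K) => j Kj.
  have l1 := L2_sub (lw k) (lw (p j)).
  rewrite (L2_innerE l1 l1) lee_fin -L2_length_sqr ler_pXn2r ?nnegrE ?L2_length_ge0 ?(ltW e0)//.
  by apply/ltW/HK => //; exact: leq_trans Kj (kp j).
have lwu : exists k, L2 m (fun x => w k x - u x).
  have [K HK] := bound 1 ltr01; exists K; apply/L2P; split; first exact: measurable_funB.
  apply/integrableP; split; first exact: mh.
  under eq_integral do rewrite gee0_abs ?lee_fin ?sqr_ge0//.
  exact: le_lt_trans (HK K (leqnn _)) (ltry _).
have lu : L2 m u.
  have [k lk] := lwu; have := L2_sub (lw k) lk.
  by rewrite (_ : (fun x => _) = u)//; apply/funext => x; rewrite opprB addrC subrK.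
exists u => //; apply/cvgrPdist_le => e e0.
have [K HK] := bound e e0; exists K => // k /= Kk.
rewrite sub0r normrN ger0_norm ?L2_length_ge0//.
have l1 := L2_sub (lw k) lu.
have := HK k Kk; rewrite (L2_innerE l1 l1) lee_fin -L2_length_sqr.
by rewrite ler_pXn2r ?nnegrE ?L2_length_ge0 ?(ltW e0).
Qed.

End Completeness.

(** * Coercive operators and their resolvent set *)

Section Coercive.
Context (d : measure_display) (T : measurableType d) (R : realType).
Variable m : {measure set T -> \bar R}.
Local Notation N := (L2_length m).
Local Notation ip := (L2_inner m).

Definition L2_cvg (a : nat -> T -> R) (u : T -> R) : Prop :=
  [/\ forall k, L2 m (a k), L2 m u & (fun k => N (fun x => a k x - u x)) @ \oo --> 0].

Lemma cvg_dominated (a r : nat -> R) (l c : R) : r @ \oo --> 0 ->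
  (forall k, `|a k - l| <= c * r k) -> a @ \oo --> l.
Proof.
move=> r0 ar; have cr : (fun k => c * r k) @ \oo --> c * 0 by apply: cvgM => //; exact: cvg_cst.
have h1 : (fun k => l - c * r k) @ \oo --> l - c * 0 by apply: cvgB => //; exact: cvg_cst.
have h2 : (fun k => l + c * r k) @ \oo --> l + c * 0 by apply: cvgD => //; exact: cvg_cst.
rewrite mulr0 subr0 in h1; rewrite mulr0 addr0 in h2.
apply: squeeze_cvgr h1 h2; apply: nearW => k.
by rewrite -ler_distl.
Qed.

Lemma L2_cvg_lin (s t : R) a u b v : L2_cvg a u -> L2_cvg b v ->
  L2_cvg (fun k x => s * a k x + t * b k x) (fun x => s * u x + t * v x).
Proof.
move=> [la lu au] [lb lv bv]; split; first by move=> k; exact: L2_lin.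
  exact: L2_lin.
have c : (fun k => `|s| * N (fun x => a k x - u x) + `|t| * N (fun x => b k x - v x)) @ \oo
    --> `|s| * 0 + `|t| * 0.
  by apply: cvgD; apply: cvgM => //; exact: cvg_cst.
rewrite !mulr0 addr0 in c; apply: (cvg_dominated (c := 1) c) => k.
rewrite subr0 ger0_norm ?L2_length_ge0// mul1r.
apply: le_trans (L2_length_lin s t (L2_sub (la k) lu) (L2_sub (lb k) lv)).
rewrite le_eqVlt; apply/orP; left; apply/eqP; congr (N _); apply/funext => x.
by ring.
Qed.

Lemma L2_cvg_inner a u w : L2_cvg a u -> L2 m w -> (fun k => ip (a k) w) @ \oo --> ip u w.
Proof.
move=> [la lu au] lw; apply: (cvg_dominated (c := N w) au) => k.
have -> : ip (a k) w - ip u w = ip (fun x => a k x - u x) w.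
  by rewrite L2_subE L2_inner_linl// mul1r mulN1r.
by rewrite mulrC; apply: L2_cauchy_schwarz => //; exact: L2_sub.
Qed.

Lemma L2_cvg_length a u : L2_cvg a u -> (fun k => N (a k)) @ \oo --> N u.
Proof.
move=> [la lu au]; apply: (cvg_dominated (c := 1) au) => k; rewrite mul1r.
have l1 := L2_sub (la k) lu.
rewrite ler_distl; apply/andP; split.
  rewrite lerBlDr; have := L2_length_lin 1 (- 1) (la k) l1.
  rewrite normrN normr1 !mul1r; apply: le_trans.
  rewrite le_eqVlt; apply/orP; left; apply/eqP; congr (N _); apply/funext => x.
  by ring.
have := L2_length_lin 1 1 lu l1; rewrite normr1 !mul1r; apply: le_trans.
rewrite le_eqVlt; apply/orP; left; apply/eqP; congr (N _); apply/funext => x.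
by ring.
Qed.

Lemma L2_parallelogram (a b : T -> R) : L2 m a -> L2 m b ->
  N (fun x => a x - b x) ^+ 2 = 2 * ip a a + 2 * ip b b
  - 4 * ip (fun x => 2^-1 * a x + 2^-1 * b x) (fun x => 2^-1 * a x + 2^-1 * b x).
Proof.
by move=> la lb; rewrite L2_length_sqr L2_subE !L2_inner_lin_sqr//; field.
Qed.

Section Resolvent.
Variables (D : set (T -> R)) (L : (T -> R) -> T -> R) (l l' : R).
Hypothesis D_neq0 : D !=set0.
Hypothesis D_lin : forall s t u v, D u -> D v -> D (fun x => s * u x + t * v x).
Hypothesis L_lin : forall s t u v, D u -> D v ->
  forall x, L (fun x => s * u x + t * v x) x = s * L u x + t * L v x.
Hypothesis D_L2 : forall u, D u -> L2 m u.
Hypothesis L_L2 : forall u, D u -> L2 m (L u).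
Hypothesis ll' : l < l'.
Hypothesis coercive : forall u, D u -> l' * ip u u <= ip (L u) u.
Local Notation A := (operator_closure m D L).
Hypothesis A_self_adjoint : self_adjoint m A.
Let kappa_gt0 : 0 < l' - l. Proof. by rewrite subr_gt0. Qed.

(** The operator minus [l]; the coefficient 1 keeps it literally of the form handled by [L2_lin] and
    its companions. *)
Definition shifted (u : T -> R) : T -> R := fun x => 1 * L u x + (- l) * u x.

Lemma shifted_L2 u : D u -> L2 m (shifted u).
Proof. by move=> Du; apply: L2_lin; [exact: L_L2|exact: D_L2]. Qed.

Lemma shifted_lin s t u v : D u -> D v ->
  shifted (fun x => s * u x + t * v x) = fun x => s * shifted u x + t * shifted v x.
Proof. by move=> Du Dv; apply/funext => x; rewrite /shifted L_lin//; ring. Qed.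

(** Coercivity bounds [(l' - l) |u|^2] by the inner product of [shifted u] with [u]; Cauchy-Schwarz
    and division by the length of [u] give the estimate. *)
Lemma shifted_coercive u : D u -> (l' - l) * N u <= N (shifted u).
Proof.
move=> Du; have lu := D_L2 Du; have lP := shifted_L2 Du.
have [->|u0] := eqVneq (N u) 0; first by rewrite mulr0 L2_length_ge0.
have u_gt0 : 0 < N u by rewrite lt_def u0 L2_length_ge0.
rewrite -(ler_pM2r u_gt0); apply: le_trans (L2_cauchy_schwarz lP lu).
apply: le_trans (ler_norm _).
rewrite -mulrA -expr2 L2_length_sqr /shifted (L2_inner_linl 1 (- l) (L_L2 Du) lu lu).
by have := coercive Du; lra.
Qed.

Lemma closure_seq u v : A u v -> exists w,
  [/\ forall k, D (w k), L2_cvg w u & L2_cvg (fun k => L (w k)) v].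
Proof.
move=> [lu lv [w [Dw wu Lwv]]]; exists w; split=> //.
- split=> //; first by move=> k; exact: D_L2.
  by apply/(cvg_L2_norm (m := m)) => [k|]; [apply: L2_sub => //; exact: D_L2|].
- split=> //; first by move=> k; exact: L_L2.
  by apply/(cvg_L2_norm (m := m)) => [k|]; [apply: L2_sub => //; exact: L_L2|].
Qed.

Lemma closure_coercive u v : A u v ->
  (l' - l) * N u <= N (fun x => 1 * v x + (- l) * u x).
Proof.
move=> /closure_seq[w [Dw wu Lwv]].
have c1 : (fun k => (l' - l) * N (w k)) @ \oo --> (l' - l) * N u.
  by apply: cvgM; [exact: cvg_cst|exact: L2_cvg_length].
have c2 := L2_cvg_length (L2_cvg_lin 1 (- l) Lwv wu).
by apply: (ler_cvg_to c1 c2); apply: nearW => k; exact: shifted_coercive.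
Qed.

(** Orthogonality passes to limits, so [<v, y> = <u, l y>] for every pair [u], [v] in the graph of
    the closure. This says that [y] and [l y] belong to the graph of the adjoint, which is the
    closure itself. *)
Lemma orthogonal_eigenvector y : L2 m y -> (forall u, D u -> ip (shifted u) y = 0) ->
  A y (fun x => l * y x + 0 * y x).
Proof.
move=> ly orth; apply/A_self_adjoint => //; first exact: L2_lin.
move=> u v /closure_seq[w [Dw wu Lwv]].
have [_ lu _] := wu; have [_ lv _] := Lwv.
have c := L2_cvg_inner (L2_cvg_lin 1 (- l) Lwv wu) ly.
have c0 : (fun k => ip (shifted (w k)) y) @ \oo --> 0.
  by rewrite (_ : (fun k => _) = cst 0); [exact: cvg_cst|apply/funext => k; exact: orth].
have : ip (fun x => 1 * v x + (- l) * u x) y = 0.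
  by rewrite -(cvg_lim (@Rhausdorff R) c) -[RHS](cvg_lim (@Rhausdorff R) c0).
rewrite (L2_inner_linl 1 (- l) lv lu ly) => e.
rewrite (L2_innerE lu (L2_lin l 0 ly ly)) (L2_innerE lv ly); congr _%:E.
by rewrite (L2_inner_linr l 0 ly ly lu); lra.
Qed.

Section Minimisation.
Variable w : T -> R.
Hypothesis lw : L2 m w.

Definition residual (u : T -> R) : T -> R := fun x => 1 * shifted u x + (- 1) * w x.

Lemma residual_L2 u : D u -> L2 m (residual u).
Proof. by move=> Du; apply: L2_lin => //; exact: shifted_L2. Qed.

Lemma minimising_sequence : exists (phi : nat -> T -> R) (delta : R),
  [/\ forall k, D (phi k), forall u, D u -> delta <= ip (residual u) (residual u) &
      forall k, ip (residual (phi k)) (residual (phi k)) <= delta + harmonic k].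
Proof.
pose S := [set ip (residual u) (residual u) | u in D].
have S0 : has_lbound S by exists 0 => _ [u _ <-]; exact: L2_inner_ge0.
have iS : has_inf S by split=> //; have [u Du] := D_neq0; exists (ip (residual u) (residual u)), u.
have /choice[phi Hphi] : forall k, exists u, D u /\
    ip (residual u) (residual u) <= inf S + harmonic k.
  move=> k; have e0 : 0 < harmonic k :> R by rewrite invr_gt0 ltr0n.
  by have [_ [u Du <-] h] := inf_adherent e0 iS; exists u; split=> //; exact: ltW.
exists phi, (inf S); split=> [k|u Du|k]; [by case: (Hphi k)|
  by apply: ge_inf => //; exists u|by case: (Hphi k)].
Qed.

Variables (phi : nat -> T -> R) (delta : R).
Hypothesis Dphi : forall k, D (phi k).
Hypothesis delta_le : forall u, D u -> delta <= ip (residual u) (residual u).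
Hypothesis phi_min : forall k,
  ip (residual (phi k)) (residual (phi k)) <= delta + harmonic k.

(** The parallelogram identity: the midpoint of two test functions is again one, so its residual has
    squared length at least [delta]. *)
Lemma residual_diff i j :
  N (fun x => residual (phi i) x - residual (phi j) x) ^+ 2
  <= 2 * (harmonic i + harmonic j).
Proof.
have li := residual_L2 (Dphi i); have lj := residual_L2 (Dphi j).
have h : residual (fun x => 2^-1 * phi i x + 2^-1 * phi j x)
    = (fun x => 2^-1 * residual (phi i) x + 2^-1 * residual (phi j) x).
  by apply/funext => x; rewrite /residual (shifted_lin _ _ (Dphi i) (Dphi j)); field.
have := delta_le (D_lin 2^-1 2^-1 (Dphi i) (Dphi j)); rewrite h.
rewrite (L2_parallelogram li lj); have := phi_min i; have := phi_min j; lra.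
Qed.

(** Moving [phi k] by [t u] lowers the squared length of the residual by at most [harmonic k], for
    every [t]; the discriminant of this quadratic polynomial gives the bound. *)
Lemma residual_orthogonal k u : D u ->
  ip (residual (phi k)) (shifted u) ^+ 2 <= harmonic k * ip (shifted u) (shifted u).
Proof.
move=> Du; have lk := residual_L2 (Dphi k); have lP := shifted_L2 Du.
apply: discriminant_le; first exact: L2_inner_ge0.
move=> t; have h : residual (fun x => 1 * phi k x + t * u x)
    = (fun x => 1 * residual (phi k) x + t * shifted u x).
  by apply/funext => x; rewrite /residual (shifted_lin _ _ (Dphi k) Du); ring.
have := delta_le (D_lin 1 t (Dphi k) Du); rewrite h (L2_inner_lin_sqr 1 t lk lP).
have := phi_min k.
set a := ip (residual (phi k)) (residual (phi k)).
set c := ip (shifted u) (shifted u).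
by move: (ip _ _) a c (harmonic k) => b a c s; lra.
Qed.

Lemma residual_cvg : exists2 r, L2_cvg (fun k => residual (phi k)) r &
  forall u, D u -> ip (shifted u) r = 0.
Proof.
have lr k : L2 m (residual (phi k)) := residual_L2 (Dphi k).
have h0 := @cvg_harmonic R.
have [r lr' rr] : exists2 r, L2 m r &
    (fun k => N (fun x => residual (phi k) x - r x)) @ \oo --> 0.
  apply: L2_complete => // e e0.
  have e2 : 0 < e ^+ 2 / 4 by rewrite divr_gt0// exprn_gt0.
  have /cvgr0Pnorm_lt/(_ _ e2)[K _ HK] := h0.
  exists K => i j Ki Kj; rewrite -(@ltr_pXn2r _ 2)// ?nnegrE ?L2_length_ge0 ?(ltW e0)//.
  apply: le_lt_trans (residual_diff i j) _.
  have := le_lt_trans (ler_norm _) (HK i Ki); have := le_lt_trans (ler_norm _) (HK j Kj).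
  by move: (harmonic i) (harmonic j) => s t; lra.
exists r => // u Du; have lP := shifted_L2 Du; rewrite L2_innerC.
have c := L2_cvg_inner (And3 lr lr' rr) lP.
have c2 : (fun k => ip (residual (phi k)) (shifted u) ^+ 2) @ \oo --> ip r (shifted u) ^+ 2.
  exact: (cvgM c c).
have c3 : (fun k => harmonic k * ip (shifted u) (shifted u)) @ \oo --> 0 * ip (shifted u) (shifted u).
  by apply: cvgM => //; exact: cvg_cst.
have : ip r (shifted u) ^+ 2 <= 0 * ip (shifted u) (shifted u).
  by apply: (ler_cvg_to c2 c3); apply: nearW => k; exact: residual_orthogonal.
by rewrite mul0r => h; apply/eqP; rewrite -sqrf_eq0 eq_le sqr_ge0 andbT.
Qed.

(** In a difference of residuals [w] cancels and [shifted (phi i - phi j)] remains; since [shifted]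
    is bounded below, the functions [phi k] form a Cauchy sequence along with their residuals. *)
Lemma minimiser_cvg : exists2 u, L2 m u &
  (fun k => N (fun x => phi k x - u x)) @ \oo --> 0.
Proof.
have [r [lr lr' rr] _] := residual_cvg.
apply: L2_complete => [k|e e0]; first exact: D_L2.
have e1 : 0 < (l' - l) * e / 2 by rewrite divr_gt0// mulr_gt0.
have /cvgr0Pnorm_lt/(_ _ e1)[K _ HK] := rr.
exists K => i j Ki Kj; rewrite -(ltr_pM2l kappa_gt0).
have E : (fun x => phi i x - phi j x) = (fun x => 1 * phi i x + (- 1) * phi j x).
  exact: L2_subE.
rewrite E; apply: le_lt_trans (shifted_coercive (D_lin 1 (- 1) (Dphi i) (Dphi j))) _.
have -> : shifted (fun x => 1 * phi i x + -1 * phi j x) =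
    (fun x => 1 * (residual (phi i) x - r x) + (- 1) * (residual (phi j) x - r x)).
  by apply/funext => x; rewrite (shifted_lin _ _ (Dphi i) (Dphi j)) /residual; ring.
apply: le_lt_trans (L2_length_lin _ _ (L2_sub (lr i) lr') (L2_sub (lr j) lr')) _.
rewrite normrN normr1 !mul1r.
have := le_lt_trans (ler_norm _) (HK i Ki); have := le_lt_trans (ler_norm _) (HK j Kj).
by lra.
Qed.

End Minimisation.

Lemma coercive_resolvent : resolvent_set m A l.
Proof.
split=> [w lw|]; last first.
  exists (l' - l)^-1 => u v Auv; have [lu lv _] := Auv.
  rewrite (L2_normE lu).
  have E : (fun x => v x - l * u x) = (fun x => 1 * v x + (- l) * u x).
    by apply/funext => x; ring.
  rewrite E (L2_normE (L2_lin 1 (- l) lv lu)) -EFinM lee_fin.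
  by rewrite mulrC ler_pdivlMr// mulrC; exact: closure_coercive.
have [phi [delta [Dphi dle phimin]]] := minimising_sequence w.
have [r [lr lr' rr] orth] := residual_cvg lw Dphi dle phimin.
have [u lu pu] := minimiser_cvg lw Dphi dle phimin.
have r0 : N r = 0.
  apply/eqP; rewrite eq_le L2_length_ge0 andbT -(ler_pM2l kappa_gt0) mulr0.
  apply: le_trans (closure_coercive (orthogonal_eigenvector lr' orth)) _.
  rewrite /L2_length (_ : ip _ _ = 0) ?sqrtr0//.
  rewrite /L2_inner (_ : (fun x => _) = cst 0); last by apply/funext => x /=; ring.
  by rewrite Rintegral_cst// mul0r.
have rc := L2_cvg_length (And3 lr lr' rr).
exists u; split=> //.
  have := L2_lin 1 l lw lu.
  by rewrite (_ : (fun x => _) = (fun x => w x + l * u x))//; apply/funext => x; rewrite mul1r.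
exists phi; split=> //.
  apply/(cvg_L2_norm (m := m)) => // k; apply: L2_sub => //; exact: D_L2.
have E k : L (phi k) \- (fun x => w x + l * u x)
    = (fun x => 1 * residual w (phi k) x + l * (phi k x - u x)).
  by apply/funext => x; rewrite /residual /shifted /=; ring.
have lE k := L2_sub (D_L2 (Dphi k)) lu.
rewrite (_ : (fun k => _) = (fun k => L2_norm m
  (fun x => 1 * residual w (phi k) x + l * (phi k x - u x)))); last first.
  by apply/funext => k; rewrite E.
apply/(cvg_L2_norm (m := m)) => [k|]; first exact: L2_lin.
have c : (fun k => N (residual w (phi k)) + `|l| * N (fun x => phi k x - u x)) @ \oo
    --> N r + `|l| * 0.
  by apply: cvgD => //; apply: cvgM => //; exact: cvg_cst.
rewrite r0 mulr0 addr0 in c; apply: (cvg_dominated (c := 1) c) => k.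
rewrite subr0 ger0_norm ?L2_length_ge0// mul1r.
have := L2_length_lin 1 l (lr k) (lE k); by rewrite normr1 mul1r.
Qed.

End Resolvent.
End Coercive.

(** * The Schroedinger operator *)

Transparent laplace_coord laplacian.

Lemma partial_lin (R : realType) (n : nat) (A : set 'rV[R]_n) (i : 'I_n) (s t : R) F H x :
  smooth_on A F -> smooth_on A H -> A x ->
  partial i (fun y => s * F y + t * H y) x = s * partial i F x + t * partial i H x.
Proof.
move=> sF sH Ax; have dF := smooth_on_is_derive i sF Ax; have dH := smooth_on_is_derive i sH Ax.
have dc (k : R) := is_derive_cst k x (delta_mx 0 i).
have [_ D] := is_derive_add (is_derive_mul (dc s) dF) (is_derive_mul (dc t) dH).
by apply: etrans D _; rewrite /= !mulr0 !addr0.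
Qed.

Lemma mul_sum_lin (R : realType) (n : nat) (a s t : R) (F H : 'I_n -> R) :
  a * \sum_i (s * F i + t * H i) = s * (a * \sum_i F i) + t * (a * \sum_i H i).
Proof. by rewrite big_split/= -!mulr_sumr mulrDr mulrCA (mulrCA a t). Qed.

Section LaplacianLinear.
Variables (R : realType) (n : nat) (M : ptopologicalType) (X : manifold R n M).
Variable g : metric X.
Local Notation img p := (chart X p @` chart_dom X p).
Local Notation inv := (chart_inv X).

(** The components of the gradient times the Riemannian density; the Laplacian is their coordinate
    divergence divided by the density. *)
Let flux p (u : M -> R) i y : R :=
  \sum_j Num.sqrt (\det (gram g p y)) * invmx (gram g p y) i j * partial j (u \o inv p) y.

Let smooth_flux p (u : M -> R) i : smooth X u -> smooth_on (img p) (flux p u i).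
Proof.
move=> su; have oI := @open_img _ _ _ X p.
apply: (smooth_on_sum oI) => j; apply: (smooth_onM oI).
  by apply: (smooth_onM oI); [exact: smooth_on_gram_sqrt_det|exact: smooth_on_gram_inv].
by apply: smooth_on_partial; exact: su.
Qed.

Lemma laplacian_lin (s t : R) (u v : M -> R) x : smooth X u -> smooth X v ->
  laplacian g (fun y => s * u y + t * v y) x = s * laplacian g u x + t * laplacian g v x.
Proof.
move=> su sv; have oI := @open_img _ _ _ X x; have ix := @img_self _ _ _ X x.
rewrite /laplacian /laplace_coord.
have E i : partial i (flux x (fun y => s * u y + t * v y) i) (chart X x x)
    = s * partial i (flux x u i) (chart X x x) + t * partial i (flux x v i) (chart X x x).
  rewrite -(partial_lin i s t (smooth_flux i su) (smooth_flux i sv) ix).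
  apply: (eq_partial oI i _ (mem_set ix)) => y /set_mem iy.
  rewrite /flux !mulr_sumr -big_split/=; apply: eq_bigr => j _.
  have D := partial_lin j s t (su x) (sv x) iy.
  rewrite (_ : partial j _ y = s * partial j (u \o inv x) y + t * partial j (v \o inv x) y).
    by ring.
  exact: D.
apply: etrans (mul_sum_lin (Num.sqrt (\det (gram g x (chart X x x))))^-1 s t
  (fun i => partial i (flux x u i) (chart X x x)) (fun i => partial i (flux x v i) (chart X x x))).
by congr (_ * _); apply: eq_bigr => i _; exact: E.
Qed.

Lemma laplacian_local_eq0 (U : set M) (u : M -> R) x : open U -> U x ->
  (forall y, U y -> u y = 0) -> laplacian g u x = 0.
Proof.
move=> oU Ux u0; rewrite /laplacian /laplace_coord big1 ?mulr0// => i _.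
rewrite -[RHS](derive_cst (0 : R) (chart X x x) (delta_mx 0 i)); apply: near_eq_derive.
apply: (@filterS _ _ (nbhs_filter (chart X x x)) _ _ _ (near_chart (chart_dom_mem X x) oU Ux)).
move=> y [iy Uy]; rewrite big1// => j _; have [Dy Ey] := chart_imgP iy.
by rewrite -[in partial _ _ _]Ey (partial_chart_eq0 j oU u0 Uy Dy) mulr0.
Qed.

End LaplacianLinear.

Opaque laplace_coord laplacian.

(** * From the quadratic form to the spectrum *)

Section SchrodingerOperator.
Variables (R : realType) (n : nat) (M : ptopologicalType) (X : manifold R n M).
Variables (g : metric X) (vol mu : {measure set (borel M) -> \bar R}).
Variables (f V : M -> R) (tau : R).
Hypothesis vol_def : is_riemannian_volume g vol.
Hypothesis f_smooth : smooth X f.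
Hypothesis tau_gt0 : 0 < tau.
Hypothesis mu_def : is_weighted_measure n vol f tau mu.
Hypothesis V_loc : locally_essentially_bounded vol V.
Local Notation D := (smooth_cpt X).
Local Notation L := (schrodinger g f V).

Lemma smooth_lin (s t : R) (u v : M -> R) : smooth X u -> smooth X v ->
  smooth X (fun x => s * u x + t * v x).
Proof. by move=> su sv; exact: (smoothD (smoothZ s su) (smoothZ t sv)). Qed.

Lemma smooth_cptP (u : M -> R) (K : set M) : smooth X u -> compact K ->
  (forall x, ~ K x -> u x = 0) -> D u.
Proof.
move=> su cK u0; split; first exact: su.
have clK := compact_manifold_closed X cK.
apply: (subclosed_compact _ cK); first exact: closed_closure.
rewrite [X in _ `<=` X](closure_id K).1//; apply: closure_subset => x /= ux.
by apply: contrapT => /u0 E; rewrite E eqxx in ux.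
Qed.

Lemma smooth_cpt_lin (s t : R) (u v : M -> R) : D u -> D v ->
  D (fun x => s * u x + t * v x).
Proof.
move=> Du Dv; have [K cK u0] := smooth_cpt_support Du.
have [K' cK' v0] := smooth_cpt_support Dv.
apply: (smooth_cptP (smooth_lin s t Du.1 Dv.1) (compactU cK cK')) => x nK.
rewrite u0 ?v0; [by rewrite !mulr0 addr0|by move=> h; apply: nK; right|].
by move=> h; apply: nK; left.
Qed.

Lemma smooth_cpt_neq0 : D !=set0.
Proof.
have s0 : smooth X (fun _ : M => 0) := @smooth_cst _ _ _ X (0 : R).
by exists (fun _ => 0); exact: (smooth_cptP s0 compact0 (fun _ _ => erefl)).
Qed.

Lemma schrodinger_lin (s t : R) (u v : M -> R) : D u -> D v ->
  forall x, L (fun y => s * u y + t * v y) x = s * L u x + t * L v x.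
Proof.
move=> [su _] [sv _] x; rewrite /schrodinger /drift_laplacian (laplacian_lin g s t x su sv).
rewrite !grad_innerE (grad_rowD x (smoothZ s su) (smoothZ t sv)).
rewrite (grad_rowZ s x su) (grad_rowZ t x sv) cometricDr !cometricZr.
move: (laplacian g u x) (laplacian g v x) => a b.
by move: (cometric _ _ _ _) (cometric _ _ _ _) => c e; ring.
Qed.

Lemma smooth_cpt_L2 (u : M -> R) : D u -> L2 mu u.
Proof.
move=> Du; have [K cK u0] := smooth_cpt_support Du.
apply/L2P; split; first exact: continuous_measurable (smooth_continuous Du.1).
exact: (integrable_mu_sqr vol_def f_smooth tau_gt0 mu_def Du.1 cK u0).
Qed.

Lemma drift_laplacian_support (u : M -> R) (K : set M) x : compact K ->
  (forall x, ~ K x -> u x = 0) -> ~ K x -> drift_laplacian g f u x = 0.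
Proof.
move=> cK u0 nK.
have oK : open (~` K) by apply: closed_openC; exact: (compact_manifold_closed X).
rewrite /drift_laplacian (laplacian_local_eq0 g oK nK u0) grad_innerE cometricC -grad_innerE.
by rewrite (grad_inner_support g f cK u0 nK) subr0.
Qed.

(** The potential is seen only on the compact support of [u], where it is essentially bounded. *)
Lemma schrodinger_L2 (u : M -> R) : D u -> L2 mu (L u).
Proof.
move=> Du; have [K cK u0] := smooth_cpt_support Du; have su := Du.1.
have cD := continuous_drift_laplacian vol_def f_smooth su.
have cu := smooth_continuous su.
have [mV VK] := V_loc; have [C HC] := VK K cK.
have [B B0 HB] := compact_continuous_bounded cK (fun x _ => cu x).
have l1 : L2 mu (drift_laplacian g f u).
  apply/L2P; split; first exact: (continuous_measurable cD).
  apply: (integrable_mu_continuous vol_def f_smooth tau_gt0 mu_def cK (continuous_comp_sqr cD)).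
  by move=> x nK; rewrite (drift_laplacian_support cK u0 nK) expr0n.
have l2 : L2 mu (fun x => V x * u x).
  have mVu : measurable_fun [set: borel M] ((fun x => V x * u x) : borel M -> R).
    by apply: measurable_funM => //; exact: (continuous_measurable cu).
  apply/L2P; split; first exact: mVu.
  apply: (integrable_mu_bounded vol_def f_smooth tau_gt0 mu_def (C := (C * B) ^+ 2) cK).
  - exact: measurable_funX.
  - have [N [mN N0 HN]] := HC; exists N; split=> // x /= nP; apply: HN => /= HCx.
    apply: nP => Kx; have CV := HCx Kx.
    rewrite normrX ler_pXn2r ?nnegrE//; last first.
      by rewrite mulr_ge0// (le_trans _ CV).
    by rewrite normrM ler_pM//; exact: HB.
  - by move=> x nK; rewrite (u0 x nK) mulr0 expr0n.
have := L2_lin (- 1) 1 l1 l2.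
rewrite (_ : (fun x => _) = L u)//; apply/funext => x.
by rewrite /schrodinger mulN1r mul1r.
Qed.

(** The weighted divergence theorem with both functions equal to [u]. *)
Lemma schrodinger_form (u : M -> R) : D u ->
  L2_inner mu (L u) u = \int[mu]_x (grad_inner g u u x + V x * u x ^+ 2) /\
  mu.-integrable setT
    (EFin \o ((fun x => grad_inner g u u x + V x * u x ^+ 2) : borel M -> R)).
Proof.
move=> Du; have [K cK u0] := smooth_cpt_support Du; have su := Du.1.
have iA := integrable_grad_sqr vol_def f_smooth tau_gt0 mu_def su cK u0.
have iV := integrable_mu_locally_bounded vol_def f_smooth tau_gt0 mu_def su cK u0 V_loc.
have i1 := integrableDr iA iV; split; last exact: i1.
have iL := L2_integrable_mul (schrodinger_L2 Du) (smooth_cpt_L2 Du).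
have iD : mu.-integrable setT (EFin \o ((fun x => u x * drift_laplacian g f u x
    + grad_inner g u u x) : borel M -> R)).
  have cD := continuous_drift_laplacian vol_def f_smooth su.
  have cg : continuous (grad_inner g u u) := continuous_grad_inner (g := g) su su.
  apply: (integrable_mu_continuous vol_def f_smooth tau_gt0 mu_def cK
    (continuous_mul_add (smooth_continuous su) cD cg)).
  by move=> x nK; exact: (mul_add0 _ (u0 x nK) (grad_inner_support g u cK u0 nK)).
have E := RintegralD measurableT iL iD.
rewrite (weighted_divergence vol_def f_smooth tau_gt0 mu_def su su cK u0) addr0 in E.
apply: etrans (esym E) _; apply: eq_Rintegral => x _; rewrite /schrodinger.
by move: (drift_laplacian g f u x) (grad_inner g u u x) => a b; ring.
Qed.

(** The Rayleigh infimum concerns functions of norm one, so [u] is divided by its length and both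
    sides scale quadratically. The scaled function is written as a linear combination with second
    coefficient 0, to reuse the closure of test functions under such combinations. *)
Lemma schrodinger_coercive (l : R) : (l%:E <= rayleigh_bottom g mu V)%E ->
  forall u, D u -> l * L2_inner mu u u <= L2_inner mu (L u) u.
Proof.
move=> lr u Du; have lu := smooth_cpt_L2 Du; have lLu := schrodinger_L2 Du.
(* A function of length zero cannot be normalised; both sides are then zero by Cauchy-Schwarz. *)
have [u0|u0] := eqVneq (L2_inner mu u u) 0.
  have : `|L2_inner mu (L u) u| <= 0.
    by apply: le_trans (L2_cauchy_schwarz lLu lu) _; rewrite {2}/L2_length u0 sqrtr0 mulr0.
  by rewrite normr_le0 u0 mulr0 => /eqP ->.
have q0 : 0 < L2_length mu u by rewrite sqrtr_gt0 lt_def u0 L2_inner_ge0.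
pose q := (L2_length mu u)^-1.
have Dv := smooth_cpt_lin q 0 Du Du.
have lv := smooth_cpt_L2 Dv.
have vE : (fun x => q * u x + 0 * u x) = (fun x => q * u x).
  by apply/funext => x; rewrite mul0r addr0.
have q2 : q ^+ 2 * L2_inner mu u u = 1.
  by rewrite -L2_length_sqr -exprMn mulVf ?expr1n// gt_eqF.
have vv : L2_inner mu (fun x => q * u x + 0 * u x) (fun x => q * u x + 0 * u x) = 1.
  by rewrite L2_inner_lin_sqr// mulr0 mul0r expr0n/= mul0r !addr0.
have Lv : L2_inner mu (L (fun x => q * u x + 0 * u x)) (fun x => q * u x + 0 * u x)
    = q ^+ 2 * L2_inner mu (L u) u.
  have -> : L (fun x => q * u x + 0 * u x) = (fun x => q * L u x + 0 * L u x).
    by apply/funext => x; exact: schrodinger_lin.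
  rewrite (L2_inner_linl q 0 lLu lLu lv) !(L2_inner_linr q 0 lu lu lLu).
  by ring.
have [FE iF] := schrodinger_form Dv.
have : (l%:E <= (L2_inner mu (L (fun x => q * u x + 0 * u x)) (fun x => q * u x + 0 * u x))%:E)%E.
  apply: (le_trans lr); rewrite FE -(EFin_Rintegral iF); apply: ereal_inf_lbound.
  exists (fun x => q * u x + 0 * u x) => //; split=> //.
  by rewrite (L2_innerE lv lv) vv.
rewrite lee_fin Lv => h.
have q2_gt0 : 0 < q ^+ 2 by rewrite exprn_gt0// invr_gt0.
by rewrite -(ler_pM2l q2_gt0) mulrCA q2 mulr1.
Qed.

Lemma le_spectrum_bottom (b : \bar R) : (b <= rayleigh_bottom g mu V)%E ->
  self_adjoint mu (operator_closure mu D L) ->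
  (b <= spectrum_bottom mu (operator_closure mu D L))%E.
Proof.
move=> br sa; apply/le_ereal_inf_tmp => _ [l ls <-]; rewrite leNgt; apply/negP => lb.
apply: ls; have lr := lt_le_trans lb br.
(* The coercivity constant must be real and strictly above [l]: it is the infimum itself when finite
   and [l + 1] when the infimum is [+oo], while [-oo] cannot lie above [l]. *)
have [l' ll' l'r] : exists2 l', l < l' & (l'%:E <= rayleigh_bottom g mu V)%E.
  move: lr; case: (rayleigh_bottom g mu V) => [r|_|//].
    by rewrite lte_fin => lr; exists r.
  by exists (l + 1); [rewrite ltrDl|rewrite leey].
exact: (coercive_resolvent (T := borel M) (m := mu) (D := D) (L := L) smooth_cpt_neq0
  smooth_cpt_lin schrodinger_lin smooth_cpt_L2 schrodinger_L2 ll' (schrodinger_coercive l'r) sa).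
Qed.

End SchrodingerOperator.

Unset Implicit Arguments.

(** The bottom of the spectrum has two descriptions, through the spectrum of the self-adjoint
    closure and through the quadratic form on test functions; each is bounded by one of the
    conjuncts. *)
Theorem theorem3p2 (R : realType) (n : nat) (M : ptopologicalType)
    (X : manifold R n M) (g : metric X) (f V Scal : M -> R) (tau : R)
    (vol mu : {measure set (borel M) -> \bar R})
    (M_connected : connected [set: M])
    (g_complete : riemannian_complete g)
    (f_smooth : smooth X f)
    (vol_def : is_riemannian_volume g vol)
    (Scal_def : is_scalar_curvature g Scal)
    (tau_gt0 : 0 < tau)
    (mu_def : is_weighted_measure n vol f tau mu)
    (V_Linfty_loc : locally_essentially_bounded vol V)
    (V_bounded_below : essentially_bounded_below vol V)
    (expV_L1 : mu.-integrable [set: borel M]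
       (fun x => (expR (- (4 * tau * V x)))%:E)) :
  let bound : \bar R :=
    ((- ((4 * tau)^-1 * ln (\int[mu]_x expR (- (4 * tau * V x))))%R)%:E
     + ((4 * tau)^-1)%:E * mu_functional g vol Scal tau
     + ((4 * tau)^-1)%:E *
       ereal_inf [set \int[mu]_x ((n%:R - f x
                        - tau * weighted_scalar_curvature g Scal f x)
                        * u x ^+ 2)%R%:E
                 | u in smooth_cpt_unit X mu])%E in
  let L_f := operator_closure mu (smooth_cpt X) (schrodinger g f V) in
  (self_adjoint mu L_f -> (bound <= spectrum_bottom mu L_f)%E) /\
  (bound <= rayleigh_bottom g mu V)%E.
Proof.
have H := spectral_bound_le_rayleigh vol_def Scal_def f_smooth tau_gt0 mu_def V_Linfty_loc
  expV_L1.
split=> [sa|]; last exact: H.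
exact: (le_spectrum_bottom vol_def f_smooth tau_gt0 mu_def V_Linfty_loc H sa).
Qed.
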